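(* Assume the setting, the assumptions on $F$ and the structural assumptions (i)-(iii) described in the context, and assume that the PDAJ algorithm does not terminate after finitely many steps. Then there are $\zeta\in(0,1)$ and $c>0$ such that $$ r_j(u_k)\le\widehat r_j(u_k)\le c\,\zeta^k $$ for all $k\in\mathbb N$ large enough.
   Context: Notation. $T>0$, $I=(0,T)$, $d\ge1$. $\mathcal C_0(I;\mathbb R^d)$ is the Banach space of continuous functions $I\to\mathbb R^d$ vanishing at the boundary of $I$, with $\|\varphi\|_{\mathcal C}=\sup_{t\in I}|\varphi(t)|_{\mathbb R^d}$ (Euclidean norm); its dual is the space $\mathcal M(I;\mathbb R^d)$ of vector measures with pairing $\langle\varphi,q\rangle$ and dual norm $\|q\|_{\mathcal M}$. $\mathrm{BV}(I;\mathbb R^d)$ is the space of $u\in L^1(I;\mathbb R^d)$ whose distributional derivative $u'$ lies in $\mathcal M(I;\mathbb R^d)$, with norm $\|u\|_{\mathrm{BV}}=\|u'\|_{\mathcal M}+\|u\|_{L^1}$. $\chi_t$ denotes the characteristic function of $(t,T)$. Problem. $Y$ is a Hilbert space, $K:L^2(I;\mathbb R^d)\to Y$ is linear and continuous with adjoint $K^*$, $F:Y\to\mathbb R$ is strictly convex and continuously Fréchet differentiable with gradient $\nabla F$, $\beta>0$, and $$(\mathcal P)\qquad \min_{u\in \mathrm{BV}(I;\mathbb R^d)} j(u)=F(Ku)+\beta\|u'\|_{\mathcal M},$$ where $j$ is radially unbounded: $\|u_k\|_{\mathrm{BV}}\to\infty$ implies $j(u_k)\to+\infty$. Problem $(\mathcal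 P)$ has a minimizer; all minimizers $\bar u$ share the same observation $\bar y=K\bar u$, hence the same dual variable $\bar p(t)=\int_0^tK^*\nabla F(\bar y)(s)\,ds$. Assumptions on $F$. $\nabla F$ is Lipschitz continuous on $Y$ with constant $L>0$, and there are a neighbourhood $\mathcal N(\bar y)$ of $\bar y$ and $\gamma_0>0$ with $F(y)\ge F(\bar y)+(\nabla F(\bar y),y-\bar y)_Y+\gamma_0\|y-\bar y\|_Y^2$ for all $y\in\mathcal N(\bar y)$. Structural assumptions. (i) There are $N\ge1$ and points $\bar t_1,\dots,\bar t_N\in I$ with $\{\bar t_i\}_{i=1}^N=\{t\in I: |\bar p(t)|_{\mathbb R^d}=\|\bar p\|_{\mathcal C}=\beta\}$. (ii) With $e_1,\dots,e_d$ the canonical basis of $\mathbb R^d$ and $\chi_I\equiv1$ on $I$, the family $\{K(\bar p(\bar t_i)\chi_{\bar t_i})\}_{i=1}^N\cup\{K(e_i\chi_I)\}_{i=1}^d$ is linearly independent in $Y$. Under (i),(ii) the minimizer $\bar u$ is unique and $\bar u'=\sum_{i=1}^N\bar\mu_i\bar{\mathbf v}_i\delta_{\bar t_i}$ with $\bar\mu_i\ge0$, $\bar{\mathbf v}_i=\bar p(\bar t_i)/\beta$. Fix $\sigma>0$, $R>0$ such that the intervals $(\bar t_i-R,\bar t_i+R)\subset I$ are pairwise disjoint and $|\bar p(t)|_{\mathbb R^d}\le\beta-\sigma$ for $t\in\bar I\setminus\bigcup_i(\bar t_i-R,\bar t_i+R)$. (iii) $\bar\mu_i>0$ for all $i$,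 there is $\theta_0>0$ with $\theta_0|t-\bar t_i|^2\le\beta-|\bar p(t)|_{\mathbb R^d}$ for all $t\in(\bar t_i-R,\bar t_i+R)$ and all $i$, and $K^*\in\mathcal L(Y;L^\infty(I;\mathbb R^d))$. Operators. $B(q,c)(t)=\int_0^t dq-\frac1T\int_0^T\int_0^s dq\,ds+c$ for $(q,c)\in\mathcal M(I;\mathbb R^d)\times\mathbb R^d$ (the BV function with derivative $q$ and mean $c$), and $\mathcal K=K\circ B$. PDAJ algorithm. A jump is a measure $v=\mathbf v\delta_t$ with $t\in I$, $\mathbf v\in\mathbb R^d$, $|\mathbf v|_{\mathbb R^d}=1$. Input: a finite active set $\mathcal A_0=\{(\mu_i^0,v_i^0)\}_{i=1}^{N_0}$ of positive magnitudes and jumps, $c^0\in\mathbb R^d$, $u_0=B(\sum_i\mu_i^0v_i^0,c^0)$. Initialization: take a minimizer $(\mu,c^1)$ of $F(\mathcal K(\sum_{i=1}^{N_0}\mu_iv_i^0,c))+\beta\sum_{i=1}^{N_0}\mu_i$ over $[0,\infty)^{N_0}\times\mathbb R^d$; $\mathcal A_1=\{(\mu_i^1,v_i^1)\}_{i=1}^{N_1}$ consists of those pairs $(\mu_i,v_i^0)$ with $\mu_i>0$, and $u_1=B(\sum_{i=1}^{N_1}\mu_i^1v_i^1,c^1)$. For $k=1,2,\dots$: set $p_k(t)=\int_0^tK^*\nabla F(Ku_k)(s)\,ds$ and choose $\hat t_k\in I$ with $|p_k(\hat t_k)|_{\mathbb R^d}=\|p_k\|_{\mathcal C}$. If $\|p_k\|_{\mathcal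 C}\le\beta$, terminate with output $u_k$. Otherwise let $\widehat v^k=(p_k(\hat t_k)/\|p_k\|_{\mathcal C})\delta_{\hat t_k}$ and take a minimizer $(\mu,c^{k+1})$ over $[0,\infty)^{N_k+1}\times\mathbb R^d$ of $F(\mathcal K(\mu_{N_k+1}\widehat v^k+\sum_{i=1}^{N_k}\mu_iv_i^k,c))+\beta\sum_{i=1}^{N_k+1}\mu_i$; $\mathcal A_{k+1}=\{(\mu_i^{k+1},v_i^{k+1})\}_{i=1}^{N_{k+1}}$ consists of the pairs among $(\mu_i,v_i^k)$, $i\le N_k$, and $(\mu_{N_k+1},\widehat v^k)$ with positive magnitude, and $u_{k+1}=B(\sum_i\mu_i^{k+1}v_i^{k+1},c^{k+1})$. Residuals. $r_j(u_k)=j(u_k)-\min j$ and $\widehat r_j(u_k)=F(Ku_k)+\beta\sum_{i=1}^{N_k}\mu_i^k-\min j$. *)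

(* Defs.v *)
From HB Require Import structures.
From mathcomp Require Import all_boot all_order all_algebra sesquilinear.
From mathcomp Require Import all_classical all_reals all_analysis.

Set Implicit Arguments.
Unset Strict Implicit.
Unset Printing Implicit Defensive.

Import Order.TTheory GRing.Theory Num.Theory.
Import numFieldNormedType.Exports.

Local Open Scope classical_set_scope.
Local Open Scope ring_scope.

(* Functions on I = (0, T) are represented by total functions on R whose values
   outside I are ignored; elements of Lebesgue spaces by representatives. *)

Section Euclidean.
Context {R : realType} {d : nat}.

Definition edot (v w : 'rV[R]_d) : R := \sum_(i < d) v 0 i * w 0 i.

(* The norm that the library puts on 'rV[R]_d is the maximum norm. *)
Definition enorm (v : 'rV[R]_d) : R := Num.sqrt (edot v v).

End Euclidean.

Section FunctionSpaces.
Context {R : realType} {d : nat}.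
Variable T : R.

Local Notation leb := (@lebesgue_measure R).
Local Notation I := (`]0, T[%classic : set R).

Definition inLp (p : nat) (u : R -> 'rV[R]_d) : Prop :=
  (forall i, measurable_fun (I : set (measurableTypeR R)) (fun t => u t 0 i)) /\
  leb.-integrable I (fun t => (enorm (u t) ^+ p)%:E).

Definition L1norm (u : R -> 'rV[R]_d) : R := \int[leb]_(t in I) enorm (u t).

Definition L2dot (u v : R -> 'rV[R]_d) : R :=
  \int[leb]_(t in I) edot (u t) (v t).

Definition L2norm (u : R -> 'rV[R]_d) : R := Num.sqrt (L2dot u u).

Definition inC0 (phi : R -> 'rV[R]_d) : Prop := forall i,
  [/\ {in I, continuous (fun t => phi t 0 i)},
      phi t 0 i @[t --> 0^'+] --> (0 : R) &
      phi t 0 i @[t --> T^'-] --> (0 : R)].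

Definition Cnorm (phi : R -> 'rV[R]_d) : R := sup [set enorm (phi t) | t in I].

Definition primitive (g : R -> 'rV[R]_d) (t : R) : 'rV[R]_d :=
  \row_i \int[leb]_(s in `]0, t[) g s 0 i.

Definition indic_after (t : R) (v : 'rV[R]_d) (s : R) : 'rV[R]_d :=
  \1_(`]t, T[%classic) s *: v.

End FunctionSpaces.

Section VectorMeasures.
Context {R : realType}.

Definition cintegral (nu : {charge set (measurableTypeR R) -> \bar R})
    (D : set R) (f : R -> R) : R :=
  let exP := cid (Hahn_decomposition nu) in
  let exN := cid (projT2 exP) in
  \int[jordan_pos (projT2 exN)]_(x in D) f x -
  \int[jordan_neg (projT2 exN)]_(x in D) f x.

Context {d : nat}.
Variable T : R.

Local Notation leb := (@lebesgue_measure R).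
Local Notation I := (`]0, T[%classic : set R).

(* A vector measure on I is given by its d components; charges live on the whole
   line and only their restriction to I is used. *)
Definition vmeasure := 'I_d -> {charge set (measurableTypeR R) -> \bar R}.

Definition vmass (q : vmeasure) (A : set R) : 'rV[R]_d :=
  \row_i fine (q i A).

Definition pairing (phi : R -> 'rV[R]_d) (q : vmeasure) : R :=
  \sum_(i < d) cintegral (q i) I (fun t => phi t 0 i).

Definition Mnorm (q : vmeasure) : R :=
  sup [set pairing phi q | phi in [set phi | inC0 T phi /\ Cnorm T phi <= 1]].

Definition test_function (phi : R -> R) : Prop :=
  (forall n x, derivable (derive1n n phi) x 1) /\
  exists a b, [/\ 0 < a, b < T & forall x, x \notin `[a, b] -> phi x = 0].

Definition is_distr_derivative (u : R -> 'rV[R]_d) (q : vmeasure) : Prop :=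
  forall phi, test_function phi -> forall i,
    cintegral (q i) I phi = - \int[leb]_(t in I) (u t 0 i * derive1 phi t).

Definition inBV (u : R -> 'rV[R]_d) : Prop :=
  inLp T 1 u /\ exists q, is_distr_derivative u q.

(* All charges representing u' agree on I, so they have the same norm. *)
Definition TV (u : R -> 'rV[R]_d) : R :=
  xget 0 [set Mnorm q | q in [set q | is_distr_derivative u q]].

Definition BVnorm (u : R -> 'rV[R]_d) : R := TV u + L1norm T u.

(* The integral of dq over (0, t) is taken over the open interval, so that for
   q = v \delta_s it is v times the indicator function of s < t. *)
Definition B_op (q : vmeasure) (c : 'rV[R]_d) (t : R) : 'rV[R]_d :=
  vmass q `]0, t[
  - T^-1 *: (\row_i \int[leb]_(s in I) vmass q `]0, s[ 0 i) + c.

(* The pair (v, t) stands for the measure v \delta_t. *)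
Definition jump := ('rV[R]_d * R)%type.

Definition is_jump (v : jump) : Prop := I v.2 /\ enorm v.1 = 1.

(* An active set is a list of pairs (mu, v) of a magnitude and a jump. *)
Definition jump_sum (A : seq (R * jump)) : vmeasure := fun i =>
  foldr (fun (x : R * jump) (nu : {charge set (measurableTypeR R) -> \bar R}) =>
      [the {charge set (measurableTypeR R) -> \bar R} of
        cadd (cscale (x.1 * x.2.1 0 i)
                     (charge_of_finite_measure \d_(x.2.2 : measurableTypeR R)))
             nu])
    [the {charge set (measurableTypeR R) -> \bar R} of czero] A.

End VectorMeasures.

Arguments vmeasure R d : clear implicits.
Arguments jump R d : clear implicits.

Section Operators.
Context {R : realType} {d : nat} {Y : completeNormedModType R}.
Variable T : R.

Definition lin_cont_L2 (K : (R -> 'rV[R]_d) -> Y) : Prop :=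
  (forall a u v, inLp T 2 u -> inLp T 2 v ->
     K (fun t => a *: u t + v t) = a *: K u + K v) /\
  exists C, forall u, inLp T 2 u -> `|K u| <= C * L2norm T u.

Definition is_adjoint (ip : {dot Y for idfun})
    (K : (R -> 'rV[R]_d) -> Y) (Kstar : Y -> R -> 'rV[R]_d) : Prop :=
  forall y, inLp T 2 (Kstar y) /\
    forall u, inLp T 2 u -> ip (K u) y = L2dot T u (Kstar y).

Definition cont_to_Linfty (Kstar : Y -> R -> 'rV[R]_d) : Prop :=
  exists C, forall y, {ae (@lebesgue_measure R),
    forall t, `]0, T[%classic t -> enorm (Kstar y t) <= C * `|y|}.

Definition strictly_convex (F : Y -> R) : Prop :=
  forall (x y : Y) (a : R), x != y -> 0 < a < 1 ->
    F (a *: x + (1 - a) *: y) < a * F x + (1 - a) * F y.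

Definition is_gradient (ip : {dot Y for idfun}) (F : Y -> R) (gradF : Y -> Y) :
    Prop :=
  forall y, differentiable (F : Y -> R^o) y /\
    forall h, 'd (F : Y -> R^o) y h = ip (gradF y) h.

Definition lin_indep (J : finType) (f : J -> Y) : Prop :=
  forall a : J -> R, \sum_j a j *: f j = 0 -> forall j, a j = 0.

End Operators.

Section Problem.
Context {R : realType} {d : nat} {Y : completeNormedModType R}.
Variables (T beta : R) (K : (R -> 'rV[R]_d) -> Y) (Kstar : Y -> R -> 'rV[R]_d).
Variables (F : Y -> R) (gradF : Y -> Y).

Definition objective (u : R -> 'rV[R]_d) : R := F (K u) + beta * TV T u.

Definition radially_unbounded : Prop :=
  forall w : nat -> R -> 'rV[R]_d, (forall k, inBV T (w k)) ->
    BVnorm T (w k) @[k --> \oo] --> +oo ->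
    objective (w k) @[k --> \oo] --> +oo.

Definition is_minimizer (u : R -> 'rV[R]_d) : Prop :=
  inBV T u /\ forall w, inBV T w -> objective u <= objective w.

Definition dual_var (u : R -> 'rV[R]_d) : R -> 'rV[R]_d :=
  primitive (Kstar (gradF (K u))).

Definition coeff_objective (vs : seq (jump R d)) (mu : seq R) (c : 'rV[R]_d) : R :=
  F (K (B_op T (jump_sum (zip mu vs)) c)) + beta * \sum_(m <- mu) m.

Definition admissible_coeffs (vs : seq (jump R d)) (mu : seq R) : bool :=
  (size mu == size vs) && all (fun m => 0 <= m) mu.

Definition minimizes_coeffs (vs : seq (jump R d)) (mu : seq R) (c : 'rV[R]_d) :
    Prop :=
  admissible_coeffs vs mu /\
  forall mu' c', admissible_coeffs vs mu' ->
    coeff_objective vs mu c <= coeff_objective vs mu' c'.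

Definition active_part (vs : seq (jump R d)) (mu : seq R) : seq (R * jump R d) :=
  [seq x <- zip mu vs | 0 < x.1].

Definition iterate (A : seq (R * jump R d)) (c : 'rV[R]_d) : R -> 'rV[R]_d :=
  B_op T (jump_sum A) c.

Definition new_jump (p : R -> 'rV[R]_d) (t : R) : jump R d :=
  ((Cnorm T p)^-1 *: p t, t).

(* An infinite run of the algorithm: active sets A k, offsets c k and chosen
   points that k, where the termination test fails at every k >= 1. *)
Record PDAJ_run (A : nat -> seq (R * jump R d)) (c : nat -> 'rV[R]_d)
    (that : nat -> R) : Prop := {
  run_input : forall x, x \in A 0%N -> 0 < x.1 /\ is_jump T x.2 ;
  run_init : exists mu,
    minimizes_coeffs (map snd (A 0%N)) mu (c 1%N) /\
    A 1%N = active_part (map snd (A 0%N)) mu ;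
  run_choice : forall k, (1 <= k)%N ->
    let p := dual_var (iterate (A k) (c k)) in
    `]0, T[%classic (that k) /\ enorm (p (that k)) = Cnorm T p ;
  run_no_stop : forall k, (1 <= k)%N ->
    beta < Cnorm T (dual_var (iterate (A k) (c k))) ;
  run_step : forall k, (1 <= k)%N ->
    let p := dual_var (iterate (A k) (c k)) in
    let vs := rcons (map snd (A k)) (new_jump p (that k)) in
    exists mu, minimizes_coeffs vs mu (c k.+1) /\ A k.+1 = active_part vs mu }.

End Problem.

(* Main.v *)
Require Import Defs.
From mathcomp Require Import all_boot all_order all_algebra sesquilinear.
From mathcomp Require Import all_classical all_reals all_analysis measurable_realfun.
From mathcomp Require Import ring lra.

(* Write kap s v for the observation K(v \chi_s), rhat for the residual, P for
   the maximum of |p_k| and eta for |K u_k - K ubar|. Optimality of the active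
   magnitudes and of the offset gives, by convexity, rhat <= M (P - beta), where M
   is the sum of the \bar\mu_i. The residual is also the Bregman distance of F
   between K ubar and K u_k plus the sum of mu (beta - v . pbar(s)) over the
   active jumps v \delta_s, so it controls gamma eta^2, the mass far from the
   \bar t_i, and, by (iii), the mean squared distance in Y between the observations
   of the active jumps near \bar t_i and of the optimal jump there. Comparing with
   the conditional gradient step yields rhat --> 0; linear independence of the
   observations then forces the active mass near each \bar t_i to tend to
   \bar\mu_i. For large k the new jump lies near some \bar t_i, and its distance to
   the optimal jump is O(eta). Moving mass tau from the active jumps near
   \bar t_i to the new one therefore changes the objective by at most
   - tau (P - beta) + C tau^2 rhat; since rhat <= M (P - beta), a small fixed tau
   makes the residual decrease by a constant factor.

   The boundedness of K^* into L^oo enters through the Lipschitz dependence of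
   kap on s. Passing from ubar to its jumps rests on the du Bois-Reymond lemma and
   on the density of test functions in C_0. *)

Set Implicit Arguments.
Unset Strict Implicit.
Unset Printing Implicit Defensive.

Import Order.TTheory GRing.Theory Num.Theory.
Import numFieldNormedType.Exports.

Local Open Scope classical_set_scope.
Local Open Scope ring_scope.

(** * Euclidean and inner product preliminaries *)

(** The convergence argument sees the problem only through the curves k_i(s) = K(chi_s e_i) in Y.
    [B_op] prescribes the mean, but the offset ranges over all of R^d and can be traded for the
    value left of the first jump; the observation then is a finite combination of points on these
    curves plus the observation of a constant. A conditional gradient step alone has a quadratic
    error of fixed size, which gives no linear rate. The swap has an error proportional to the
    residual because the new jump is linearly close to the optimal one in eta, not merely of order
    sqrt(eta). This needs p_k - pbar to be small as a Lipschitz function of time and not only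
    uniformly. On the side of ubar only the derivative is given, and its norm is a supremum over
    C_0. Testing with pbar / beta recovers the mass; pbar is admissible there because constants
    carry no penalty, which makes it vanish at T. *)

Section EuclideanNorm.
Context {R : realType} {d : nat}.
Implicit Types u v w : 'rV[R]_d.

Lemma edotC v w : edot v w = edot w v.
Proof. by apply: eq_bigr => i _; rewrite mulrC. Qed.

Lemma edotDl u v w : edot (u + v) w = edot u w + edot v w.
Proof. by rewrite -big_split; apply: eq_bigr => i _; rewrite mxE mulrDl. Qed.

Lemma edotZl a v w : edot (a *: v) w = a * edot v w.
Proof. by rewrite [RHS]mulr_sumr; apply: eq_bigr => i _; rewrite mxE mulrA. Qed.

Lemma edotDr u v w : edot u (v + w) = edot u v + edot u w.
Proof. by rewrite edotC edotDl !(edotC u). Qed.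

Lemma edotZr a v w : edot v (a *: w) = a * edot v w.
Proof. by rewrite edotC edotZl edotC. Qed.

Lemma edotNl v w : edot (- v) w = - edot v w.
Proof. by rewrite -scaleN1r edotZl mulN1r. Qed.

Lemma edotBr u v w : edot u (v - w) = edot u v - edot u w.
Proof. by rewrite edotDr -scaleN1r edotZr mulN1r. Qed.

Lemma edotBl u v w : edot (u - v) w = edot u w - edot v w.
Proof. by rewrite !(edotC _ w) edotBr. Qed.

Lemma edot_ge0 v : 0 <= edot v v.
Proof. by apply: sumr_ge0 => i _; rewrite -expr2 sqr_ge0. Qed.

Lemma edot_delta i v : edot (delta_mx 0 i) v = v 0 i.
Proof.
rewrite /edot (bigD1 i) //= mxE !eqxx mul1r big1 ?addr0 // => j ji.
by rewrite mxE (negPf ji) mul0r.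
Qed.

Lemma enorm_ge0 v : 0 <= enorm v.
Proof. exact: sqrtr_ge0. Qed.

Lemma sqr_enorm v : enorm v ^+ 2 = edot v v.
Proof. by rewrite sqr_sqrtr // edot_ge0. Qed.

Lemma enorm0 : enorm (0 : 'rV[R]_d) = 0.
Proof. by rewrite /enorm -(scale0r 0) edotZl mul0r sqrtr0. Qed.

Lemma enormZ a v : enorm (a *: v) = `|a| * enorm v.
Proof.
by rewrite /enorm edotZl edotZr mulrA -expr2 sqrtrM ?sqr_ge0 // sqrtr_sqr.
Qed.

Lemma enormN v : enorm (- v) = enorm v.
Proof. by rewrite -scaleN1r enormZ normrN1 mul1r. Qed.

Lemma enorm_delta i : enorm (delta_mx 0 i : 'rV[R]_d) = 1.
Proof. by rewrite /enorm edot_delta mxE !eqxx sqrtr1. Qed.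

(** Cauchy-Schwarz, from the square of (w.w) v - (v.w) w, which avoids dividing by w.w; if w.w = 0,
    every coordinate of w vanishes. *)
Lemma edot_le v w : edot v w <= enorm v * enorm w.
Proof.
have [w0|w0] := eqVneq (edot w w) 0.
  suff -> : edot v w = 0 by rewrite mulr_ge0 // enorm_ge0.
  rewrite /edot big1 // => i _; apply/eqP; rewrite mulf_eq0 -[w 0 i == 0]sqrf_eq0.
  move/eqP: w0; rewrite psumr_eq0 => [|j _]; last by rewrite -expr2 sqr_ge0.
  by move=> /allP/(_ i); rewrite mem_index_enum -expr2 => /(_ isT) /= ->; rewrite orbT.
have {}w0 : 0 < edot w w by rewrite lt_def w0 edot_ge0.
have := edot_ge0 (edot w w *: v - edot v w *: w).
rewrite edotBl !edotBr !edotZl !edotZr (edotC w v) -!sqr_enorm => h.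
have {}h : edot v w ^+ 2 <= (enorm v * enorm w) ^+ 2.
  rewrite -(ler_pM2l w0) -sqr_enorm; lra.
apply: le_trans (ler_norm _) _.
by rewrite -(ler_pXn2r (n := 2)) ?nnegrE ?mulr_ge0 ?enorm_ge0 // -normrX ger0_norm ?sqr_ge0.
Qed.

Lemma enormD v w : enorm (v + w) <= enorm v + enorm w.
Proof.
rewrite -(ler_pXn2r (n := 2)) ?nnegrE ?addr_ge0 ?enorm_ge0 //.
rewrite sqr_enorm edotDl !edotDr -!sqr_enorm (edotC w v).
have := edot_le v w; lra.
Qed.

Lemma coord_le_enorm v i : `|v 0 i| <= enorm v.
Proof.
rewrite -edot_delta ler_norml -{1}(mul1r (enorm v)) lerNl -(enorm_delta i) -edotNl.
by rewrite -{1}enormN !edot_le /= -[leRHS]mul1r -(enorm_delta i) edot_le.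
Qed.

Lemma enorm_le_sum v : enorm v <= \sum_i `|v 0 i|.
Proof.
rewrite -(ler_pXn2r (n := 2)) ?nnegrE ?enorm_ge0 ?sumr_ge0 //.
rewrite sqr_enorm expr2 mulr_suml; apply: ler_sum => i _.
rewrite -expr2 -real_normK ?num_real // expr2 ler_wpM2l //.
by rewrite (bigD1 i) //= lerDl sumr_ge0.
Qed.

End EuclideanNorm.

Section InnerProduct.
Context {R : realType} {Y : completeNormedModType R}.
Variable ip : {dot Y for idfun}.
Hypothesis hip : forall y, ip y y = `|y| ^+ 2.
Implicit Types x y z : Y.

Lemma ipC x y : ip x y = ip y x.
Proof. by rewrite (hermC ip) expr0 mul1r. Qed.

Lemma ipZl a x y : ip (a *: x) y = a * ip x y.
Proof. exact: linearZl_LR. Qed.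

Lemma ipZr a x y : ip x (a *: y) = a * ip x y.
Proof. by rewrite ipC ipZl ipC. Qed.

Lemma ip_sumr x (I : Type) (r : seq I) (P : pred I) (f : I -> Y) :
  ip x (\sum_(i <- r | P i) f i) = \sum_(i <- r | P i) ip x (f i).
Proof. exact: linear_sumr. Qed.

Lemma ler_ip x y : `|ip x y| <= `|x| * `|y|.
Proof.
have [->|y0] := eqVneq y 0; first by rewrite linear0r !normr0 mulr0.
have {}y0 : 0 < ip y y by rewrite hip exprn_gt0 // normr_gt0.
have : 0 <= ip (ip y y *: x - ip x y *: y) (ip y y *: x - ip x y *: y).
  by rewrite hip sqr_ge0.
rewrite linearBl !linearBr /= !ipZl !ipZr (ipC y x) => h.
rewrite -(ler_pXn2r (n := 2)) ?nnegrE ?mulr_ge0 // real_normK ?num_real //.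
rewrite exprMn -!hip -(ler_pM2l y0); lra.
Qed.

End InnerProduct.

(** * Convex functions with Lipschitz gradient and local quadratic growth *)

Section Smoothness.
Context {R : realType} {Y : completeNormedModType R}.
Variable ip : {dot Y for idfun}.
Hypothesis hip : forall y, ip y y = `|y| ^+ 2.
Variables (F : Y -> R) (gradF : Y -> Y) (L : R).
Hypothesis cvxF : forall x y, F x + ip (gradF x) (y - x) <= F y.
Hypothesis lipF : forall x y, `|gradF x - gradF y| <= L * `|x - y|.
Implicit Types x y z h : Y.

(* By convexity [F y >= F (y + h) - ip (gradF (y + h)) h], which spares the
   integration along the segment at the price of the factor 1/2. *)
Lemma descent y h : F (y + h) <= F y + ip (gradF y) h + L * `|h| ^+ 2.
Proof.
have := cvxF (y + h) y; rewrite opprD addrA subrr add0r linearNr => h1.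
have := ler_ip hip (gradF (y + h) - gradF y) h; rewrite linearBl.
have := lipF (y + h) y; rewrite [y + h - y]addrC addKr => h2 /(le_trans (ler_norm _)) h3.
have := ler_wpM2r (normr_ge0 h) h2; rewrite -mulrA -expr2; lra.
Qed.

(** The term [t * b] is the change of the mass penalty: 0 when the offset moves, beta times a mass
    when magnitudes are scaled by 1 + t, which stay nonnegative for |t| <= 1. The first-order
    condition comes from [descent] at a single explicit step instead of a limit. *)
Lemma stationary y h b :
  (forall t, `|t| <= 1 -> F y <= F (y + t *: h) + t * b) ->
  ip (gradF y) h + b = 0.
Proof.
move=> hmin; set a := ip _ _ + b; set q := L * `|h| ^+ 2.
(* [L] carries no sign here; a negative [q] would force L < 0 and h nonzero, against [lipF] at h and
   0. *)
have [q0|q0] := leP 0 q; last first.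
  have hp : 0 < q * -1 by rewrite mulrN1 oppr_gt0.
  have h0 : 0 < `|h| ^+ 2.
    rewrite lt_def sqr_ge0 andbT; apply/eqP => h0; move: hp.
    by rewrite /q h0 mulr0 mul0r ltxx.
  have L0 : L < 0 by move: q0; rewrite /q pmulr_llt0.
  have hn : 0 < `|h| by rewrite lt_def normr_ge0 andbT -sqrf_eq0 gt_eqF.
  have := lipF h 0; rewrite subr0 => /(le_trans (normr_ge0 _)).
  by rewrite leNgt nmulr_rlt0 // hn.
(* D dominates |a|, which keeps the step - a / D in [-1, 1], and exceeds q, which makes t a + t^2 q
   negative at that step unless a = 0. *)
have D0 : 0 < `|a| + q + 1 by rewrite ltr_wpDl ?addr_ge0.
set D := `|a| + q + 1 in D0.
have tD : `| - a / D| <= 1.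
  rewrite normrM normrN normfV (gtr0_norm D0) ler_pdivrMr // mul1r /D; lra.
have := le_trans (hmin _ tD) (lerD (descent y ((- a / D) *: h)) (lexx _)).
rewrite ipZr normrZ exprMn real_normK ?num_real // => H.
have {H} : 0 <= (- a / D) * a + (- a / D) ^+ 2 * q.
  by move: (- a / D) H => t H; rewrite /a /q; lra.
have -> : (- a / D) * a + (- a / D) ^+ 2 * q = - (a ^+ 2 * ((D - q) / D ^+ 2)).
  by field; rewrite gt_eqF.
rewrite oppr_ge0 pmulr_lle0 => [|]; last first.
  by rewrite divr_gt0 ?exprn_gt0 // /D; have := normr_ge0 a; lra.
by move=> ha; apply/eqP; rewrite -sqrf_eq0 eq_le ha sqr_ge0.
Qed.

Variables (ybar : Y) (gamma e : R).
Hypotheses (gamma0 : 0 < gamma) (e0 : 0 < e).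
Hypothesis growth : forall y, `|y - ybar| <= e ->
  F ybar + ip (gradF ybar) (y - ybar) + gamma * `|y - ybar| ^+ 2 <= F y.

Definition bregman y := F y - F ybar - ip (gradF ybar) (y - ybar).

Lemma bregman_ge0 y : 0 <= bregman y.
Proof. rewrite /bregman; have := cvxF ybar y; lra. Qed.

(** Growth is assumed only within distance e of [ybar]. Beyond it convexity takes over: the Bregman
    distance is already gamma e^2 at the point z where the segment to y leaves the ball, and it
    grows at least linearly from there. *)
Lemma bregman_far y : e <= `|y - ybar| -> gamma * e * `|y - ybar| <= bregman y.
Proof.
move=> ey; have n0 := lt_le_trans e0 ey; set n := `|y - ybar| in n0 ey *.
set s := e / n; have s0 : 0 < s by rewrite divr_gt0.
have s1 : s <= 1 by rewrite ler_pdivrMr ?mul1r.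
pose z := ybar + s *: (y - ybar).
have zy : z - ybar = s *: (y - ybar) by rewrite /z addrC addKr.
have yz : y - z = (1 - s) *: (y - ybar).
  by rewrite /z scalerBl scale1r opprD addrA.
have zb : ybar - z = - (s *: (y - ybar)) by rewrite -zy opprB.
have nz : `|z - ybar| = e.
  by rewrite zy normrZ gtr0_norm // /s mulfVK ?gt_eqF.
have := growth (y := z); rewrite nz lexx zy ipZr => /(_ isT) h1.
(* The tangent at z is evaluated at both ends of the segment; with weights s and 1 - s its gradient
   terms cancel. *)
have h2 := cvxF z y; rewrite yz ipZr in h2.
have h3 := cvxF z ybar; rewrite zb linearNr /= ipZr in h3.
set q := ip (gradF z) _ in h2 h3; set p := ip (gradF ybar) _ in h1 *.
have h4 : gamma * e ^+ 2 <= s * bregman y.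
  have a1 := ler_wpM2l (ltW s0) h2.
  have s1' : 0 <= 1 - s by rewrite subr_ge0.
  have a2 := ler_wpM2l s1' h3.
  rewrite /bregman -/p; move: h1 a1 a2; rewrite !mulrDr !mulrDl !mulrN; lra.
rewrite -(ler_pM2l s0); apply: le_trans h4.
by rewrite mulrCA /s mulfVK ?gt_eqF // expr2 mulrA.
Qed.

Lemma bregman_near y : bregman y < gamma * e ^+ 2 ->
  gamma * `|y - ybar| ^+ 2 <= bregman y.
Proof.
move=> h; have [ey|ye] := leP e `|y - ybar|.
  have := bregman_far ey.
  have : gamma * e ^+ 2 <= gamma * e * `|y - ybar|.
    by rewrite expr2 mulrA ler_pM2l // mulr_gt0.
  lra.
have := growth (ltW ye); rewrite /bregman; lra.
Qed.

(** A crude bound valid at every distance; with a monotone residual it bounds the observations along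
    the whole run. *)
Lemma bregman_bounds y : `|y - ybar| <= e + bregman y / (gamma * e).
Proof.
have g0 : 0 < gamma * e by rewrite mulr_gt0.
have [ey|ye] := leP e `|y - ybar|.
  have := bregman_far ey; rewrite mulrC -ler_pdivlMr // => h.
  by rewrite (le_trans h) // lerDr ltW.
by rewrite (le_trans (ltW ye)) // lerDl divr_ge0 ?bregman_ge0 // ltW.
Qed.

End Smoothness.

Section GradientInequality.
Context {R : realType} {Y : completeNormedModType R}.
Variable ip : {dot Y for idfun}.
Variables (F : Y -> R) (gradF : Y -> Y).

Lemma convex_gradient : strictly_convex F -> is_gradient ip F gradF ->
  forall x y, F x + ip (gradF x) (y - x) <= F y.
Proof.
move=> cF gF x y; have [->|xy] := eqVneq y x.
  by rewrite subrr linear0r addr0.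
have [dF dE] := gF x; rewrite -dE -deriveE //.
suff : 'D_(y - x) (F : Y -> R^o) x <= F y - F x by lra.
have dv : derivable (F : Y -> R^o) x (y - x) by exact: diff_derivable.
have {}dv : h^-1 *: ((F \o shift x) (h *: (y - x)) - F x : R^o) @[h --> 0^'+] -->
    'D_(y - x) (F : Y -> R^o) x by exact: (cvg_dnbhs_at_right dv).
apply: (@cvgr_to_le _ _ _ R _ _ _ dv).
near=> h; rewrite /= /GRing.scale /=.
have h0 : 0 < h by [].
have h1 : h < 1 by near: h; exact: nbhs_right_lt.
rewrite mulrC ler_pdivrMr //.
have -> : h *: (y - x) + x = h *: y + (1 - h) *: x.
  by rewrite scalerBr scalerBl scale1r addrAC addrA.
by have := cF y x h xy; rewrite h0 h1 => /(_ isT); lra.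
Unshelve. all: by end_near. Qed.

End GradientInequality.

(** * Scalar inequalities and recursions *)

Section ScalarSequences.
Context {R : realType}.

Lemma weighted_sq_sum (I : eqType) (s : seq I) (P : pred I) (w a : I -> R) :
  {in s, forall x, 0 <= w x} ->
  (\sum_(x <- s | P x) w x * a x) ^+ 2 <=
  (\sum_(x <- s | P x) w x) * \sum_(x <- s | P x) w x * a x ^+ 2.
Proof.
move=> w0; set m := \sum_(x <- s | P x) w x.
set b := \sum_(x <- s | P x) w x * a x.
set q := \sum_(x <- s | P x) w x * a x ^+ 2.
have m0 : 0 <= m by rewrite /m big_seq_cond sumr_ge0 // => x /andP[/w0].
(* This is the sum of w (u a - t)^2. The choice t = b, u = m settles m > 0; for m = 0 and b nonzero,
   u = 1 and t = (q + 1) / b turn it into - q - 2, although q >= 0. *)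
have h t u : 0 <= u ^+ 2 * q - 2 * (t * u) * b + t ^+ 2 * m.
  rewrite /q /b /m !mulr_sumr -sumrB -big_split /= big_seq_cond sumr_ge0 //.
  move=> x /andP[/w0 wx _].
  have -> : u ^+ 2 * (w x * a x ^+ 2) - 2 * (t * u) * (w x * a x) + t ^+ 2 * w x
     = w x * (u * a x - t) ^+ 2 by ring.
  by rewrite mulr_ge0 // sqr_ge0.
have [m0'|m0'] := eqVneq m 0; last first.
  have {}m0 : 0 < m by rewrite lt_def m0' m0.
  by have := h b m => H; rewrite -(ler_pM2l m0); lra.
have [->|b0] := eqVneq b 0; first by rewrite m0' mul0r expr0n.
have := h ((q + 1) / b) 1; rewrite m0' mul0r mulr0 addr0 expr1n mul1r mulr1.
have -> : q - 2 * ((q + 1) / b) * b = - q - 2 by field.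
have : 0 <= q by rewrite /q big_seq_cond sumr_ge0 // => x /andP[/w0 wx _]; rewrite mulr_ge0 ?sqr_ge0.
lra.
Qed.

(** The recursion of the conditional gradient method. If r stayed above eps, one fixed s would
    produce a fixed decrease at every step and r would become negative. *)
Lemma quadratic_decrease_cvg0 (r : nat -> R) (Q : R) : 0 <= Q ->
  (forall n, 0 <= r n) ->
  (forall n s, 0 <= s <= 1 -> r n.+1 <= r n - s * r n + s ^+ 2 * Q) ->
  forall eps, 0 < eps -> \forall n \near \oo, r n < eps.
Proof.
move=> Q0 r0 hr eps eps0.
have mono m n : (m <= n)%N -> r n <= r m.
  elim: n => [|n ih]; first by rewrite leqn0 => /eqP ->.
  rewrite leq_eqVlt => /predU1P[-> //|/ih]; apply: le_trans.
  by have := hr n 0; rewrite lexx ler01 mul0r expr0n mul0r subr0 addr0; exact.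
suff [n hn] : exists n, r n < eps.
  by exists n => // m /= nm; exact: le_lt_trans (mono _ _ nm) hn.
apply: contrapT => /forallNP H.
have {}H n : eps <= r n by rewrite leNgt; exact/negP.
(* With this s the quadratic term is at most half of the linear one while r >= eps, so every step
   loses s eps / 2. *)
pose s := eps / (2 * Q + eps).
have D0 : 0 < 2 * Q + eps by rewrite ltr_wpDl // mulr_ge0.
have s0 : 0 < s by rewrite divr_gt0.
have s1 : s <= 1 by rewrite ler_pdivrMr // mul1r lerDr mulr_ge0.
have sQ : s * Q <= eps / 2.
  rewrite /s mulrAC ler_pdivrMr //; have := mulr_ge0 (ltW eps0) (ltW eps0); lra.
have step n : r n.+1 <= r n - s * (eps / 2).
  apply: le_trans (hr n s _) _; first by rewrite (ltW s0) s1.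
  have := ler_wpM2l (ltW s0) (H n); have := ler_wpM2l (ltW s0) sQ.
  rewrite expr2 -mulrA; lra.
have lin n : r n <= r 0%N - n%:R * (s * (eps / 2)).
  elim: n => [|n ih]; first by rewrite mul0r subr0.
  have := step n; rewrite -[n.+1]addn1 natrD; lra.
have c0 : 0 < s * (eps / 2) by rewrite mulr_gt0 // divr_gt0.
have := lin (Num.bound (r 0%N / (s * (eps / 2)))).
have := r0 (Num.bound (r 0%N / (s * (eps / 2)))).
have : r 0%N < (Num.bound (r 0%N / (s * (eps / 2))))%:R * (s * (eps / 2)).
  by rewrite -ltr_pdivrMr // archi_boundP // divr_ge0 // ltW.
lra.
Qed.

Lemma linear_decrease (r : nat -> R) (z : R) : 0 < z ->
  (\forall n \near \oo, r n.+1 <= z * r n) ->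
  exists2 C, 0 < C & \forall n \near \oo, r n <= C * z ^+ n.
Proof.
move=> z0 [n0 _ h].
(* The division by z^n0 accounts for the decrease starting only at n0; the summand 1 keeps the
   constant positive when r n0 = 0. *)
exists (`|r n0| / z ^+ n0 + 1).
  by rewrite ltr_wpDl // divr_ge0 // exprn_ge0 // ltW.
exists n0 => // n /= /subnKC <-; elim: (n - n0)%N => [|m ih].
  rewrite addn0 mulrDl mul1r mulfVK ?expf_neq0 ?gt_eqF //.
  by rewrite ler_wpDr ?ler_norm // exprn_ge0 // ltW.
rewrite addnS; apply: le_trans (h _ _) _; first exact: leq_addr.
rewrite exprS mulrCA.
by rewrite ler_pM2l.
Qed.

End ScalarSequences.

Section DualFamily.
Context {R : realType} {Y : completeNormedModType R}.
Variable ip : {dot Y for idfun}.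
Hypothesis hip : forall y, ip y y = `|y| ^+ 2.

(** The coefficients of w i are a row of the inverse Gram matrix. A vector in the kernel of that
    matrix gives a combination of the f j of norm 0, so independence makes it invertible. Pairing
    with w i later isolates the mass near one optimal jump. *)
Lemma dual_family (J : finType) (f : J -> Y) : lin_indep f ->
  exists w : J -> Y, forall i j, ip (w i) (f j) = (i == j)%:R.
Proof.
move=> indep; pose e (i : 'I_#|J|) : J := enum_val i.
pose G : 'M[R]_#|J| := \matrix_(i, j) ip (f (e i)) (f (e j)).
have uG : G \in unitmx.
  rewrite -row_free_unit -kermx_eq0; apply/eqP/row_matrixP => k.
  rewrite row0; set u := row k (kermx G).
  have uG0 : u *m G = 0 by rewrite /u -row_mul mulmx_ker row0.
  clearbody u.
  pose y := \sum_i u 0 i *: f (e i).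
  have y0 : y = 0.
    apply/eqP; rewrite -normr_eq0 -sqrf_eq0 -hip {1}/y linear_sumlz /=.
    rewrite big1 // => i _.
    have := congr1 (fun M : 'rV_ _ => M 0 i) uG0; rewrite mxE [RHS]mxE => uGi.
    have -> : ip (u 0 i *: f (e i)) y = u 0 i * \sum_j u 0 j * G j i.
      rewrite ipZl /y ip_sumr; congr (_ * _); apply: eq_bigr => j _.
      by rewrite ipZr (ipC ip) mxE.
    by rewrite uGi mulr0.
  have h : forall j, u 0 (enum_rank j) = 0.
    apply: indep; rewrite -[RHS]y0 /y (reindex_onto e (@enum_rank J)) /=.
      rewrite (eq_bigl xpredT) => [|i]; last by rewrite enum_valK eqxx.
      by apply: eq_bigr => i _; rewrite enum_valK.
    by move=> j _; rewrite /e enum_rankK.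
  by apply/rowP => i; rewrite -[i]enum_valK h mxE.
exists (fun i => \sum_l invmx G (enum_rank i) l *: f (e l)) => i j.
rewrite linear_sumlz /=.
transitivity ((invmx G *m G) (enum_rank i) (enum_rank j)).
  by rewrite mxE; apply: eq_bigr => l _; rewrite ipZl mxE /e enum_rankK.
by rewrite mulVmx // mxE (inj_eq enum_rank_inj).
Qed.

End DualFamily.

(** * Linear convergence in terms of the observations of jumps *)

Lemma sumr_const_ord (V : nmodType) d (a : V) : \sum_(i < d) a = a *+ d.
Proof. by rewrite sumr_const card_ord. Qed.

(** Meant for values p, q of pbar at two times and perturbations a, b of it there. Every term on the
    right contains p - q or a - b, and both are Lipschitz in time, so the whole bound carries a
    factor of the distance between the times. Bounding by |a| + |b| would lose this factor. *)
Lemma sqr_enorm_diff (R : realType) d (p q a b : 'rV[R]_d) :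
  enorm (q + b) ^+ 2 <= enorm (p + a) ^+ 2 ->
  enorm q ^+ 2 - enorm p ^+ 2 <=
  2 * (edot (p - q) a + edot q (a - b)) + edot (a - b) (a + b).
Proof.
rewrite !sqr_enorm !edotBl !edotBr !edotDl !edotDr.
rewrite (edotC a p) (edotC b q) (edotC b a); lra.
Qed.

(** * Observations of jumps as points on Lipschitz curves *)

Section JumpOperator.
Context {R : realType} {Y : completeNormedModType R} {d : nat}.
Variable ip : {dot Y for idfun}.
Hypothesis hip : forall y, ip y y = `|y| ^+ 2.
Variables (k : 'I_d -> R -> Y) (T Ck : R).
Hypotheses (T0 : 0 < T) (Ck0 : 0 <= Ck).
Hypothesis lipk : forall i s t, 0 <= s <= T -> 0 <= t <= T ->
  `|k i s - k i t| <= Ck * `|s - t|.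
Implicit Types (s t : R) (v w : 'rV[R]_d) (g h : Y) (A : seq (R * jump R d)).

Definition kap s v : Y := \sum_i v 0 i *: k i s.

(* When [k i s] is the image under K of the [i]-th unit vector times \chi_s, this
   is the integral of [Kstar g] over (0, t). *)
Definition pvar g t : 'rV[R]_d := \row_i ip (k i 0 - k i t) g.

Lemma kapD s v w : kap s (v + w) = kap s v + kap s w.
Proof. by rewrite -big_split; apply: eq_bigr => i _; rewrite mxE scalerDl. Qed.

Lemma kapZ s a v : kap s (a *: v) = a *: kap s v.
Proof. by rewrite scaler_sumr; apply: eq_bigr => i _; rewrite mxE scalerA. Qed.

Lemma kapB s v w : kap s (v - w) = kap s v - kap s w.
Proof. by rewrite kapD -scaleN1r kapZ scaleN1r. Qed.

Lemma kap_delta s i : kap s (delta_mx 0 i) = k i s.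
Proof.
rewrite /kap (bigD1 i) //= mxE !eqxx scale1r big1 ?addr0 // => j ji.
by rewrite mxE (negPf ji) scale0r.
Qed.

Definition kap_bound : R := \sum_i (`|k i 0| + Ck * T).

Lemma kap_bound_ge0 : 0 <= kap_bound.
Proof. by apply: sumr_ge0 => i _; rewrite addr_ge0 ?mulr_ge0 // ltW. Qed.

Lemma kap_le s v : 0 <= s <= T -> `|kap s v| <= kap_bound * enorm v.
Proof.
move=> sT; apply: le_trans (ler_norm_sum _ _ _) _; rewrite mulr_suml.
apply: ler_sum => i _; rewrite normrZ mulrC ler_pM ?coord_le_enorm //.
have := @lipk i s 0 sT; rewrite lexx (ltW T0) => /(_ isT); rewrite subr0.
have := ler_normB (k i s - k i 0) (- k i 0); rewrite opprK subrK normrN.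
have /andP[s0 s1] := sT; rewrite (ger0_norm s0).
have := ler_wpM2l Ck0 s1; lra.
Qed.

Lemma kap_lip s t v : 0 <= s <= T -> 0 <= t <= T ->
  `|kap s v - kap t v| <= d%:R * Ck * `|s - t| * enorm v.
Proof.
move=> sT tT; rewrite /kap -sumrB (le_trans (ler_norm_sum _ _ _)) //.
rewrite -[leRHS]mulrA -[leRHS]mulrA mulr_natl -sumr_const_ord.
apply: ler_sum => i _; rewrite -scalerBr normrZ mulrC mulrA.
by rewrite ler_pM ?coord_le_enorm // lipk.
Qed.

Lemma kap_dist s t v w : 0 <= s <= T -> 0 <= t <= T ->
  `|kap s v - kap t w| <= kap_bound * enorm (v - w) + d%:R * Ck * `|s - t| * enorm w.
Proof.
move=> sT tT; rewrite -(subrK (kap s w) (kap s v)) -addrA.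
by rewrite (le_trans (ler_normD _ _)) // lerD ?kap_lip // -kapB kap_le.
Qed.

Lemma pvarB g h t : pvar (g - h) t = pvar g t - pvar h t.
Proof. by apply/rowP => i; rewrite !mxE linearBr. Qed.

Lemma pvar0 g : pvar g 0 = 0.
Proof. by apply/rowP => i; rewrite !mxE subrr linear0l. Qed.

Lemma pvar_lip g s t : 0 <= s <= T -> 0 <= t <= T ->
  enorm (pvar g s - pvar g t) <= d%:R * Ck * `|g| * `|s - t|.
Proof.
move=> sT tT; apply: le_trans (enorm_le_sum _) _.
rewrite -[leRHS]mulrA -[leRHS]mulrA mulr_natl -sumr_const_ord.
apply: ler_sum => i _; rewrite !mxE -linearBl /=.
have -> : k i 0 - k i s - (k i 0 - k i t) = - (k i s - k i t).
  by rewrite opprB addrC addrA subrK opprB.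
rewrite linearNl normrN mulrCA mulrC; apply: le_trans (ler_ip hip _ _) _.
by rewrite ler_wpM2r // lipk.
Qed.

Lemma pvar_le g t : 0 <= t <= T -> enorm (pvar g t) <= d%:R * Ck * `|g| * T.
Proof.
move=> tT; have := @pvar_lip g t 0 tT; rewrite pvar0 !subr0 lexx (ltW T0).
move=> /(_ isT) h; apply: le_trans h _; have /andP[t0 tT'] := tT.
by rewrite ger0_norm // ler_wpM2l // !mulr_ge0.
Qed.

(** [k i 0] is the observation of the constant e_i, as chi_0 = 1 on I; this is stationarity in the
    offset, which the penalty does not see. *)
Definition orth_const g := forall i, ip g (k i 0) = 0.

Lemma ip_kap0 g v : orth_const g -> ip g (kap 0 v) = 0.
Proof. by move=> g0; rewrite ip_sumr big1 // => i _; rewrite ipZr g0 mulr0. Qed.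

Lemma edot_pvar g t v : orth_const g -> edot v (pvar g t) = - ip g (kap t v).
Proof.
move=> g0; rewrite ip_sumr -sumrN; apply: eq_bigr => i _.
by rewrite mxE (ipC ip) linearBr /= g0 sub0r ipZr mulrN.
Qed.

Definition kjump (x : R * jump R d) := kap x.2.2 x.2.1.
(** The offset v is the value of the function left of its first jump, not its mean as in [B_op]. *)
Definition Phi A v := \sum_(x <- A) x.1 *: kjump x + kap 0 v.

Lemma Phi_map A (f : R * jump R d -> R) v :
  Phi [seq (f x, x.2) | x <- A] v = \sum_(x <- A) f x *: kjump x + kap 0 v.
Proof. by rewrite /Phi big_map. Qed.

End JumpOperator.

Section LinearRate.
Context {R : realType} {Y : completeNormedModType R} {d : nat}.
Variable ip : {dot Y for idfun}.
Hypothesis hip : forall y, ip y y = `|y| ^+ 2.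
Variables (k : 'I_d -> R -> Y) (T Ck : R).
Hypotheses (T0 : 0 < T) (Ck0 : 0 <= Ck).
Hypothesis lipk : forall i s t, 0 <= s <= T -> 0 <= t <= T ->
  `|k i s - k i t| <= Ck * `|s - t|.
Variables (F : Y -> R) (gradF : Y -> Y) (L : R).
Hypothesis L0 : 0 < L.
Hypothesis cvxF : forall x y, F x + ip (gradF x) (y - x) <= F y.
Hypothesis lipF : forall x y, `|gradF x - gradF y| <= L * `|x - y|.
Variable beta : R.
Hypothesis beta0 : 0 < beta.

Local Notation kap := (kap k).
Local Notation pvar := (pvar ip k).
Local Notation kx := (kjump k).
Local Notation Phi := (Phi k).
Local Notation Bk := (kap_bound k T Ck).

Definition jump_objective (A : seq (R * jump R d)) v :=
  F (Phi A v) + beta * \sum_(x <- A) x.1.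

Variables (A : nat -> seq (R * jump R d)) (c : nat -> 'rV[R]_d) (th : nat -> R).
Let y n := Phi (A n) (c n).
Let g n := gradF (y n).
Let P n := enorm (pvar (g n) (th n)).
Let vhat n : jump R d := ((P n)^-1 *: pvar (g n) (th n), th n).

Hypothesis HA : forall n x, x \in A n -> 0 < x.1 /\ is_jump T x.2.
(** Competitors reweight the active jumps by a function of the pair, which allows repeated entries
    in the list. *)
Hypothesis opt_step : forall n f v, {in A n, forall x, 0 <= f x} ->
  jump_objective (A n) (c n) <= jump_objective [seq (f x, x.2) | x <- A n] v.
Hypothesis next_step : forall n f m v, {in A n, forall x, 0 <= f x} -> 0 <= m ->
  jump_objective (A n.+1) (c n.+1) <=
  jump_objective (rcons [seq (f x, x.2) | x <- A n] (m, vhat n)) v.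
Hypothesis thI : forall n, 0 < th n < T.
Hypothesis P_max : forall n t, 0 < t < T -> enorm (pvar (g n) t) <= P n.
Hypothesis P_gt : forall n, beta < P n.

Lemma in_cc t : 0 < t < T -> 0 <= t <= T.
Proof. by case/andP=> /ltW -> /ltW ->. Qed.

Lemma active_mass n x : x \in A n -> 0 <= x.1.
Proof. by case/HA => /ltW. Qed.

Lemma active_pos n x : x \in A n -> 0 < x.2.2 < T.
Proof. by case/HA => _ [/=]; rewrite in_itv. Qed.

Lemma active_dir n x : x \in A n -> enorm x.2.1 = 1.
Proof. by case/HA => _ []. Qed.

Lemma optimal_const n : orth_const ip k (g n).
Proof.
move=> i; have := @stationary _ _ ip hip F gradF L cvxF lipF (y n) (k i 0) 0.
rewrite addr0; apply => t _; rewrite mulr0 addr0.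
have := @opt_step n fst (c n + t *: delta_mx 0 i).
move=> /(_ (@active_mass n)); rewrite /jump_objective Phi_map big_map.
rewrite lerD2r kapD kapZ kap_delta addrA; exact.
Qed.

(** Active magnitudes are positive, so those selected by S may be scaled by 1 + t for t of either
    sign, and complementarity is an equality on every subfamily. It is used for the whole active set
    and for the jumps near one optimal point. *)
Lemma optimal_active n (S : pred (R * jump R d)) :
  \sum_(x <- A n | S x) x.1 * (ip (g n) (kx x) + beta) = 0.
Proof.
pose h := \sum_(x <- A n | S x) x.1 *: kx x.
pose b := beta * \sum_(x <- A n | S x) x.1.
transitivity (ip (g n) h + b).
  rewrite /h /b ip_sumr mulr_sumr -big_split /=; apply: eq_bigr => x _.
  by rewrite ipZr mulrDr (mulrC beta).
apply: (@stationary _ _ ip hip F gradF L cvxF lipF (y n)) => t t1.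
pose f (x : R * jump R d) := x.1 * (1 + t * (S x)%:R).
have f0 : {in A n, forall x, 0 <= f x}.
  move=> x xA; rewrite mulr_ge0 ?(active_mass xA) //.
  by case: (S x); rewrite ?mulr1 ?mulr0; move: t1; rewrite ler_norml; lra.
have := opt_step (c n) f0; rewrite /jump_objective Phi_map big_map /=.
have -> : \sum_(x <- A n) f x *: kx x = \sum_(x <- A n) x.1 *: kx x + t *: h.
  rewrite /h scaler_sumr [X in _ + X]big_mkcond -big_split /=; apply: eq_bigr => x _.
  rewrite /f; case: (S x); rewrite ?mulr1 ?mulr0 ?addr0 ?mulr1 // mulrDr mulr1.
  by rewrite scalerDl scalerA (mulrC t).
have -> : \sum_(x <- A n) f x =
    \sum_(x <- A n) x.1 + t * \sum_(x <- A n | S x) x.1.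
  rewrite mulr_sumr [X in _ + X]big_mkcond -big_split /=; apply: eq_bigr => x _.
  rewrite /f; case: (S x); rewrite ?mulr1 ?mulr0 ?addr0 ?mulr1 // mulrDr mulr1.
  by rewrite (mulrC t).
by rewrite addrAC /b -/(y n); lra.
Qed.

(** * The residual and its convergence to 0 *)

Variables (ybar : Y) (gamma e : R).
Hypotheses (gamma0 : 0 < gamma) (e0 : 0 < e).
Hypothesis growth : forall y, `|y - ybar| <= e ->
  F ybar + ip (gradF ybar) (y - ybar) + gamma * `|y - ybar| ^+ 2 <= F y.
Let gb := gradF ybar.
Let pb := pvar gb.
Hypothesis orth_gb : orth_const ip k gb.

Variables (N : nat) (tb : 'I_N -> R) (mub : 'I_N -> R) (cb : 'rV[R]_d).
Let vb i := beta^-1 *: pb (tb i).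
Let Mb := \sum_i mub i.
Hypothesis tbI : forall i, 0 < tb i < T.
Hypothesis mub0 : forall i, 0 < mub i.
Hypothesis pb_tb : forall i, enorm (pb (tb i)) = beta.
Hypothesis ybarE : ybar = \sum_i mub i *: kap (tb i) (vb i) + kap 0 cb.
Hypothesis pb_le : forall t, 0 < t < T -> enorm (pb t) <= beta.

Let Jbar := F ybar + beta * Mb.
Let r n := jump_objective (A n) (c n) - Jbar.

Lemma enorm_vb i : enorm (vb i) = 1.
Proof. by rewrite enormZ pb_tb gtr0_norm ?invr_gt0 // mulVf ?gt_eqF. Qed.

Lemma Mb_ge0 : 0 <= Mb.
Proof. by apply: sumr_ge0 => i _; rewrite ltW. Qed.

Lemma ip_g_y n : ip (g n) (y n) = - beta * \sum_(x <- A n) x.1.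
Proof.
rewrite /y /Phi linearDr /= (ip_kap0 _ (@optimal_const n)) addr0 ip_sumr.
have h : \sum_(x <- A n) x.1 * ip (g n) (kx x) + (\sum_(x <- A n) x.1) * beta = 0.
  rewrite -[RHS](optimal_active n xpredT) mulr_suml -big_split /=.
  by apply: eq_bigr => x _; rewrite mulrDr.
rewrite (eq_bigr (fun x => x.1 * ip (g n) (kx x))) => [|x _]; first by lra.
by rewrite ipZr.
Qed.

Lemma ip_gb_ybar : ip gb ybar = - beta * Mb.
Proof.
rewrite ybarE linearDr /= (ip_kap0 _ orth_gb) addr0 ip_sumr mulr_sumr.
apply: eq_bigr => i _; rewrite ipZr -[ip _ _]opprK -edot_pvar // /vb edotZl.
rewrite -/pb -sqr_enorm pb_tb expr2 mulKf ?gt_eqF //; lra.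
Qed.

Lemma gap n : r n <= Mb * (P n - beta).
Proof.
have := cvxF (y n) ybar; rewrite linearBr /= -/(g n) ip_g_y.
(* An optimal jump contributes its mass times the component of the dual variable along a unit
   vector, which the maximum P n bounds. *)
have : - ip (g n) ybar <= Mb * P n.
  rewrite ybarE linearDr /= (ip_kap0 _ (@optimal_const n)) addr0 ip_sumr.
  rewrite -sumrN mulr_suml; apply: ler_sum => i _; rewrite ipZr -mulrN.
  rewrite ler_pM2l // -(edot_pvar _ _ (@optimal_const n)).
  by rewrite (le_trans (edot_le _ _)) // enorm_vb mul1r P_max.
rewrite /r /jump_objective /Jbar -/(y n); lra.
Qed.

Definition defect (x : R * jump R d) : R := beta - edot x.2.1 (pb x.2.2).

Lemma defect_ge0 n x : x \in A n -> 0 <= defect x.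
Proof.
move=> xA; rewrite subr_ge0 (le_trans (edot_le _ _)) // (active_dir xA) mul1r.
exact/pb_le/(active_pos xA).
Qed.

(** An identity, because [gb] annihilates the offsets of both observations: it gives minus the sum
    of mu v . pbar(s) on [y n], and - beta Mb on [ybar]. *)
Lemma residualE n :
  r n = bregman ip F gradF ybar (y n) + \sum_(x <- A n) x.1 * defect x.
Proof.
have -> : \sum_(x <- A n) x.1 * defect x =
    beta * (\sum_(x <- A n) x.1) + ip gb (y n).
  rewrite /y /Phi linearDr /= (ip_kap0 _ orth_gb) addr0 ip_sumr mulr_sumr.
  rewrite -big_split /=; apply: eq_bigr => x _.
  rewrite /defect (edot_pvar _ _ orth_gb) ipZr /kjump; ring.
rewrite /r /Jbar /jump_objective /bregman -/gb linearBr /= ip_gb_ybar -/(y n); ring.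
Qed.

Lemma sum_defect_ge0 n : 0 <= \sum_(x <- A n) x.1 * defect x.
Proof.
rewrite big_seq sumr_ge0 // => x xA.
by rewrite mulr_ge0 ?(active_mass xA) ?(defect_ge0 xA).
Qed.

Lemma bregman_le_residual n : bregman ip F gradF ybar (y n) <= r n.
Proof. by rewrite residualE lerDl sum_defect_ge0. Qed.

Lemma sum_defect_le n : \sum_(x <- A n) x.1 * defect x <= r n.
Proof. by rewrite residualE lerDr (bregman_ge0 cvxF). Qed.

Lemma residual_ge0 n : 0 <= r n.
Proof. exact: le_trans (sum_defect_ge0 n) (sum_defect_le n). Qed.

Lemma P_gt0 n : 0 < P n.
Proof. exact: lt_trans (P_gt n). Qed.

Lemma enorm_vhat n : enorm (vhat n).1 = 1.
Proof.
by rewrite enormZ -/(P n) gtr0_norm ?invr_gt0 ?P_gt0 // mulVf // gt_eqF // P_gt0.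
Qed.

Let khat n := kap (th n) (vhat n).1.

Lemma ip_khat n : ip (g n) (khat n) = - P n.
Proof.
rewrite -[ip _ _]opprK -(edot_pvar _ _ (@optimal_const n)) /vhat /= edotZl.
by rewrite -sqr_enorm -/(P n) expr2 mulKf ?gt_eqF // P_gt0.
Qed.

Lemma next_le n f m v : {in A n, forall x, 0 <= f x} -> 0 <= m ->
  r n.+1 <= F (\sum_(x <- A n) f x *: kx x + m *: khat n + kap 0 v)
    + beta * (\sum_(x <- A n) f x + m) - Jbar.
Proof.
move=> f0 m0; rewrite /r lerD2r.
have := next_step v f0 m0; rewrite {2}/jump_objective /Phi.
by rewrite -!cats1 !big_cat !big_seq1 !big_map /=.
Qed.

(** The competitor moves from [y n] towards the new jump carrying the whole mass Mb. With this mass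
    the active magnitudes cancel from the linear term, which becomes - s Mb (P n - beta), the
    quantity bounded in [gap]. *)
Lemma conditional_gradient_step n s : 0 <= s <= 1 ->
  r n.+1 <= r n - s * r n + s ^+ 2 * (L * `|Mb *: khat n - y n| ^+ 2).
Proof.
case/andP=> s0 s1.
have f0 : {in A n, forall x, 0 <= (1 - s) * x.1}.
  by move=> x xA; rewrite mulr_ge0 ?subr_ge0 ?(active_mass xA).
have := next_le ((1 - s) *: c n) f0 (mulr_ge0 s0 Mb_ge0).
have -> : \sum_(x <- A n) ((1 - s) * x.1) *: kx x + (s * Mb) *: khat n
    + kap 0 ((1 - s) *: c n) = y n + s *: (Mb *: khat n - y n).
  rewrite addrAC kapZ (eq_bigr (fun x => (1 - s) *: (x.1 *: kx x))) => [|x _].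
    rewrite -scaler_sumr -scalerDr -/(Phi _ _) -/(y n) -scalerA.
    by rewrite scalerBr scalerBl scale1r addrAC addrA.
  by rewrite scalerA.
rewrite -mulr_sumr.
move=> h; apply: le_trans h _.
have := descent hip cvxF lipF (y n) (s *: (Mb *: khat n - y n)).
rewrite -/(g n) ipZr normrZ exprMn real_normK ?num_real // linearBr /= ipZr.
rewrite ip_khat ip_g_y.
have := ler_wpM2l s0 (gap n).
by rewrite /r /jump_objective -/(y n); lra.
Qed.

(** Mass is taken from S in proportion to the magnitudes, and the total is kept, so the penalty does
    not change. The barycentre of the observations in S, where the gradient gives - beta by
    complementarity, is exchanged for [khat n], where it gives - P n. *)
Lemma swap_step n (S : pred (R * jump R d)) tau
    (m := \sum_(x <- A n | S x) x.1) : 0 < m -> 0 <= tau <= m ->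
  r n.+1 <= r n - tau * (P n - beta) + tau ^+ 2 *
    (L * `|khat n - m^-1 *: \sum_(x <- A n | S x) x.1 *: kx x| ^+ 2).
Proof.
move=> m0 /andP[tau0 tau1]; set h := \sum_(x <- A n | S x) x.1 *: kx x.
pose f (x : R * jump R d) := x.1 * (1 - tau / m * (S x)%:R).
have f0 : {in A n, forall x, 0 <= f x}.
  move=> x xA; rewrite mulr_ge0 ?(active_mass xA) // subr_ge0.
  by case: (S x); rewrite ?mulr1 ?mulr0 // ler_pdivrMr // mul1r.
have := next_le (c n) f0 tau0.
have -> : \sum_(x <- A n) f x *: kx x + tau *: khat n + kap 0 (c n) =
    y n + tau *: (khat n - m^-1 *: h).
  have -> : \sum_(x <- A n) f x *: kx x =
      \sum_(x <- A n) x.1 *: kx x - (tau / m) *: h.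
    rewrite /h scaler_sumr [X in _ - X]big_mkcond -sumrB; apply: eq_bigr => x _.
    rewrite /f; case: (S x); rewrite ?mulr1 ?mulr0 ?subr0 ?mulr1 //.
    by rewrite mulrBr mulr1 scalerBl scalerA (mulrC (tau / m)).
  by rewrite scalerBr scalerA -[LHS]addrA [X in _ + X]addrC addrACA (addrC (- _)).
have -> : \sum_(x <- A n) f x + tau = \sum_(x <- A n) x.1.
  have -> : \sum_(x <- A n) f x = \sum_(x <- A n) x.1 - tau / m * m.
    rewrite {2}/m mulr_sumr [X in _ - X]big_mkcond -sumrB; apply: eq_bigr => x _.
    rewrite /f; case: (S x); rewrite ?mulr1 ?mulr0 ?subr0 ?mulr1 //.
    by rewrite mulrBr mulr1 (mulrC (tau / m)).
  by rewrite mulfVK ?subrK // gt_eqF.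
have gh : ip (g n) h = - beta * m.
  have e1 : ip (g n) h + m * beta = 0.
    rewrite -[RHS](optimal_active n S) /h ip_sumr /m mulr_suml -big_split /=.
    by apply: eq_bigr => x _; rewrite ipZr mulrDr.
  lra.
have := descent hip cvxF lipF (y n) (tau *: (khat n - m^-1 *: h)).
rewrite -/(g n) ipZr normrZ exprMn real_normK ?num_real // linearBr /= ipZr.
rewrite ip_khat gh mulrCA mulVf ?gt_eqF // mulr1.
rewrite /r /jump_objective -/(y n); lra.
Qed.

Lemma residual_mono m n : (m <= n)%N -> r n <= r m.
Proof.
elim: n => [|n ih]; first by rewrite leqn0 => /eqP ->.
rewrite leq_eqVlt => /predU1P[-> //|/ih]; apply: le_trans.
have := @conditional_gradient_step n 0; rewrite lexx ler01.
by rewrite mul0r expr0n mul0r subr0 addr0; exact.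
Qed.

Let By := e + r 0%N / (gamma * e).

Lemma dist_le n : `|y n - ybar| <= By.
Proof.
apply: le_trans (bregman_bounds cvxF gamma0 e0 growth _) _.
rewrite lerD2l ler_wpM2r ?invr_ge0 ?mulr_ge0 ?(ltW gamma0) ?(ltW e0) //.
exact: le_trans (bregman_le_residual n) (residual_mono (leq0n n)).
Qed.

Lemma residual_cvg0 eps : 0 < eps -> \forall n \near \oo, r n < eps.
Proof.
pose Q := L * (Mb * Bk + By + `|ybar|) ^+ 2.
apply: (@quadratic_decrease_cvg0 _ r Q).
- by rewrite mulr_ge0 ?sqr_ge0 // ltW.
- exact: residual_ge0.
move=> n s s01; apply: le_trans (conditional_gradient_step n s01) _.
rewrite lerD2l ler_wpM2l ?sqr_ge0 // ler_pM2l //.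
rewrite ler_pXn2r ?nnegrE //; last first.
  apply: addr_ge0 => //; apply: addr_ge0.
    by rewrite mulr_ge0 ?Mb_ge0 ?(kap_bound_ge0 k T0 Ck0).
  exact: le_trans (normr_ge0 _) (dist_le 0%N).
rewrite (le_trans (ler_normB _ _)) // -addrA lerD //.
  rewrite normrZ ger0_norm ?Mb_ge0 // ler_wpM2l ?Mb_ge0 //.
  rewrite (le_trans (kap_le T0 Ck0 lipk _ (in_cc (thI n)))) // enorm_vhat mulr1 //.
by rewrite -[y n](subrK ybar) (le_trans (ler_normD _ _)) // lerD2r dist_le.
Qed.

Lemma sq_dist_le : \forall n \near \oo, gamma * `|y n - ybar| ^+ 2 <= r n.
Proof.
have : 0 < gamma * e ^+ 2 by rewrite mulr_gt0 ?exprn_gt0.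
move=> /residual_cvg0; apply: filterS => n rn.
have h := bregman_le_residual n.
exact: le_trans (bregman_near cvxF gamma0 e0 growth (le_lt_trans h rn)) h.
Qed.

Let Mmax := (r 0%N + beta * Mb + `|gb| * By) / beta.

(** The tangent of F at [ybar] bounds F from below on the bounded set of observations, so a bounded
    residual leaves only a bounded penalty. *)
Lemma mass_le n : \sum_(x <- A n) x.1 <= Mmax.
Proof.
rewrite ler_pdivlMr // mulrC.
have := residual_mono (leq0n n); have := cvxF ybar (y n).
have := ler_ip hip gb (y n - ybar); rewrite ler_norml => /andP[+ _].
have := ler_wpM2l (normr_ge0 gb) (dist_le n).
rewrite {1}/r /Jbar /jump_objective -/(y n) -/gb; lra.
Qed.

(** * Localization of the active jumps near the optimal ones *)

Variables (rho sigma theta : R).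
Hypotheses (sigma0 : 0 < sigma) (theta0 : 0 < theta).
Let near i t := `|t - tb i| < rho.
Hypothesis sep : forall t, 0 < t < T -> (forall i, ~~ near i t) ->
  enorm (pb t) <= beta - sigma.
Hypothesis disj : forall i j t, near i t -> near j t -> i = j.
Hypothesis quad : forall i t, near i t ->
  theta * `|t - tb i| ^+ 2 <= beta - enorm (pb t).
Variable w : 'I_N -> Y.
Hypothesis w_jump : forall i j, ip (w i) (kap (tb j) (vb j)) = (i == j)%:R.
Hypothesis w_const : forall i, orth_const ip k (w i).

Let kb i := kap (tb i) (vb i).
Let c3 := d%:R * Ck * `|gb|.

Lemma c3_ge0 : 0 <= c3.
Proof. by rewrite !mulr_ge0. Qed.

Lemma pb_lip s t : 0 < s < T -> 0 < t < T ->
  enorm (pb s - pb t) <= c3 * `|s - t|.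
Proof. by move=> /in_cc sT /in_cc tT; exact: (pvar_lip hip lipk gb sT tT). Qed.

Let Cnear := 4 * (Bk / beta) ^+ 2 * beta
  + 2 * (Bk / beta * c3 + d%:R * Ck) ^+ 2 / theta.

Lemma Cnear_ge0 : 0 <= Cnear.
Proof.
apply: addr_ge0; last by rewrite divr_ge0 ?(ltW theta0) // mulr_ge0 // sqr_ge0.
by rewrite mulr_ge0 ?(ltW beta0) // mulr_ge0 // sqr_ge0.
Qed.

(** The defect controls both errors. As |v| = 1 and |pbar| <= beta, the direction obeys |beta v -
    pbar(s)|^2 <= 2 beta defect; the position obeys theta |s - tbar_i|^2 <= defect by [quad]. The
    two summands of [Cnear] come from these bounds after (aX + bZ)^2 <= 2 a^2 X^2 + 2 b^2 Z^2. *)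
Lemma near_kap n i x : x \in A n -> near i x.2.2 ->
  `|kx x - kb i| ^+ 2 <= Cnear * defect x.
Proof.
move=> xA xi; have xI := active_pos xA; have xd := active_dir xA.
set X := enorm (beta *: x.2.1 - pb x.2.2); set Z := `|x.2.2 - tb i|.
have B0 : 0 <= Bk / beta by rewrite divr_ge0 ?(kap_bound_ge0 k T0 Ck0) ?ltW.
have ed : edot x.2.1 (pb x.2.2) <= enorm (pb x.2.2).
  by rewrite (le_trans (edot_le _ _)) // xd mul1r.
have hZ : theta * Z ^+ 2 <= defect x.
  by apply: le_trans (quad xi) _; rewrite /defect lerD2l lerN2.
have hX : X ^+ 2 <= 2 * beta * defect x.
  rewrite sqr_enorm edotBl !edotBr !edotZl !edotZr -!sqr_enorm xd (edotC (pb _)).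
  have : enorm (pb x.2.2) ^+ 2 <= beta ^+ 2.
    by rewrite ler_pXn2r ?nnegrE ?enorm_ge0 ?pb_le // ltW.
  rewrite /defect; lra.
have hv : enorm (x.2.1 - vb i) <= beta^-1 * (X + c3 * Z).
  have -> : x.2.1 - vb i =
      beta^-1 *: ((beta *: x.2.1 - pb x.2.2) + (pb x.2.2 - pb (tb i))).
    by rewrite addrA subrK scalerBr scalerA mulVf ?gt_eqF // scale1r.
  rewrite enormZ gtr0_norm ?invr_gt0 // ler_pM2l ?invr_gt0 //.
  by rewrite (le_trans (enormD _ _)) // lerD2l pb_lip.
have hk : `|kx x - kb i| <= Bk / beta * X + (Bk / beta * c3 + d%:R * Ck) * Z.
  have := kap_dist T0 Ck0 lipk x.2.1 (vb i) (in_cc xI) (in_cc (tbI i)).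
  rewrite enorm_vb -/(kjump _ _) -/(kb i) -/Z => h; apply: le_trans h _.
  have := ler_wpM2l (kap_bound_ge0 k T0 Ck0) hv; lra.
set a := Bk / beta in hk B0 *; set b := a * c3 + d%:R * Ck in hk *.
have b0 : 0 <= b.
  apply: addr_ge0; last by rewrite mulr_ge0.
  by apply: mulr_ge0 => //; exact: c3_ge0.
have X0 : 0 <= X by rewrite enorm_ge0.
have Z0 : 0 <= Z by exact: normr_ge0.
have h1 : `|kx x - kb i| ^+ 2 <= (a * X + b * Z) ^+ 2.
  by rewrite ler_pXn2r ?nnegrE //; apply: addr_ge0; apply: mulr_ge0.
have h2 : (a * X + b * Z) ^+ 2 <= 2 * a ^+ 2 * X ^+ 2 + 2 * b ^+ 2 * Z ^+ 2.
  by have := sqr_ge0 (a * X - b * Z); lra.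
have h3 : Z ^+ 2 <= defect x / theta by rewrite ler_pdivlMr // mulrC.
have := ler_wpM2l (sqr_ge0 a) hX; have := ler_wpM2l (sqr_ge0 b) h3.
have -> : Cnear * defect x = 4 * a ^+ 2 * beta * defect x
  + 2 * (b ^+ 2 * (defect x / theta)) by rewrite /Cnear -/a -/b; ring.
lra.
Qed.

(** The functional w i almost counts the jumps near [tb i]. Near some [tb j] only the square of the
    distance is controlled, so a <= delta + a^2 / delta makes the error affine in the defect. Away
    from all of them the defect is at least sigma and absorbs the crude bound on the observation. *)
Lemma dual_error n i x delta : 0 < delta -> x \in A n ->
  `|ip (w i) (kx x) - (near i x.2.2)%:R| <=
  `|w i| * (delta + (Cnear / delta + Bk / sigma) * defect x).
Proof.
move=> delta0 xA; have x0 := defect_ge0 xA; have Bk0 := kap_bound_ge0 k T0 Ck0.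
have [[j xj]|far] := pselect (exists j, near j x.2.2).
  have -> : near i x.2.2 = (i == j).
    by apply/idP/eqP => [xi|-> //]; exact: disj xi xj.
  rewrite -w_jump -linearBr /= (le_trans (ler_ip hip _ _)) // ler_wpM2l //.
  set a := `|_|; have hk := near_kap xA xj; rewrite -/(kb j) -/a in hk.
  have : a <= delta + a ^+ 2 / delta.
    rewrite -(ler_pM2r delta0) mulrDl mulfVK ?gt_eqF //.
    have := sqr_ge0 (a - delta); have := sqr_ge0 a; have := sqr_ge0 delta; lra.
  have : a ^+ 2 / delta <= Cnear * defect x / delta.
    by rewrite ler_pM2r // invr_gt0.
  have : 0 <= Bk / sigma * defect x by rewrite mulr_ge0 ?divr_ge0 // ltW.
  lra.
have nf j : ~~ near j x.2.2 by apply/negP => xj; apply: far; exists j.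
rewrite (negPf (nf i)) subr0 (le_trans (ler_ip hip _ _)) // ler_wpM2l //.
have := kap_le T0 Ck0 lipk x.2.1 (in_cc (active_pos xA)).
rewrite (active_dir xA) mulr1 -/(kjump _ _) => hk; apply: le_trans hk _.
have hs : sigma <= defect x.
  have := sep (active_pos xA) nf; have := edot_le x.2.1 (pb x.2.2).
  by rewrite (active_dir xA) mul1r /defect; lra.
have : Bk <= Bk / sigma * defect x.
  by rewrite mulrAC ler_pdivlMr // ler_wpM2l.
have : 0 <= Cnear / delta * defect x.
  by rewrite mulr_ge0 ?divr_ge0 ?Cnear_ge0 // ltW.
lra.
Qed.

Lemma near_mass i :
  \forall n \near \oo, mub i / 2 <= \sum_(x <- A n | near i x.2.2) x.1.
Proof.
(* The allowed loss mub i / 2 is shared by three errors: the parameter delta times the total mass,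
   the summed defects, and the pairing of w i with y n - ybar. *)
set nu := mub i / 6.
have nu0 : 0 < nu by rewrite divr_gt0.
have M0 : 0 <= Mmax.
  by apply: le_trans _ (mass_le 0%N); rewrite big_seq sumr_ge0 // => x /active_mass.
pose delta := nu / (`|w i| * Mmax + 1).
have D0 : 0 < `|w i| * Mmax + 1 by rewrite ltr_wpDl // mulr_ge0.
have delta0 : 0 < delta by rewrite divr_gt0.
pose Cd := Cnear / delta + Bk / sigma.
have Cd0 : 0 <= Cd.
  by apply: addr_ge0; apply: divr_ge0;
    rewrite ?Cnear_ge0 ?(kap_bound_ge0 k T0 Ck0) ?(ltW delta0) ?(ltW sigma0).
have W0 : 0 < `|w i| * Cd + 1 by rewrite ltr_wpDl // mulr_ge0.
have W1 : 0 < `|w i| + 1 by rewrite ltr_wpDl.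
have e1 : 0 < nu / (`|w i| * Cd + 1) by rewrite divr_gt0.
have e2 : 0 < gamma * (nu / (`|w i| + 1)) ^+ 2.
  by rewrite mulr_gt0 // exprn_gt0 // divr_gt0.
move: (residual_cvg0 e1) (residual_cvg0 e2) sq_dist_le.
apply: filterS3 => n r1 r2 hy.
(* Pairing with w i kills the offsets and all optimal jumps but the i-th, so [ybar] contributes
   exactly mub i. *)
have hm : \sum_(x <- A n | near i x.2.2) x.1 - mub i =
    ip (w i) (y n - ybar)
    - \sum_(x <- A n) x.1 * (ip (w i) (kx x) - (near i x.2.2)%:R).
  rewrite linearBr /= {1}/y /Phi ybarE !linearDr /= !(ip_kap0 _ (w_const i)).
  rewrite !addr0 !ip_sumr big_mkcond.
  rewrite [X in _ = _ - X - _](bigD1 i) //= ipZr w_jump eqxx mulr1.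
  rewrite [X in mub i + X]big1 => [|j ji]; last first.
    by rewrite ipZr w_jump eq_sym (negPf ji) mulr0.
  rewrite addr0 addrAC; congr (_ - _); rewrite -sumrB; apply: eq_bigr => x _.
  by rewrite ipZr mulrBr opprB addrC subrK; case: near; rewrite ?mulr1 ?mulr0.
have h1 : `|\sum_(x <- A n) x.1 * (ip (w i) (kx x) - (near i x.2.2)%:R)| <=
    `|w i| * delta * Mmax + `|w i| * Cd * r n.
  apply: (@le_trans _ _ (\sum_(x <- A n)
     (`|w i| * delta * x.1 + `|w i| * Cd * (x.1 * defect x)))).
    apply: le_trans (ler_norm_sum _ _ _) _; rewrite big_seq [leRHS]big_seq.
    apply: ler_sum => x xA; rewrite normrM ger0_norm ?(active_mass xA) //.
    apply: le_trans (ler_wpM2l (active_mass xA) (dual_error i delta0 xA)) _.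
    by rewrite -/Cd; lra.
  rewrite big_split /= -!mulr_sumr; apply: lerD.
    by apply: ler_wpM2l (mass_le n); rewrite mulr_ge0 // ltW.
  by apply: ler_wpM2l (sum_defect_le n); rewrite mulr_ge0.
have h2 : `|w i| * delta * Mmax <= nu.
  rewrite mulrAC /delta mulrA ler_pdivrMr // mulrC ler_pM2l //; lra.
have h3 : `|w i| * Cd * r n <= nu.
  have : r n * (`|w i| * Cd + 1) <= nu by rewrite -ler_pdivlMr // ltW.
  have := residual_ge0 n; lra.
have h4 : `|ip (w i) (y n - ybar)| <= nu.
  apply: le_trans (ler_ip hip _ _) _.
  have hq : `|y n - ybar| <= nu / (`|w i| + 1).
    rewrite -(ler_pXn2r (n := 2)) ?nnegrE //; last by rewrite divr_ge0 // ltW.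
    by rewrite -(ler_pM2l gamma0) (le_trans hy) // ltW.
  apply: le_trans (ler_wpM2l _ hq) _ => //.
  by rewrite mulrA ler_pdivrMr // mulrC ler_pM2l //; lra.
have -> : mub i / 2 = mub i - nu - nu - nu by rewrite /nu; field.
move: h1 h4; rewrite !ler_norml => /andP[_ h1] /andP[h4 _]; lra.
Qed.


(** * Distance of the new jump to the optimal one *)

Let c1 := d%:R * Ck * L.

Lemma c1_ge0 : 0 <= c1.
Proof. by apply: mulr_ge0; rewrite ?mulr_ge0 // ltW. Qed.

Lemma grad_dist n : `|g n - gb| <= L * `|y n - ybar|.
Proof. exact: lipF. Qed.

Lemma dual_dist n t : 0 < t < T ->
  enorm (pvar (g n) t - pb t) <= c1 * T * `|y n - ybar|.
Proof.
move=> tI; rewrite -pvarB; apply: le_trans (pvar_le hip T0 Ck0 lipk _ (in_cc tI)) _.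
have := ler_wpM2l (mulr_ge0 (mulr_ge0 (ler0n R d) Ck0) (ltW T0)) (grad_dist n).
rewrite /c1; lra.
Qed.

Lemma dual_dist_lip n s t : 0 < s < T -> 0 < t < T ->
  enorm ((pvar (g n) s - pb s) - (pvar (g n) t - pb t)) <=
  c1 * `|y n - ybar| * `|s - t|.
Proof.
move=> /in_cc sI /in_cc tI; rewrite -!pvarB.
apply: le_trans (pvar_lip hip lipk _ sI tI) _; rewrite ler_wpM2r //.
have := ler_wpM2l (mulr_ge0 (ler0n R d) Ck0) (grad_dist n).
rewrite /c1; lra.
Qed.

Let Cpos := (2 * c1 * T * c3 + 2 * beta * c1 + 2 * c1 ^+ 2 * T * By)
  / (theta * beta).

Lemma Cpos_ge0 : 0 <= Cpos.
Proof.
have By0 : 0 <= By := le_trans (normr_ge0 _) (dist_le 0%N).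
have h0 := c1_ge0; have h3 := c3_ge0; have := ltW T0; have := ltW beta0.
move=> b0 t0; have Lp := ltW L0; apply: divr_ge0; last by rewrite mulr_ge0 // ltW.
by apply: addr_ge0; [apply: addr_ge0|]; rewrite !mulr_ge0.
Qed.

(** The new point maximizes the perturbed dual norm and [tb i] the unperturbed one. By
    [sqr_enorm_diff] their comparison reads theta beta x^2 <= C eta x for the distance x; cancelling
    one x gives the linear bound. *)
Lemma new_position n i : near i (th n) ->
  `|th n - tb i| <= Cpos * `|y n - ybar|.
Proof.
move=> hi; set eta := `|y n - ybar|; set x := `|th n - tb i|.
have By0 : eta <= By := dist_le n; have eta0 : 0 <= eta by exact: normr_ge0.
have x0 : 0 <= x by exact: normr_ge0.
have h1 := c1_ge0; have h3 := c3_ge0; have bt0 := ltW beta0.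
set p := pb (th n); set p0 := pb (tb i).
set a := pvar (g n) (th n) - p; set a0 := pvar (g n) (tb i) - p0.
have na : enorm a <= c1 * T * eta := dual_dist n (thI n).
have na0 : enorm a0 <= c1 * T * eta := dual_dist n (tbI i).
have naa : enorm (a - a0) <= c1 * eta * x := dual_dist_lip n (thI n) (tbI i).
have npp : enorm (p - p0) <= c3 * x := pb_lip (thI n) (tbI i).
have hmax : enorm (p0 + a0) ^+ 2 <= enorm (p + a) ^+ 2.
  rewrite ler_pXn2r ?nnegrE ?enorm_ge0 // /a /a0 !(addrC _ (_ - _)) !subrK.
  exact: P_max.
have hq : theta * x ^+ 2 <= beta - enorm p := quad hi.
have np0 : enorm p0 = beta := pb_tb i.
have hsq : beta ^+ 2 - enorm p ^+ 2 <= 2 * (edot (p - p0) a + edot p0 (a - a0))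
    + edot (a - a0) (a + a0).
  by rewrite -np0; exact: sqr_enorm_diff.
have e1 : edot (p - p0) a <= c3 * x * (c1 * T * eta).
  by rewrite (le_trans (edot_le _ _)) // ler_pM ?enorm_ge0.
have e2 : edot p0 (a - a0) <= beta * (c1 * eta * x).
  by rewrite (le_trans (edot_le _ _)) // np0 ler_wpM2l.
(* One of the two factors eta is replaced by its bound [By], which makes this second-order term
   linear in eta too. *)
have e3 : edot (a - a0) (a + a0) <= c1 * eta * x * (2 * c1 * T * By).
  rewrite (le_trans (edot_le _ _)) // ler_pM ?enorm_ge0 //.
  rewrite (le_trans (enormD _ _)) // (le_trans (lerD na na0)) //.
  have := ler_wpM2l (mulr_ge0 h1 (ltW T0)) By0; lra.
have [x0'|x0'] := eqVneq x 0; first by rewrite x0' mulr_ge0 // Cpos_ge0.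
have xp : 0 < x by rewrite lt_def x0' x0.
rewrite /Cpos mulrAC ler_pdivlMr ?mulr_gt0 // -(ler_pM2r xp).
have ep : enorm p <= beta := pb_le (thI n).
(* Here |p| <= beta gives beta^2 - |p|^2 >= beta (beta - |p|). *)
have : beta * (theta * x ^+ 2) <= beta ^+ 2 - enorm p ^+ 2.
  have := ler_wpM2l bt0 hq; have := ler_wpM2r (enorm_ge0 p) ep; lra.
lra.
Qed.

Let Cdir := 2 / beta * (c1 * T + c3 * Cpos).
Let Cnew := Bk * Cdir + d%:R * Ck * Cpos.

Lemma new_jump_dist n i : near i (th n) ->
  `|khat n - kb i| <= Cnew * `|y n - ybar|.
Proof.
move=> hi; set eta := `|y n - ybar|.
have eta0 : 0 <= eta by exact: normr_ge0.
have hx := new_position hi; rewrite -/eta in hx.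
set p0 := pb (tb i); set q := pvar (g n) (th n).
have np0 : enorm p0 = beta := pb_tb i.
have hqp : enorm (q - p0) <= (c1 * T + c3 * Cpos) * eta.
  have -> : q - p0 = (q - pb (th n)) + (pb (th n) - p0) by rewrite addrA subrK.
  rewrite (le_trans (enormD _ _)) // mulrDl lerD //; first exact: dual_dist.
  apply: le_trans (pb_lip (thI n) (tbI i)) _; rewrite -mulrA ler_wpM2l //.
  exact: c3_ge0.
have hP : P n <= enorm (q - p0) + beta.
  by rewrite -np0 /P -/q -{1}(subrK p0 q) enormD.
have hv : enorm ((vhat n).1 - vb i) <= Cdir * eta.
  (* The last term is the error of normalizing by P n instead of beta. Its norm is P n / beta - 1,
     at most |q - p0| / beta, whence the factor 2 in [Cdir]. *)
  have -> : (vhat n).1 - vb i =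
      beta^-1 *: (q - p0) + ((P n)^-1 - beta^-1) *: q.
    by rewrite scalerBr scalerBl [RHS]addrC addrA subrK /vhat /= -/q.
  rewrite (le_trans (enormD _ _)) // !enormZ gtr0_norm ?invr_gt0 //.
  have hb : (P n)^-1 <= beta^-1 by rewrite lef_pV2 ?posrE ?P_gt0 // ltW // P_gt.
  have b0 : 0 <= beta^-1 by rewrite invr_ge0 ltW.
  rewrite -/(P n) distrC ger0_norm ?subr_ge0 // mulrBl mulVf ?gt_eqF ?P_gt0 //.
  have := ler_wpM2l b0 hP; rewrite mulrDr mulVf ?gt_eqF //.
  have := ler_wpM2l b0 hqp; rewrite /Cdir; lra.
apply: le_trans (kap_dist T0 Ck0 lipk _ _ (in_cc (thI n)) (in_cc (tbI i))) _.
rewrite enorm_vb mulr1 /Cnew mulrDl; apply: lerD; rewrite -[leRHS]mulrA.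
  by rewrite ler_wpM2l // kap_bound_ge0.
by rewrite ler_wpM2l // mulr_ge0.
Qed.

(** * The contraction *)

Let Mpos := Mb + 1.

(** An active jump of small magnitude may lie far from the optimal one, so single distances are not
    controlled. By convexity the squared distance from [khat n] to the barycentre is at most the
    weighted mean of the squared distances, and the triangle inequality through [kb i] bounds this
    mean by eta^2 and by the summed defects over the mass; hence the lower bound t0 on that mass. *)
Lemma linear_step t0 tau n i : 0 < t0 -> 0 <= tau <= t0 ->
  gamma * `|y n - ybar| ^+ 2 <= r n -> near i (th n) ->
  t0 <= \sum_(x <- A n | near i x.2.2) x.1 ->
  r n.+1 <= r n - tau * (P n - beta)
    + tau ^+ 2 * (L * ((2 * Cnew ^+ 2 / gamma + 2 * Cnear / t0) * r n)).
Proof.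
move=> t00 /andP[tau0 taut] hy hi; set m := \sum_(x <- _ | _) _ => hm.
have m0 : 0 < m := lt_le_trans t00 hm.
have tm : 0 <= tau <= m by rewrite tau0 (le_trans taut).
apply: le_trans (@swap_step n (fun x => near i x.2.2) _ m0 tm) _.
rewrite lerD2l ler_wpM2l ?sqr_ge0 // ler_pM2l // -/m.
set S := \sum_(x <- _ | _) _.
have -> : khat n - m^-1 *: S =
    m^-1 *: \sum_(x <- A n | near i x.2.2) x.1 *: (khat n - kx x).
  under [X in _ = _ *: X]eq_bigr do rewrite scalerBr.
  by rewrite sumrB -scaler_suml -/m scalerBr scalerA mulVf ?gt_eqF // scale1r.
pose a x := `|khat n - kx x|.
have h1 : `|\sum_(x <- A n | near i x.2.2) x.1 *: (khat n - kx x)| ^+ 2 <=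
    m * \sum_(x <- A n | near i x.2.2) x.1 * a x ^+ 2.
  apply: le_trans (weighted_sq_sum _ a (@active_mass n)).
  rewrite ler_pXn2r ?nnegrE ?normr_ge0 //; last first.
    rewrite big_seq_cond sumr_ge0 // => x /andP[/active_mass x0 _].
    by rewrite mulr_ge0 // normr_ge0.
  apply: le_trans (ler_norm_sum _ _ _) _; rewrite big_seq_cond [leRHS]big_seq_cond.
  apply: ler_sum => x /andP[/active_mass x0 _].
  by rewrite normrZ ger0_norm.
have h2 : \sum_(x <- A n | near i x.2.2) x.1 * a x ^+ 2 <=
    2 * (Cnew * `|y n - ybar|) ^+ 2 * m + 2 * Cnear * r n.
  apply: (@le_trans _ _ (\sum_(x <- A n | near i x.2.2)
     (2 * (Cnew * `|y n - ybar|) ^+ 2 * x.1 + 2 * Cnear * (x.1 * defect x)))).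
    rewrite big_seq_cond [leRHS]big_seq_cond; apply: ler_sum => x /andP[xA xi].
    have ha : a x <= Cnew * `|y n - ybar| + `|kx x - kb i|.
      rewrite /a -(subrK (kb i) (khat n)) -addrA (le_trans (ler_normD _ _)) //.
      by rewrite lerD ?(new_jump_dist hi) // distrC.
    have hk := near_kap xA xi.
    have : a x ^+ 2 <= (Cnew * `|y n - ybar| + `|kx x - kb i|) ^+ 2.
      by rewrite ler_pXn2r ?nnegrE ?(le_trans _ ha) // normr_ge0.
    have := sqr_ge0 (Cnew * `|y n - ybar| - `|kx x - kb i|).
    move: hk; set u := Cnew * _; set v := `|_ - kb i| => hk hs hax.
    have hb : a x ^+ 2 <= 2 * u ^+ 2 + 2 * (Cnear * defect x) by lra.
    by have := ler_wpM2l (active_mass xA) hb; lra.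
  rewrite big_split /= -!mulr_sumr -/m lerD2l.
  apply: ler_wpM2l; first by rewrite mulr_ge0 // Cnear_ge0.
  apply: le_trans (sum_defect_le n); rewrite big_mkcond big_seq [leRHS]big_seq.
  apply: ler_sum => x xA; case: near => //.
  by rewrite mulr_ge0 ?(active_mass xA) ?(defect_ge0 xA).
rewrite normrZ exprMn real_normK ?num_real //.
have h3 : m * \sum_(x <- A n | near i x.2.2) x.1 * a x ^+ 2 <=
    m ^+ 2 * (2 * (Cnew * `|y n - ybar|) ^+ 2 + 2 * Cnear * r n / m).
  apply: le_trans (ler_wpM2l (ltW m0) h2) _.
  by rewrite le_eqVlt; apply/orP; left; apply/eqP; field; rewrite gt_eqF.
apply: le_trans (ler_wpM2l (sqr_ge0 _) (le_trans h1 h3)) _.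
rewrite mulrA -exprMn mulVf ?gt_eqF // expr1n mul1r [leRHS]mulrDl; apply: lerD.
  rewrite [leLHS](_ : _ = 2 * Cnew ^+ 2 / gamma * (gamma * `|y n - ybar| ^+ 2)).
    by rewrite ler_wpM2l // divr_ge0 ?(ltW gamma0) // mulr_ge0 // sqr_ge0.
  by field; rewrite gt_eqF.
rewrite mulrAC ler_wpM2r ?residual_ge0 // ler_wpM2l //.
  by rewrite mulr_ge0 // Cnear_ge0.
by rewrite lef_pV2 ?posrE.
Qed.

Lemma linear_rate : exists z C : R, [/\ 0 < z < 1, 0 < C &
  \forall n \near \oo, r n <= C * z ^+ n].
Proof.
(* The mass that [near_mass] eventually guarantees near every optimal point at once. *)
pose t0 := \big[Num.min/(1 : R)]_i (mub i / 2).
have t00 : 0 < t0.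
  by rewrite /t0; elim/big_ind: _ => // [a b a0 b0|i _]; rewrite ?lt_min ?a0 ?b0 // divr_gt0.
have t0_le i : t0 <= mub i / 2 by exact: bigmin_le.
have Mp : 0 < Mpos by rewrite /Mpos ltr_wpDl // Mb_ge0.
pose Q := L * (2 * Cnew ^+ 2 / gamma + 2 * Cnear / t0) + 1.
have Q0 : 0 < Q.
  rewrite /Q ltr_wpDl // mulr_ge0 ?(ltW L0) //; apply: addr_ge0.
    by rewrite divr_ge0 ?(ltW gamma0) // mulr_ge0 ?sqr_ge0.
  by rewrite divr_ge0 ?(ltW t00) // mulr_ge0 // Cnear_ge0.
(* The three bounds keep tau within the available mass, keep the factor z positive, and make the
   quadratic term at most half of the linear gain. *)
pose tau := Num.min t0 (Num.min Mpos (2 * Mpos * Q)^-1).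
have tau0 : 0 < tau by rewrite !lt_min t00 Mp invr_gt0 !mulr_gt0.
have tau1 : tau <= t0 by rewrite ge_min lexx.
have tau2 : tau / Mpos <= 1.
  by rewrite ler_pdivrMr // mul1r !ge_min lexx orbT.
have tau3 : tau * Q <= (2 * Mpos)^-1.
  rewrite -ler_pdivlMr // -invfM; by rewrite !ge_min lexx !orbT.
have tM : 0 < tau / Mpos by rewrite divr_gt0.
pose z := 1 - tau / Mpos / 2.
have z0 : 0 < z by rewrite /z; lra.
suff : \forall n \near \oo, r n.+1 <= z * r n.
  move=> /(linear_decrease z0)[C C0 hC]; exists z, C; split => //.
  by rewrite z0 /z; lra.
have mass : \forall n \near \oo,
    forall i, t0 <= \sum_(x <- A n | near i x.2.2) x.1.
  apply: filter_forall => i; apply: filterS (near_mass i) => n.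
  exact: le_trans.
(* Once eta < s the dual variable is within sigma of pbar, and a maximum above beta can only be
   attained where |pbar| > beta - sigma. *)
pose s := sigma / (c1 * T + 1).
have cT0 : 0 <= c1 * T by rewrite mulr_ge0 ?c1_ge0 // ltW.
have cT : 0 < c1 * T + 1 by rewrite ltr_wpDl.
have s0 : 0 < s by rewrite divr_gt0.
have small : 0 < gamma * s ^+ 2 by rewrite mulr_gt0 // exprn_gt0.
move: mass sq_dist_le (residual_cvg0 small); apply: filterS3 => n hm hy hr.
have [i hi] : exists i, near i (th n).
  apply: contrapT => /forallNP nf.
  have := sep (thI n) (fun i => introN idP (nf i)).
  have hs : `|y n - ybar| < s.
    rewrite -(ltr_pXn2r (n := 2)) ?nnegrE ?(ltW s0) //.
    by rewrite -(ltr_pM2l gamma0) (le_lt_trans hy).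
  have := dual_dist n (thI n).
  have := enormD (pvar (g n) (th n) - pb (th n)) (pb (th n)).
  rewrite subrK -/(P n); have := P_gt n.
  have : c1 * T * `|y n - ybar| < sigma.
    apply: (@le_lt_trans _ _ (c1 * T * s)); first by rewrite ler_wpM2l // ltW.
    by rewrite /s mulrA ltr_pdivrMr // mulrC ltr_pM2l // ltrDl.
  lra.
have tau01 : 0 <= tau <= t0 by rewrite ltW.
apply: le_trans (linear_step t00 tau01 hy hi (hm i)) _.
have rn0 := residual_ge0 n.
have h1 : r n <= Mpos * (P n - beta).
  apply: le_trans (gap n) _; rewrite ler_pM2r ?subr_gt0 ?P_gt //.
  by rewrite /Mpos lerDl.
have h2 : tau / Mpos * r n <= tau * (P n - beta).
  by rewrite -mulrA ler_pM2l // mulrC ler_pdivrMr // mulrC.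
have h3 : tau ^+ 2 * (L * ((2 * Cnew ^+ 2 / gamma + 2 * Cnear / t0) * r n)) <=
    tau / Mpos / 2 * r n.
  apply: (@le_trans _ _ (tau * (tau * Q) * r n)).
    have : 0 <= tau ^+ 2 * r n by rewrite mulr_ge0 ?sqr_ge0.
    rewrite /Q; lra.
  rewrite ler_wpM2r // -mulrA -invfM ler_pM2l //.
  by rewrite (mulrC Mpos).
rewrite /z; lra.
Qed.


End LinearRate.

(** * Integration on the interval and the forward operator *)

Section AeBounds.
Context {R : realType}.
Local Notation leb := (@lebesgue_measure R).
Implicit Types (D : set (measurableTypeR R)) (f g : R -> R).

Lemma ae_bounded_integrable D f M : measurable D -> (leb D < +oo)%E ->
  measurable_fun D f -> {ae leb, forall t, D t -> `|f t| <= M} ->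
  leb.-integrable D (EFin \o f).
Proof.
move=> mD D_fin mf fM.
apply/integrableP; split; first exact/measurable_EFinP.
apply: le_lt_trans (_ : (\int[leb]_(t in D) (cst `|M|%:E t) < +oo)%E).
  apply: ae_ge0_le_integral => //.
  - by apply: measurableT_comp => //; exact/measurable_EFinP.
  - by move=> t _; rewrite lee_fin.
  - apply: filterS fM => t h Dt.
    by rewrite lee_fin (le_trans (h Dt)) // ler_norm.
by rewrite integral_cst // lte_mul_pinfty // lee_fin.
Qed.

Lemma Rintegral_ae_le D f M : measurable D -> (leb D < +oo)%E -> 0 <= M ->
  measurable_fun D f -> {ae leb, forall t, D t -> `|f t| <= M} ->
  `|\int[leb]_(t in D) f t| <= M * fine (leb D).
Proof.
move=> mD D_fin M0 mf fM.
have intf := ae_bounded_integrable mD D_fin mf fM.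
apply: le_trans (le_normr_Rintegral mD intf) _.
rewrite -Rintegral_cst // /Rintegral; apply: fine_le.
- apply: integrable_fin_num => //.
  exact: (integrable_norm intf).
- by rewrite integral_cst // fin_numM // ge0_fin_numE.
apply: ae_ge0_le_integral => //.
- by apply/measurable_EFinP; apply: measurableT_comp.
Qed.

Lemma Rintegral_ae_eq D f g : measurable D -> measurable_fun D f ->
  measurable_fun D g -> {ae leb, forall t, D t -> f t = g t} ->
  \int[leb]_(t in D) f t = \int[leb]_(t in D) g t.
Proof.
move=> mD mf mg fg; rewrite /Rintegral; congr fine.
apply: ae_eq_integral => //; [exact/measurable_EFinP|exact/measurable_EFinP|].
by apply: filterS fg => t h Dt; rewrite h.
Qed.

End AeBounds.

Section Lebesgue.
Context {R : realType} {d : nat}.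
Variable T : R.
Local Notation leb := (@lebesgue_measure R).
Local Notation I := (`]0, T[%classic : set (measurableTypeR R)).
Implicit Types u v : R -> 'rV[R]_d.

Lemma leb_itv_fin (a b : R) (x y : bool) :
  (leb [set` Interval (BSide x a) (BSide y b)] < +oo)%E.
Proof. by rewrite lebesgue_measure_itv /=; case: ifP => // _; rewrite -EFinB ltry. Qed.

Definition measurable_coords (D : set (measurableTypeR R)) u :=
  forall i, measurable_fun D (fun t => u t 0 i).

Lemma measurable_edot D u v : measurable_coords D u -> measurable_coords D v ->
  measurable_fun D (fun t => edot (u t) (v t)).
Proof. by move=> mu mv; apply: measurable_sum => i; exact: measurable_funM. Qed.

Lemma measurable_enorm D u : measurable_coords D u ->
  measurable_fun D (fun t => enorm (u t)).
Proof.
move=> mu; apply: (@measurableT_comp _ _ _ _ _ _ (@Num.sqrt R)).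
  by apply: continuous_measurable_fun; exact: sqrt_continuous.
exact: measurable_edot.
Qed.

Lemma ae_bounded_inLp p u M : measurable_coords I u ->
  {ae leb, forall t, I t -> enorm (u t) <= M} -> inLp T p u.
Proof.
move=> mu uM; split => //.
apply: (@ae_bounded_integrable _ I (fun t => enorm (u t) ^+ p) (M ^+ p)) => //.
- exact: leb_itv_fin.
- by apply: measurable_funX; exact: measurable_enorm.
apply: filterS uM => t h It; rewrite ger0_norm ?exprn_ge0 ?enorm_ge0 //.
by rewrite lerXn2r ?nnegrE ?enorm_ge0 ?h // (le_trans (enorm_ge0 (u t))) ?h.
Qed.

Lemma bounded_inLp p u M : measurable_coords I u ->
  (forall t, I t -> enorm (u t) <= M) -> inLp T p u.
Proof. by move=> mu uM; apply: (ae_bounded_inLp p mu (M := M)); apply: aeW. Qed.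

Lemma inLp_coord_integrable p u i : (0 < p)%N -> inLp T p u ->
  leb.-integrable I (EFin \o (fun t => u t 0 i)).
Proof.
move=> p0 [mu iu].
(* On an interval of finite length 1 + |u|^p is an integrable majorant of each coordinate. *)
have i1 : leb.-integrable I (EFin \o cst (1 : R)).
  apply: (@ae_bounded_integrable _ I (cst 1) 1) => //; first exact: leb_itv_fin.
  by apply: aeW => t _ /=; rewrite normr1.
have := integrableD _ i1 iu => /(_ (measurable_itv _)).
apply: le_integrable => //; first exact/measurable_EFinP.
move=> t It; rewrite /= lee_fin.
have := coord_le_enorm (u t) i; set e := enorm _ => h.
have e0 : 0 <= e by exact: enorm_ge0.
rewrite [leRHS]ger0_norm ?addr_ge0 ?exprn_ge0 //; apply: le_trans h _.
have [e1|e1] := leP e 1; first by rewrite (le_trans e1) // lerDl exprn_ge0.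
rewrite (@le_trans _ _ (e ^+ p)) ?lerDr //.
by rewrite -{1}(expr1 e) ler_weXn2l // ltW.
Qed.

Lemma itv_sub_I (a b : R) : 0 <= a -> b <= T -> `]a, b[ `<=` `]0, T[.
Proof.
move=> a0 bT t /=; rewrite !in_itv /= => /andP[at_ tb].
by rewrite (le_lt_trans a0 at_) (lt_le_trans tb bT).
Qed.

Lemma L2dot_indic_after s i v : 0 <= s ->
  L2dot T (indic_after T s (delta_mx 0 i)) v =
  \int[leb]_(t in `]s, T[) v t 0 i.
Proof.
move=> s0; rewrite /L2dot.
have -> : `]s, T[%classic = I `&` `]s, T[.
  by rewrite setIidr //; exact: itv_sub_I.
rewrite Rintegral_mkcondr; apply: eq_Rintegral => t _.
rewrite /indic_after edotZl edot_delta /patch indicE.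
by case: ifP => _; rewrite ?mul1r ?mul0r.
Qed.

Lemma measurable_indic_after D s (w : 'rV[R]_d) : measurable_coords D (indic_after T s w).
Proof.
move=> i; rewrite (_ : (fun _ => _) = (fun t => w 0 i * \1_(`]s, T[) t)).
  by apply: measurable_funM => //; exact: measurable_indic.
by apply/funext => t; rewrite mxE mulrC.
Qed.

Lemma enorm_indic_after s (w : 'rV[R]_d) t : enorm (indic_after T s w t) <= enorm w.
Proof.
rewrite enormZ indicE; case: (_ \in _) => /=; rewrite ?normr1 ?normr0 ?mul1r //.
by rewrite mul0r enorm_ge0.
Qed.

Lemma inLp_indic_after p s (w : 'rV[R]_d) : inLp T p (indic_after T s w).
Proof.
apply: (@bounded_inLp p _ (enorm w)); first exact: measurable_indic_after.
by move=> t _; exact: enorm_indic_after.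
Qed.

End Lebesgue.

Section BoundedFunctions.
Context {R : realType} {d : nat}.
Variable T : R.
Local Notation leb := (@lebesgue_measure R).
Local Notation I := (`]0, T[%classic : set (measurableTypeR R)).
Implicit Types u v : R -> 'rV[R]_d.

(** K takes arbitrary functions, but linearity and the norm bound are available only in L^2. This
    class lies in every L^p and is stable under the combinations to which K is applied. *)
Definition bounded_meas u : Prop :=
  measurable_coords I u /\ exists M, forall t, I t -> enorm (u t) <= M.

Lemma bounded_meas_inLp p u : bounded_meas u -> inLp T p u.
Proof. by case=> mu [M hM]; exact: bounded_inLp hM. Qed.

Lemma eq_bounded_meas u v : (forall t, I t -> u t = v t) ->
  bounded_meas u -> bounded_meas v.
Proof.
move=> uv [mu [M hM]]; split; last first.
  by exists M => t It; rewrite -uv // hM.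
by move=> i; apply: eq_measurable_fun (mu i) => t /set_mem It; rewrite uv.
Qed.

Lemma bounded_meas_comb a u v : bounded_meas u -> bounded_meas v ->
  bounded_meas (fun t => a *: u t + v t).
Proof.
move=> [mu [M hM]] [mv [M' hM']]; split.
  move=> i; rewrite (_ : (fun _ => _) = (fun t => a * u t 0 i + v t 0 i)).
    by apply: measurable_funD => //; apply: measurable_funM.
  by apply/funext => t; rewrite !mxE.
exists (`|a| * M + M') => t It.
by rewrite (le_trans (enormD _ _)) // lerD ?hM' // enormZ ler_wpM2l ?hM.
Qed.

Lemma bounded_meas_cst w : bounded_meas (cst w : R -> 'rV[R]_d).
Proof. by split => [i|]; [exact: measurable_cst|exists (enorm w)]. Qed.

Lemma bounded_meas_indic s (w : 'rV[R]_d) : bounded_meas (indic_after T s w).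
Proof.
split; first exact: measurable_indic_after.
by exists (enorm w) => t _; exact: enorm_indic_after.
Qed.

Lemma bounded_meas_sum (J : Type) (r : seq J) (a : J -> R) (u : J -> R -> 'rV[R]_d) v :
  (forall j, bounded_meas (u j)) -> bounded_meas v ->
  bounded_meas (fun t => \sum_(j <- r) a j *: u j t + v t).
Proof.
move=> bu bv; elim: r => [|j r ih].
  by apply: eq_bounded_meas bv => t _; rewrite big_nil add0r.
apply: eq_bounded_meas (bounded_meas_comb (a j) (bu j) ih) => t _ /=.
by rewrite big_cons addrA.
Qed.

End BoundedFunctions.

(** * Jump functions produced by [B_op] *)

Section JumpSums.
Context {R : realType} {d : nat}.
Variable T : R.
Local Notation leb := (@lebesgue_measure R).
Local Notation I := (`]0, T[%classic : set (measurableTypeR R)).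
Implicit Types A : seq (R * jump R d).

Lemma jump_sumE A i D :
  jump_sum A i D = (\sum_(x <- A) x.1 * x.2.1 0 i * \1_D x.2.2)%:E.
Proof.
elim: A => [|x A ih]; first by rewrite big_nil.
rewrite big_cons EFinD -ih /jump_sum /= /cadd /= /cscale /=.
by rewrite /charge_of_finite_measure /= /dirac -EFinM.
Qed.

Lemma vmass_jump_sum A D :
  vmass (jump_sum A) D = \sum_(x <- A) (x.1 * \1_D x.2.2) *: x.2.1.
Proof.
apply/rowP => i; rewrite mxE jump_sumE /= summxE; apply: eq_bigr => x _.
by rewrite mxE mulrAC.
Qed.

(** The mean over I of the sum of mu v chi_s, as chi_s has integral T - s. Subtracting it converts
    the mean c of [B_op] into the value left of the first jump. *)
Definition mean_shift A : 'rV[R]_d :=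
  T^-1 *: \sum_(x <- A) (x.1 * (T - x.2.2)) *: x.2.1.

Lemma integral_indic_sum A (a : R * jump R d -> R) :
  {in A, forall x, 0 < x.2.2 < T} ->
  leb.-integrable I (EFin \o (fun s => \sum_(x <- A) a x * \1_(`]0, s[) x.2.2)) /\
  \int[leb]_(s in I) (\sum_(x <- A) a x * \1_(`]0, s[) x.2.2) =
  \sum_(x <- A) a x * (T - x.2.2).
Proof.
elim: A => [|x A ih] xA.
  have -> : (fun s : R => \sum_(x <- [::]) a x * \1_(`]0, s[) x.2.2) = cst 0.
    by apply/funext => s; rewrite big_nil.
  rewrite Rintegral_cst // mul0r big_nil; split => //.
  apply: (@ae_bounded_integrable _ I (cst 0) 0) => //; first exact: leb_itv_fin.
  by apply: aeW => t _ /=; rewrite normr0.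
have /andP[x0 xT] : 0 < x.2.2 < T by apply: xA; rewrite mem_head.
have {}ih := ih (fun y (yA : y \in A) => xA y (@mem_behead _ (x :: A) y yA)).
(* The jump point lies in (0, s) exactly when s lies to its right, which turns a function of the set
   into an indicator in s. *)
have hind s : I s -> \1_(`]0, s[) x.2.2 = \1_(`]x.2.2, T[) s :> R.
  rewrite /= in_itv /= => /andP[s0 sT]; rewrite !indicE; congr ((nat_of_bool _)%:R).
  by apply/idP/idP; rewrite !inE /= !in_itv /= ?x0 ?sT ?andbT.
have mind : measurable_fun I (fun s => a x * \1_(`]x.2.2, T[) s).
  by apply: measurable_funM => //; exact: measurable_indic.
have iind : leb.-integrable I (EFin \o (fun s => a x * \1_(`]0, s[) x.2.2)).
  apply: (@ae_bounded_integrable _ I _ `|a x|) => //; first exact: leb_itv_fin.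
    by apply: eq_measurable_fun mind => s /set_mem /hind ->.
  apply: aeW => t _; rewrite normrM ler_piMr // indicE.
  by case: (_ \in _) => /=; rewrite ?normr1 ?normr0.
split.
  have := integrableD _ iind ih.1 => /(_ (measurable_itv _)).
  by apply: eq_integrable => // t _; rewrite /= big_cons EFinD.
have -> : \int[leb]_(s in I) (\sum_(y <- x :: A) a y * \1_(`]0, s[) y.2.2) =
    \int[leb]_(s in I) (a x * \1_(`]0, s[) x.2.2 +
      \sum_(y <- A) a y * \1_(`]0, s[) y.2.2).
  by apply: eq_Rintegral => t _; rewrite big_cons.
rewrite RintegralD ?ih.2 ?big_cons //; last exact: ih.1.
congr (_ + _).
have -> : \int[leb]_(s in I) (a x * \1_(`]0, s[) x.2.2) =
    \int[leb]_(s in I) (a x * \1_(`]x.2.2, T[) s).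
  by apply: eq_Rintegral => s /set_mem /hind ->.
rewrite RintegralZl //; last first.
  apply: (@ae_bounded_integrable _ I _ 1) => //; first exact: leb_itv_fin.
  apply: aeW => t _; rewrite indicE.
  by case: (_ \in _) => /=; rewrite ?normr1 ?normr0.
congr (_ * _).
rewrite /Rintegral integral_indic // setIidl; last exact: itv_sub_I (ltW x0) _.
have h : leb `]x.2.2, T[ = (T - x.2.2)%:E.
  by rewrite lebesgue_measure_itv /= lte_fin xT -EFinB.
exact: (congr1 fine h).
Qed.

Lemma B_op_jump_sum A c t : {in A, forall x, 0 < x.2.2 < T} -> I t ->
  B_op T (jump_sum A) c t =
  \sum_(x <- A) x.1 *: indic_after T x.2.2 x.2.1 t + (c - mean_shift A).
Proof.
move=> xA It; rewrite /B_op vmass_jump_sum addrAC -addrA; congr (_ + (c - _)).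
  rewrite big_seq [RHS]big_seq; apply: eq_bigr => x /xA /andP[x0 xT].
  rewrite scalerA; congr (_ * _ *: _); rewrite !indicE; congr ((nat_of_bool _)%:R).
  move: It; rewrite /= in_itv /= => /andP[t0 tT].
  by apply/idP/idP; rewrite !inE /= !in_itv /= ?x0 ?tT ?andbT.
congr (_ *: _); apply/rowP => i; rewrite mxE summxE.
have -> : \int[leb]_(s in I) vmass (jump_sum A) `]0, s[ 0 i =
    \int[leb]_(s in I) (\sum_(x <- A) (x.1 * x.2.1 0 i) * \1_(`]0, s[) x.2.2).
  apply: eq_Rintegral => s _; rewrite vmass_jump_sum summxE.
  by apply: eq_bigr => x _; rewrite mxE mulrAC.
rewrite (integral_indic_sum _ xA).2.
by apply: eq_bigr => x _; rewrite mxE mulrAC.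
Qed.

Lemma bounded_meas_B_op A c : {in A, forall x, 0 < x.2.2 < T} ->
  bounded_meas T (B_op T (jump_sum A) c).
Proof.
move=> xA; apply: eq_bounded_meas (@bounded_meas_sum _ _ T _ A fst
  (fun x => indic_after T x.2.2 x.2.1) (cst (c - mean_shift A)) _ _).
- by move=> t It; rewrite B_op_jump_sum.
- by move=> x; exact: bounded_meas_indic.
- exact: bounded_meas_cst.
Qed.

End JumpSums.

Section ForwardOperator.
Context {R : realType} {d : nat} {Y : completeNormedModType R}.
Variable T : R.
Hypothesis T0 : 0 < T.
Variable ip : {dot Y for idfun}.
Hypothesis hip : forall y, ip y y = `|y| ^+ 2.
Variables (K : (R -> 'rV[R]_d) -> Y) (Kstar : Y -> R -> 'rV[R]_d).
Hypotheses (hK : lin_cont_L2 T K) (hKstar : is_adjoint T ip K Kstar).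
Hypothesis hKinf : cont_to_Linfty T Kstar.
Local Notation leb := (@lebesgue_measure R).
Local Notation I := (`]0, T[%classic : set (measurableTypeR R)).
Implicit Types (u v : R -> 'rV[R]_d) (A : seq (R * jump R d)).

Lemma K_zero : K (fun=> 0) = 0.
Proof.
have z : inLp T 2 (fun=> 0 : 'rV[R]_d).
  by apply: bounded_meas_inLp; exact: bounded_meas_cst.
have := hK.1 1 _ _ z z; rewrite (_ : (fun t => _) = fun=> 0); last first.
  by apply/funext => t; rewrite scaler0 addr0.
by move/eqP; rewrite scale1r -[X in X == _]addr0 (inj_eq (addrI _)) eq_sym => /eqP.
Qed.

(** K acts on representatives; the bound by the L^2 norm of the difference makes it blind to null
    sets. *)
Lemma K_ae_eq u v : inLp T 2 u -> inLp T 2 v ->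
  {ae leb, forall t, I t -> u t = v t} -> K u = K v.
Proof.
move=> iu iv uv.
have e : K (fun t => -1 *: v t + u t) = -1 *: K v + K u by exact: hK.1.
suff : K (fun t => -1 *: v t + u t) = 0.
  by rewrite e scaleN1r addrC => /eqP; rewrite subr_eq0 => /eqP.
have mw : measurable_coords I (fun t => -1 *: v t + u t).
  move=> i; rewrite (_ : (fun _ => _) = (fun t => -1 * v t 0 i + u t 0 i)).
    apply: measurable_funD; last exact: iu.1.
    by apply: measurable_funM => //; exact: iv.1.
  by apply/funext => t; rewrite !mxE.
have w0 : {ae leb, forall t, I t -> -1 *: v t + u t = 0}.
  by apply: filterS uv => t h It; rewrite h // scaleN1r addNr.
have iw : inLp T 2 (fun t => -1 *: v t + u t).
  apply: (@ae_bounded_inLp _ _ _ _ _ 0) => //.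
  by apply: filterS w0 => t h It; rewrite h // enorm0.
have [C hC] := hK.2; have := hC _ iw; suff -> : L2norm T (fun t => -1 *: v t + u t) = 0.
  by rewrite mulr0 normr_le0 => /eqP.
rewrite /L2norm /L2dot.
have -> : \int[leb]_(t in I) edot (-1 *: v t + u t) (-1 *: v t + u t) =
    \int[leb]_(t in I) (0 : R).
  apply: Rintegral_ae_eq => //; first exact: measurable_edot.
  by apply: filterS w0 => t h It; rewrite h // -sqr_enorm enorm0 expr0n.
by rewrite Rintegral_cst // mul0r sqrtr0.
Qed.

Lemma K_eq u v : bounded_meas T u -> (forall t, I t -> u t = v t) -> K u = K v.
Proof.
move=> bu uv; apply: K_ae_eq; last exact: aeW.
- exact: bounded_meas_inLp.
- exact/bounded_meas_inLp/(eq_bounded_meas uv bu).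
Qed.

Lemma K_comb (J : Type) (r : seq J) (a : J -> R) (w : J -> R -> 'rV[R]_d) v :
  (forall j, bounded_meas T (w j)) -> bounded_meas T v ->
  K (fun t => \sum_(j <- r) a j *: w j t + v t) =
  \sum_(j <- r) a j *: K (w j) + K v.
Proof.
move=> bw bv; elim: r => [|j r ih].
  rewrite big_nil add0r; congr K; apply/funext => t.
  by rewrite big_nil add0r.
rewrite big_cons -addrA -ih.
rewrite -hK.1; [|exact: bounded_meas_inLp|].
  by congr K; apply/funext => t; rewrite big_cons addrA.
by apply: bounded_meas_inLp; exact: bounded_meas_sum.
Qed.

Definition kvec (i : 'I_d) (s : R) : Y := K (indic_after T s (delta_mx 0 i)).

Lemma K_indic_after s (v : 'rV[R]_d) : K (indic_after T s v) = kap kvec s v.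
Proof.
have -> : indic_after T s v =
    fun t => \sum_(i <- index_enum 'I_d) v 0 i *: indic_after T s (delta_mx 0 i) t
      + (fun=> 0) t.
  apply/funext => t; rewrite addr0 /indic_after.
  rewrite {1}(row_sum_delta v) scaler_sumr; apply: eq_bigr => i _.
  by rewrite !scalerA mulrC.
rewrite K_comb ?K_zero ?addr0 //; first by move=> i; exact: bounded_meas_indic.
exact: bounded_meas_cst.
Qed.

Lemma K_cst (v : 'rV[R]_d) : K (cst v) = kap kvec 0 v.
Proof.
rewrite -K_indic_after; apply: K_eq; first exact: bounded_meas_cst.
by move=> t It; rewrite /indic_after indicE mem_set // scale1r.
Qed.

Lemma K_B_op A c : {in A, forall x, 0 < x.2.2 < T} ->
  K (B_op T (jump_sum A) c) = Phi kvec A (c - mean_shift T A).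
Proof.
move=> xA; rewrite (K_eq (bounded_meas_B_op c xA) (fun t => @B_op_jump_sum _ _ T A c t xA)).
rewrite K_comb; [|by move=> x; exact: bounded_meas_indic|exact: bounded_meas_cst].
rewrite K_cst /Phi; congr (_ + _); apply: eq_bigr => x _.
by rewrite K_indic_after.
Qed.

Lemma Kstar_integrable w i : leb.-integrable I (EFin \o (fun t => Kstar w t 0 i)).
Proof. exact: (inLp_coord_integrable i _ (hKstar w).1). Qed.

Lemma ip_kvec i s w : 0 <= s ->
  ip (kvec i s) w = \int[leb]_(t in `]s, T[) Kstar w t 0 i.
Proof.
move=> s0; rewrite (hKstar w).2; last exact: inLp_indic_after.
exact: L2dot_indic_after.
Qed.

Lemma ip_kvecB i s t w : 0 <= s -> s <= t <= T ->
  ip (kvec i s - kvec i t) w = \int[leb]_(x in `]s, t[) Kstar w x 0 i.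
Proof.
move=> s0 /andP[st tT]; have t0 := le_trans s0 st.
rewrite linearBl /= !ip_kvec //.
have isub a b : 0 <= a -> b <= T ->
    leb.-integrable `]a, b[ (EFin \o (fun x => Kstar w x 0 i)).
  move=> a0 bT; apply: integrableS (Kstar_integrable w i) => //.
  exact: itv_sub_I.
have [->|tT'] := eqVneq t T.
  by rewrite set_itvoo0 Rintegral_set0 subr0.
have {}tT' : t < T by rewrite lt_neqAle tT' tT.
rewrite -(@Rintegral_itvB _ _ (BRight s) (BLeft T) t) ?bnd_simp //; last exact: isub.
rewrite opprB addrC subrK Rintegral_itv_bndo_bndc //.
exact: isub.
Qed.

Lemma primitive_pvar w t : 0 <= t <= T -> primitive (Kstar w) t = pvar ip kvec w t.
Proof. by move=> tT; apply/rowP => i; rewrite !mxE ip_kvecB. Qed.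

(** Self-duality: for w the difference of the two observations, |w|^2 is the integral of a
    coordinate of [Kstar w] over (s, t). The L^oo bound gives C |w| (t - s), and one factor |w|
    cancels; an L^2 bound would give only the power 1/2 of t - s. *)
Lemma kvec_lip : exists2 C, 0 <= C & forall i s t, 0 <= s <= T -> 0 <= t <= T ->
  `|kvec i s - kvec i t| <= C * `|s - t|.
Proof.
have [C0 hC0] := hKinf; pose C := `|C0|; exists C; first exact: normr_ge0.
move=> i; have Cn : 0 <= C by exact: normr_ge0.
have key s t : 0 <= s -> s <= t <= T -> `|kvec i s - kvec i t| <= C * (t - s).
  move=> s0 st; have /andP[st' tT] := st; set w := kvec i s - kvec i t.
  have [->|w0] := eqVneq w 0; first by rewrite normr0 mulr_ge0 // subr_ge0.
  have {}w0 : 0 < `|w| by rewrite normr_gt0.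
  have := hip w; rewrite {1}/w ip_kvecB // -/w => e.
  suff : `|w| ^+ 2 <= C * `|w| * (t - s).
    by rewrite expr2 -mulrA mulrCA ler_pM2l.
  have hae : {ae leb, forall x, `]s, t[%classic x -> `|Kstar w x 0 i| <= C * `|w|}.
    have hw : {ae leb, forall x, I x -> enorm (Kstar w x) <= C0 * `|w|} := hC0 w.
    apply: filterS hw => x h xst; apply: le_trans (coord_le_enorm _ _) _.
    apply: le_trans (h _) _; first exact: itv_sub_I s0 tT _ xst.
    by rewrite ler_wpM2r // ler_norm.
  rewrite -e; apply: le_trans (ler_norm _) _.
  have -> : t - s = fine (leb `]s, t[).
    rewrite lebesgue_measure_itv /= lte_fin; case: ltP => //= ts.
    by rewrite (@le_anti _ _ s t) ?subrr // st' ts.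
  apply: Rintegral_ae_le hae => //.
  - exact: leb_itv_fin.
  - by rewrite mulr_ge0.
  - apply: measurable_funS ((hKstar w).1.1 i) => //; exact: itv_sub_I.
move=> s t /andP[s0 sT] /andP[t0 tT]; have [st|ts] := leP s t.
  by rewrite [`|s - t|]distrC ger0_norm ?subr_ge0 // key // st.
by rewrite ger0_norm ?subr_ge0 ?(ltW ts) // distrC key // (ltW ts).
Qed.

End ForwardOperator.

(** * Smooth steps and density of test functions *)

Section SmoothFunctions.
Context {R : realType}.
Implicit Types (f g : R -> R) (x : R) (n : nat).

(** Exhibiting the derivative at each order lets sums, products, inverses and affine substitutions
    be treated by induction, without formulas for iterated derivatives. *)
Fixpoint Cn n f : Prop :=
  if n is n'.+1 then
    exists f', (forall x, is_derive x (1 : R) f (f' x)) /\ Cn n' f'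
  else True.

Definition smooth f := forall n x, derivable (derive1n n f) x 1.

Lemma is_derive1_funE f f' : (forall x, is_derive x (1 : R) f (f' x)) ->
  derive1 f = f'.
Proof.
by move=> h; apply/funext => x; rewrite derive1E; have [_ ->] := h x.
Qed.

Lemma Cn_smooth f : (forall n, Cn n f) -> smooth f.
Proof.
move=> h n; move: f {h}(h n.+1); elim: n => [|n ih] f [f' [df Cf]] x.
  by have [] := df x.
by rewrite derive1Sn (is_derive1_funE df); exact: ih.
Qed.

Lemma CnW n f : Cn n.+1 f -> Cn n f.
Proof.
elim: n f => [//|n ih] f [f' [df Cf]]; exists f'; split => //.
exact: ih.
Qed.

Lemma Cn_cst n (a : R) : Cn n (fun=> a).
Proof.
elim: n a => [//|n ih] a; exists (fun=> 0); split => // x.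
exact: is_derive_cst.
Qed.

Lemma CnD n f g : Cn n f -> Cn n g -> Cn n (fun x => f x + g x).
Proof.
elim: n f g => [//|n ih] f g [f' [df Cf]] [g' [dg Cg]].
exists (fun x => f' x + g' x); split; last exact: ih.
by move=> x; have := df x; have := dg x => ? ?; exact: is_deriveD.
Qed.

Lemma CnM n f g : Cn n f -> Cn n g -> Cn n (fun x => f x * g x).
Proof.
elim: n f g => [//|n ih] f g Cf Cg.
have Cf0 := CnW Cf; have Cg0 := CnW Cg.
case: Cf => f' [df Cf]; case: Cg => g' [dg Cg].
exists (fun x => f x * g' x + g x * f' x); split; last by apply: CnD; exact: ih.
by move=> x; have := df x; have := dg x => ? ?; exact: is_deriveM.
Qed.

Lemma CnZ n (a : R) f : Cn n f -> Cn n (fun x => a * f x).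
Proof. by move=> Cf; apply: CnM => //; exact: Cn_cst. Qed.

Lemma Cn_sum n m (a : 'I_m -> R -> R) : (forall k, Cn n (a k)) ->
  Cn n (fun x => \sum_(k < m) a k x).
Proof.
move=> Ca; elim: m a Ca => [|m ih] a Ca.
  rewrite (_ : (fun _ => _) = fun=> 0); first exact: Cn_cst.
  by apply/funext => x; rewrite big_ord0.
rewrite (_ : (fun _ => _) = fun x => \sum_(k < m) a (widen_ord (leqnSn m) k) x + a ord_max x).
  by apply: CnD => //; apply: ih.
by apply/funext => x; rewrite big_ord_recr.
Qed.

Lemma is_derive_affine (a b x : R) :
  is_derive x (1 : R) (fun y => a * y + b) a.
Proof.
have h : is_derive x (1 : R) ((a *: (id : R -> R^o)) + cst b) (a *: (1 : R^o) + 0).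
  exact: is_deriveD.
by apply: is_derive_eq h _; rewrite addr0 /GRing.scale /= mulr1.
Qed.

Lemma Cn_affine n f (a b : R) : Cn n f -> Cn n (fun x => f (a * x + b)).
Proof.
elim: n f => [//|n ih] f [f' [df Cf]].
exists (fun x => a * f' (a * x + b)); split; last exact: CnZ (ih _ Cf).
move=> x; have h := is_derive_affine a b x.
have := df (a * x + b) => hf.
have := @is_derive1_comp _ f (fun y => a * y + b) x _ _ hf h.
by rewrite mulrC.
Qed.

Lemma CnV n f : (forall x, f x != 0) -> Cn n f -> Cn n (fun x => (f x)^-1).
Proof.
move=> f0; elim: n => [//|n ih] Cf; have Ci := ih (CnW Cf).
case: Cf => f' [df Cf].
exists (fun x => - 1 * ((f x)^-1 * (f x)^-1 * f' x)); split; last first.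
  by apply: CnZ; apply: CnM => //; exact: CnM.
move=> x; apply: is_derive_eq (is_deriveV (f0 x) (df x)) _.
rewrite /GRing.scale /= expr2 invfM; ring.
Qed.

(** The case m = 0 is the usual flat function exp(-1/x); the powers of 1/x make the family stable
    under differentiation up to linear combinations. *)
Definition flat m x : R := if 0 < x then x^-1 ^+ m * expR (- x^-1) else 0.

(** Serves the derivative at 0, where it bounds the difference quotient by C |h|. The exponential of
    y = 1/x is at least y^(m+2) / (m+2)!, two powers more than [flat m] contains. *)
Lemma flat_small m : exists2 C, 0 <= C & forall x, `|flat m x| <= C * x ^+ 2.
Proof.
exists (m.+2 `!)%:R => // x; rewrite /flat; case: ifPn => [x0|_]; last first.
  by rewrite normr0 mulr_ge0 // sqr_ge0.
have y0 : 0 < x^-1 by rewrite invr_gt0.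
rewrite ger0_norm ?mulr_ge0 ?exprn_ge0 ?expR_ge0 // ?(ltW y0) //.
have := @expR_ge1Dxn R x^-1 m.+1 (ltW y0).
have f0 : 0 < (m.+2 `!)%:R :> R by rewrite ltr0n fact_gt0.
rewrite expRN => h; rewrite ler_pdivrMr ?expR_gt0 //.
have {}h : x^-1 ^+ m.+2 <= (m.+2)`!%:R * expR x^-1.
  by rewrite mulrC -ler_pdivrMr // (le_trans _ h) // lerDr.
have -> : x^-1 ^+ m = x ^+ 2 * x^-1 ^+ m.+2.
  by rewrite -[m.+2]addn2 exprD mulrCA -exprMn divff ?gt_eqF // expr1n mulr1.
by rewrite [leRHS]mulrAC [leLHS]mulrC ler_pM2r ?exprn_gt0.
Qed.

Lemma flat_derive m x :
  is_derive x (1 : R) (flat m) (flat m.+2 x + - m%:R * flat m.+1 x).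
Proof.
have [x0|x0|x0] := ltgtP x 0.
- rewrite /flat ltNge (ltW x0) /= mulr0 addr0.
  apply: (@near_eq_is_derive _ _ _ (cst 0)).
  near=> y; rewrite /= ltNge (_ : y <= 0) //=; apply: ltW.
  by near: y; exact: lt_nbhsl.
- have dV : is_derive x (1 : R) (fun y : R => y^-1) (- x^-1 ^+ 2).
    have xn0 : id x != 0 by rewrite gt_eqF.
    apply: is_derive_eq (is_deriveV xn0 (is_derive_id x 1)) _.
    by rewrite /GRing.scale /= mulr1 exprVn.
  apply: (@near_eq_is_derive _ _ _ (fun y : R => y^-1 ^+ m * expR (- y^-1))).
    near=> y; rewrite /flat ifT //; near: y; exact: lt_nbhsr.
  have dN : is_derive x (1 : R) (fun y : R => - y^-1) (x^-1 ^+ 2).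
    by apply: is_derive_eq (is_deriveN dV) _; rewrite opprK.
  have dE := @is_derive1_comp _ expR (fun y : R => - y^-1) x _ _ (is_derive_expR (- x^-1)) dN.
  have dX : is_derive x (1 : R) (fun y : R => y^-1 ^+ m)
      (m%:R * x^-1 ^+ m.-1 * (- x^-1 ^+ 2)).
    rewrite (_ : (fun y : R => _) = (fun y : R => y^-1) ^+ m).
      by apply: is_derive_eq (is_deriveX m dV) _.
    by apply/funext => y; elim: m => [|m ih]; rewrite ?expr0 // !exprS ih.
  apply: is_derive_eq (is_deriveM dX dE) _.
  rewrite /flat x0 /GRing.scale /=; clear dX; case: m => [|m].
    rewrite !mul0r mulr0 oppr0 !mul0r !addr0 expr0 /=; ring.
  rewrite /= !exprS; ring.
have fl0 k : flat k 0 = 0 by rewrite /flat ltxx.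
rewrite x0 !fl0 mulr0 addr0.
have [C C0 hC] := flat_small m.
have hcv : h^-1 *: ((flat m \o shift 0) (h *: 1) - flat m 0) @[h --> (0 : R)^'] --> (0 : R).
  apply/cvgr0Pnorm_lt => eps eps0.
  have Cp : 0 < C + 1 by rewrite ltr_wpDl.
  near=> h; have hn0 : h != 0 by near: h; exact: nbhs_dnbhs_neq.
  rewrite /= /GRing.scale /= mulr1 addr0 fl0 subr0 normrM normfV.
  apply: (@le_lt_trans _ _ (C * `|h|)).
    rewrite mulrC ler_pdivrMr ?normr_gt0 // -mulrA -expr2 real_normK ?num_real //.
  apply: (@lt_le_trans _ _ ((C + 1) * (eps / (C + 1)))); last first.
    by rewrite mulrC mulfVK ?gt_eqF.
  rewrite (@le_lt_trans _ _ ((C + 1) * `|h|)) ?ler_wpM2r ?lerDl // ltr_pM2l //.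
  near: h; apply: dnbhs0_lt; exact: divr_gt0.
apply: DeriveDef; first by apply/cvg_ex; exists 0.
exact/cvg_lim.
Unshelve. all: by end_near. Qed.

End SmoothFunctions.

Section C1Integral.
Context {R : realType}.
Local Notation leb := (@lebesgue_measure R).

Lemma is_derive_continuous (f f' : R -> R) :
  (forall x, is_derive x (1 : R) f (f' x)) -> continuous f.
Proof.
by move=> df x; apply/differentiable_continuous/derivable1_diffP; have [] := df x.
Qed.

Lemma C1_integral (f f' : R -> R) (a b : R) : a <= b ->
  (forall x, is_derive x (1 : R) f (f' x)) -> continuous f' ->
  leb.-integrable `]a, b[ (EFin \o f') /\
  \int[leb]_(x in `]a, b[) f' x = f b - f a.
Proof.
rewrite le_eqVlt => /predU1P[<- _ _|ab df cf].
  by rewrite set_itvoo0 Rintegral_set0 subrr; split => //; exact: integrable_set0.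
have icc : leb.-integrable `[a, b] (EFin \o f').
  apply: continuous_compact_integrable; first exact: segment_compact.
  exact: continuous_subspaceT.
have ico : leb.-integrable `]a, b] (EFin \o f').
  by apply: integrableS icc => //; exact: subset_itv_oc_cc.
have ioo : leb.-integrable `]a, b[ (EFin \o f').
  by apply: integrableS icc => //; exact: subset_itv_oo_cc.
split => //.
rewrite Rintegral_itv_bndo_bndc // Rintegral_itv_obnd_cbnd //.
have cF : continuous f := is_derive_continuous df.
rewrite /Rintegral (@continuous_FTC2 _ f' f) //.
- exact: continuous_subspaceT.
- split; first by move=> x _; have [] := df x.
  + exact: (cvg_at_right_filter (cF a)).
  + exact: (cvg_at_left_filter (cF b)).
- by move=> x _; rewrite derive1E; have [_ ->] := df x.
Qed.

End C1Integral.

Section SmoothStep.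
Context {R : realType}.
Implicit Types (x : R) (n : nat).

Lemma Cn_flat n m : Cn n (flat m : R -> R).
Proof.
elim: n m => [//|n ih] m.
exists (fun x => flat m.+2 x + - m%:R * flat m.+1 x); split.
  exact: flat_derive.
by apply: CnD => //; exact: CnZ.
Qed.

Lemma flat_ge0 x : 0 <= flat 0 x.
Proof.
by rewrite /flat; case: ifP => // _; rewrite mulr_ge0 ?expr0 // expR_ge0.
Qed.

Lemma flat_gt0 x : (0 < flat 0 x) = (0 < x).
Proof.
rewrite /flat; case: ifP => [_|_]; last by rewrite ltxx.
by rewrite expr0 mul1r expR_gt0.
Qed.

Lemma flat_le0 x : x <= 0 -> flat 0 x = 0.
Proof. by move=> x0; rewrite /flat ltNge x0. Qed.

(** The quotient of flat functions that rises from 0 at -1 to 1 at 1; the arguments have the shape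
    required by [Cn_affine]. *)
Definition step x : R :=
  flat 0 (1 * x + 1) * (flat 0 (1 * x + 1) + flat 0 (-1 * x + 1))^-1.

Lemma step_den_gt0 x : 0 < flat 0 (1 * x + 1) + flat 0 (-1 * x + 1).
Proof.
have [x0|x0] := leP x 0.
  by rewrite ltr_wpDl ?flat_ge0 // flat_gt0; lra.
by rewrite ltr_pwDl ?flat_ge0 // flat_gt0; lra.
Qed.

Lemma Cn_step n : Cn n step.
Proof.
have C (a b : R) := Cn_affine a b (@Cn_flat n 0).
apply: CnM; first exact: C.
apply: CnV; last by apply: CnD; exact: C.
by move=> x; rewrite gt_eqF // step_den_gt0.
Qed.

Lemma step_ge0 x : 0 <= step x.
Proof. by rewrite /step divr_ge0 ?flat_ge0 // ltW // step_den_gt0. Qed.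

Lemma step_le1 x : step x <= 1.
Proof. by rewrite /step ler_pdivrMr ?step_den_gt0 // [leRHS]mul1r lerDl flat_ge0. Qed.

Lemma step0 x : x <= -1 -> step x = 0.
Proof. by move=> x1; rewrite /step flat_le0 ?mul0r //; lra. Qed.

Lemma step1 x : 1 <= x -> step x = 1.
Proof.
move=> x1; rewrite /step (@flat_le0 (-1 * x + 1)); last by lra.
by rewrite addr0 mulfV // gt_eqF // flat_gt0; lra.
Qed.

(** The derivative of the step is the mollifier of the du Bois-Reymond argument. Two orders of
    [Cn_step] are used: the second makes the first derivative continuous. *)
Lemma step_bump : exists bump : R -> R,
  [/\ forall x, is_derive x (1 : R) step (bump x), continuous bump,
      forall x, 1 < `|x| -> bump x = 0 & exists M, forall x, `|bump x| <= M].
Proof.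
have [b [db [b' [db' _]]]] := Cn_step 2.
have cb : continuous b := is_derive_continuous db'.
have b0 x : 1 < `|x| -> b x = 0.
  rewrite lter_normr; move=> x1.
  have [_ <-] := db x; suff [_ ->] : is_derive x (1 : R) step 0 by [].
  have [{}x1|{}x1] := orP x1.
    apply: (@near_eq_is_derive _ _ _ (fun=> 1 : R)).
    near=> y; rewrite step1 //; apply: ltW; near: y; exact: lt_nbhsr.
  have {}x1 : x < -1 by lra.
  apply: (@near_eq_is_derive _ _ _ (fun=> 0 : R)).
  near=> y; rewrite step0 //; apply: ltW; near: y; exact: lt_nbhsl.
exists b; split => //.
have le11 : -1 <= 1 :> R by lra.
have cn : {within `[(-1 : R), 1], continuous (fun x => `|b x|)}.
  apply: continuous_subspaceT => x.
  exact: (continuous_comp (@cb x) (@norm_continuous _ _ _)).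
have [c _ hc] := EVT_max le11 cn.
exists `|b c| => x; have [x1|x1] := leP `|x| 1; last by rewrite b0 // normr0.
by apply: hc; rewrite in_itv /= -ler_norml.
Unshelve. all: by end_near. Qed.

End SmoothStep.

(** * Density of test functions in C_0 *)

Section Density.
Context {R : realType}.
Variable T : R.
Hypothesis T0 : 0 < T.
Implicit Types (f : R -> R) (a b x : R).

Lemma segment_uniform_continuity f a b eps : 0 < eps ->
  (forall x, a <= x <= b -> {for x, continuous f}) ->
  exists2 delta, 0 < delta & forall x y, a <= x <= b -> `|x - y| < delta ->
    `|f x - f y| < eps.
Proof.
move=> eps0 cf.
have /compact_near_coveringP cover := @segment_compact R a b.
have e2 : 0 < eps / 2 by rewrite divr_gt0.
have : \forall delta \near (0 : R)^'+, `[a, b]%classic `<=`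
    (fun x => forall y, `|x - y| < delta -> `|f x - f y| < eps).
  apply: (cover R (0 : R)^'+
    (fun delta x => forall y, `|x - y| < delta -> `|f x - f y| < eps)).
  move=> x /=; rewrite in_itv /= => /cf /cvgrPdist_lt /(_ _ e2) [r /= r0 hr].
  have r2 : 0 < r / 2 by rewrite divr_gt0.
  exists (ball x (r / 2), [set delta | delta < r / 2]).
    by split => /=; [exact: nbhsx_ballx|exact: nbhs_right_lt].
  move=> [z delta] /= [xz dr] y zy.
  have h1 : `|f x - f z| < eps / 2.
    by apply: hr; rewrite /ball /= in xz *; apply: lt_le_trans xz _; lra.
  have h2 : `|f x - f y| < eps / 2.
    apply: hr; rewrite /ball /= in xz *.
    rewrite -(subrK z x) -addrA (le_lt_trans (ler_normD _ _)) //.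
    have -> : r = r / 2 + r / 2 by field.
    by rewrite ltrD // (lt_trans zy).
  rewrite -(subrK (f x) (f z)) -addrA (le_lt_trans (ler_normD _ _)) //.
  by rewrite distrC; lra.
move=> near0; have [delta [d0 hd]] : exists delta, 0 < delta /\
    `[a, b]%classic `<=` (fun x => forall y, `|x - y| < delta -> `|f x - f y| < eps).
  have := nbhs_right_gt (0 : R) => pos.
  have [delta [? ?]] := filter_ex (filterI pos near0).
  by exists delta.
exists delta => // x y xab xy; apply: hd xy.
by rewrite /= in_itv.
Qed.

(** Between nodes j and j + 1 all earlier steps are complete and no later one has begun, so a single
    term is partial. *)
Lemma telescoping_step (c s : nat -> R) (j : nat) (t : R) :
  (forall k, (k < j)%N -> s k = 1) -> s j = t ->
  (forall k, (j < k)%N -> s k = 0) -> forall n, (j < n)%N ->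
  \sum_(k < n) (c k.+1 - c k) * s k = c j - c 0%N + (c j.+1 - c j) * t.
Proof.
move=> s1 sj s0.
have below m : (m <= j)%N -> \sum_(k < m) (c k.+1 - c k) * s k = c m - c 0%N.
  elim: m => [|m ih] mj; first by rewrite big_ord0 subrr.
  by rewrite big_ord_recr /= ih ?(ltnW mj) // s1 //; ring.
elim=> [//|n ih]; rewrite ltnS leq_eqVlt => /predU1P[<-|jn].
  by rewrite big_ord_recr /= below // sj.
by rewrite big_ord_recr /= ih // s0 // mulr0 addr0.
Qed.

(* The approximant interpolates the values of [f] at equidistant nodes by
   smooth steps, after replacing the values at the two extreme nodes by 0. *)
Lemma test_function_density f eps : 0 < eps ->
  (forall x, 0 < x < T -> {for x, continuous f}) ->
  f x @[x --> 0^'+] --> (0 : R) -> f x @[x --> T^'-] --> (0 : R) ->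
  exists phi, [/\ test_function T phi, exists B, forall x, `|phi x| <= B &
    forall x, 0 < x < T -> `|f x - phi x| <= eps].
Proof.
move=> eps0 cf f0 fT; pose e := eps / 2; have e0 : 0 < e by rewrite divr_gt0.
have T32 : T / 3 < T / 2 by rewrite ltr_pM2l // ltf_pV2 ?posrE // ltr_nat.
have [a [a0 aT ha]] : exists a, [/\ 0 < a, a < T / 2 &
    forall x, 0 < x <= a -> `|f x| <= e].
  have /cvgrPdist_le/(_ _ e0)[r /= r0 hr] := f0.
  exists (Num.min (r / 2) (T / 3)); split.
  - by rewrite lt_min !divr_gt0.
  - by rewrite gt_min; apply/orP; right; exact: T32.
  move=> x /andP[x0]; rewrite le_min => /andP[xr _].
  have := hr x; rewrite /= sub0r normrN => /(_ _ x0); rewrite sub0r normrN; apply.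
  by rewrite gtr0_norm //; lra.
have [b [Tb bT hb]] : exists b, [/\ T / 2 < b, b < T &
    forall x, b <= x < T -> `|f x| <= e].
  have /cvgrPdist_le/(_ _ e0)[r /= r0 hr] := fT.
  exists (Num.max (T - r / 2) (T - T / 3)); split.
  - by rewrite lt_max; apply/orP; right; lra.
  - by rewrite gt_max; apply/andP; split; lra.
  move=> x /andP[]; rewrite ge_max => /andP[xr _] xT.
  have := hr x => /(_ _ xT); rewrite sub0r normrN; apply.
  by rewrite /= gtr0_norm; lra.
have ab : a < b by lra.
have [delta d0 hd] := @segment_uniform_continuity f a b e e0
  (fun x h => cf x (ltac:(move: h; lra))).
pose n := (Num.truncn ((b - a) / delta)).+1.
have n0 : 0 < n%:R :> R by rewrite ltr0n.
pose h := (b - a) / n%:R.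
have h0 : 0 < h by rewrite divr_gt0 // subr_gt0.
have hdelta : h < delta.
  rewrite /h ltr_pdivrMr // mulrC -ltr_pdivrMr //.
  by rewrite truncnS_gt.
have nh : n%:R * h = b - a by rewrite mulrC mulfVK ?gt_eqF.
pose node (k : nat) := a + k%:R * h.
pose c (k : nat) := if (0 < k < n)%N then f (node k) else 0.
have c0 : c 0%N = 0 by [].
have cn : c n = 0 by rewrite /c ltnn andbF.
(* The affine argument maps the interval from [node k] to [node k.+1] onto [-1, 1]. *)
pose s (k : nat) x := step (2 / h * x + (- (2 / h) * node k - 1)).
have s1 k x : node k.+1 <= x -> s k x = 1.
  move=> kx; apply: step1.
  have -> : 2 / h * x + (- (2 / h) * node k - 1) = 2 * ((x - node k) / h) - 1 by field; rewrite gt_eqF.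
  have : 1 <= (x - node k) / h.
    by rewrite ler_pdivlMr // mul1r; move: kx; rewrite /node -natr1; lra.
  lra.
have s0 k x : x <= node k -> s k x = 0.
  move=> kx; apply: step0.
  have -> : 2 / h * x + (- (2 / h) * node k - 1) = 2 * ((x - node k) / h) - 1 by field; rewrite gt_eqF.
  have : (x - node k) / h <= 0 by rewrite ler_pdivrMr // mul0r subr_le0.
  lra.
have node_le k m : (k <= m)%N -> node k <= node m.
  by move=> km; rewrite /node lerD2l ler_pM2r // ler_nat.
have noden : node n = b by rewrite /node nh; lra.
have node0 : node 0%N = a by rewrite /node mul0r addr0.
pose phi x := \sum_(k < n) (c k.+1 - c k) * s k x.
have phi_a x : x <= a -> phi x = 0.
  move=> xa; rewrite /phi big1 // => k _; rewrite s0 ?mulr0 //.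
  by rewrite (le_trans xa) // -node0 node_le.
have phi_b x : b <= x -> phi x = 0.
  move=> bx; rewrite /phi (eq_bigr (fun k : 'I_n => c k.+1 - c k)) => [|k _].
    by rewrite -(big_mkord xpredT (fun k => c k.+1 - c k)) telescope_sumr // cn c0 subrr.
  by rewrite s1 ?mulr1 // (le_trans _ bx) // -noden node_le.
exists phi; split.
- split; last first.
    exists a, b; split => // x; rewrite in_itv /= negb_and -!ltNge.
    by case/orP => /ltW; [exact: phi_a|exact: phi_b].
  apply: Cn_smooth => m; apply: Cn_sum => k; apply: CnZ.
  exact: Cn_affine (Cn_step m).
- exists (\sum_(k < n) `|c k.+1 - c k|) => x.
  apply: le_trans (ler_norm_sum _ _ _) _; apply: ler_sum => k _.
  rewrite normrM ler_piMr // ger0_norm ?step_le1 //; exact: step_ge0.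
move=> x /andP[x0 xT].
have [xa|ax] := leP x a.
  by rewrite phi_a // subr0 (le_trans (ha x _)) ?x0 // /e; lra.
have [bx|xb] := leP b x.
  by rewrite phi_b // subr0 (le_trans (hb x _)) ?xT ?bx // /e; lra.
have xab : a <= x <= b by rewrite !ltW.
pose j := Num.truncn ((x - a) / h).
have /andP[j1 j2] : j%:R <= (x - a) / h < j.+1%:R.
  by apply: truncn_itv; rewrite divr_ge0 ?(ltW h0) // subr_ge0 ltW.
have {}j1 : node j <= x by move: j1; rewrite ler_pdivlMr // /node; lra.
have {}j2 : x <= node j.+1 by move: j2; rewrite ltr_pdivrMr // /node; lra.
have jn : (j < n)%N.
  by rewrite -(ltr_nat R) -(ltr_pM2r h0) nh; move: j1; rewrite /node; lra.
(* At an inner node [c m] is the value of f; at the two extreme nodes it is 0 while |f| <= e there,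
   so the two halves of eps are both spent. *)
have close m : (m <= n)%N -> `|x - node m| <= h -> `|f x - c m| <= eps.
  move=> mn xm; have h1 := hd x (node m) xab (le_lt_trans xm hdelta).
  rewrite /c; case: ifPn => [_|]; first by rewrite (le_trans (ltW h1)) // /e; lra.
  rewrite negb_and -!leqNgt leqn0 subr0 => hm.
  have h2 : `|f (node m)| <= e.
    case/orP: hm => [/eqP ->|nm].
      by rewrite node0; apply: ha; rewrite a0 lexx.
    have -> : m = n by apply/eqP; rewrite eqn_leq mn nm.
    by rewrite noden; apply: hb; rewrite lexx bT.
  rewrite -(subrK (f (node m)) (f x)) (le_trans (ler_normD _ _)) //.
  by rewrite [leRHS](_ : _ = e + e) ?lerD ?(ltW h1) // /e; field.
have e1 : `|f x - c j| <= eps.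
  apply: close; first exact: ltnW.
  by rewrite ger0_norm ?subr_ge0 //; move: j2; rewrite /node -natr1; lra.
have e2 : `|f x - c j.+1| <= eps.
  apply: close => //; rewrite distrC ger0_norm ?subr_ge0 //.
  by move: j1; rewrite /node -natr1; lra.
have -> : phi x = c j - c 0%N + (c j.+1 - c j) * s j x.
  apply: (@telescoping_step c (fun k => s k x)) => // k kj.
    by rewrite s1 // (le_trans _ j1) // node_le.
  by rewrite s0 // (le_trans j2) // node_le.
rewrite c0 subr0; set t := s j x.
have t0 : 0 <= t by exact: step_ge0.
have t1 : t <= 1 by exact: step_le1.
have t1' : 0 <= 1 - t by lra.
clearbody t.
have -> : f x - (c j + (c j.+1 - c j) * t) =
  (1 - t) * (f x - c j) + t * (f x - c j.+1) by ring.
rewrite (le_trans (ler_normD _ _)) // !normrM (ger0_norm t0) (ger0_norm t1').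
have := ler_wpM2l t0 e2; have := ler_wpM2l t1' e1; lra.
Qed.

End Density.

(** * Distributional derivatives of jump functions *)

Section ChargeIntegral.
Context {R : realType}.
Local Notation MR := (measurableTypeR R).
Implicit Types (m : {measure set MR -> \bar R}) (D : set MR) (f g : R -> R).

Definition bounded_on D f := exists M, forall x, D x -> `|f x| <= M.

Lemma bounded_integrable m D f : measurable D -> (m D < +oo)%E ->
  measurable_fun D f -> bounded_on D f -> m.-integrable D (EFin \o f).
Proof.
move=> mD D_fin mf [M hM]; apply: measurable_bounded_integrable => //.
exists M; split; first exact: num_real.
by move=> N MN x Dx; rewrite /= (le_trans (hM x Dx)) // ltW.
Qed.

Lemma Rintegral_measure_add m1 m2 D f : measurable D ->
  m1.-integrable D (EFin \o f) -> m2.-integrable D (EFin \o f) ->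
  \int[measure_add m1 m2]_(x in D) f x =
  \int[m1]_(x in D) f x + \int[m2]_(x in D) f x.
Proof.
move=> mD i1 i2; have mf := measurable_int m1 i1.
by rewrite /Rintegral integral_measure_add // fineD //; exact: integrable_fin_num.
Qed.

Lemma Rintegral_mscale (k : {nonneg R}) m D f : measurable D ->
  m.-integrable D (EFin \o f) ->
  \int[mscale k m]_(x in D) f x = k%:num * \int[m]_(x in D) f x.
Proof.
move=> mD intf; have mf := measurable_int m intf.
rewrite /Rintegral integralE [in RHS]integralE.
rewrite !ge0_integral_mscale //; [|exact: measurable_funeneg|exact: measurable_funepos].
have fp : (\int[m]_(x in D) (EFin \o f)^\+ x \is a fin_num)%E.
  exact: integrable_pos_fin_num.
have fn : (\int[m]_(x in D) (EFin \o f)^\- x \is a fin_num)%E.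
  exact: integrable_neg_fin_num.
move: fp fn => /fineK <- /fineK <-.
by rewrite -!EFinM -!EFinB /= mulrBr.
Qed.

Lemma Rintegral_dirac (a : R) D f : measurable D -> D a -> measurable_fun D f ->
  \int[\d_(a : MR)]_(x in D) f x = f a.
Proof.
move=> mD Da mf; rewrite /Rintegral integral_dirac //; last exact/measurable_EFinP.
by rewrite diracE mem_set // mul1e.
Qed.

Lemma cintegralE (nu : {charge set MR -> \bar R}) :
  exists p q : {finite_measure set MR -> \bar R},
    (forall B, measurable B -> nu B = p B - q B)%E /\
    forall D f, cintegral nu D f = \int[p]_(x in D) f x - \int[q]_(x in D) f x.
Proof.
rewrite /cintegral; set exP := cid _; set exN := cid _.
exists (jordan_pos (projT2 exN)), (jordan_neg (projT2 exN)); split => // B mB.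
by rewrite (jordan_decomp (projT2 exN) mB) /cadd /= cscaleN1.
Qed.

(** [cintegral] uses a chosen Hahn decomposition; any other splitting gives the same value, because
    p - q = m1 - m2 rearranges to the equality p + m2 = q + m1 of measures. *)
Lemma cintegral_difference (nu : {charge set MR -> \bar R}) m1 m2 D f :
  measurable D -> measurable_fun D f -> bounded_on D f ->
  (m1 setT < +oo)%E -> (m2 setT < +oo)%E ->
  (forall B, measurable B -> nu B = m1 B - m2 B)%E ->
  cintegral nu D f = \int[m1]_(x in D) f x - \int[m2]_(x in D) f x.
Proof.
move=> mD mf bf f1 f2 nuE; have [p [q [pqE ->]]] := cintegralE nu.
have fin m B : measurable B -> (m setT < +oo)%E -> (m B < +oo)%E.
  by move=> mB; apply: le_lt_trans; apply: le_measure; rewrite ?inE.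
have i1 : m1.-integrable D (EFin \o f) by apply: bounded_integrable => //; exact: fin.
have i2 : m2.-integrable D (EFin \o f) by apply: bounded_integrable => //; exact: fin.
have fp : (p setT < +oo)%E by rewrite ltey_eq fin_num_measure.
have fq : (q setT < +oo)%E by rewrite ltey_eq fin_num_measure.
have ip : p.-integrable D (EFin \o f) by apply: bounded_integrable => //; exact: fin.
have iq : q.-integrable D (EFin \o f) by apply: bounded_integrable => //; exact: fin.
suff : \int[p]_(x in D) f x + \int[m2]_(x in D) f x =
    \int[q]_(x in D) f x + \int[m1]_(x in D) f x by lra.
rewrite -!Rintegral_measure_add // /Rintegral; congr fine.
apply: eq_measure_integral => B mB _.
rewrite [LHS](_ : _ = p B + m2 B)%E; last exact: measure_addE.
rewrite [RHS](_ : _ = q B + m1 B)%E; last exact: measure_addE.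
have := nuE B mB; rewrite pqE //.
have Fm m : (m setT < +oo)%E -> (m B \is a fin_num)%E.
  by move=> h; rewrite ge0_fin_numE //; exact: fin.
have := Fm _ f1; have := Fm _ f2; have := Fm _ fp; have := Fm _ fq.
move=> /fineK <- /fineK <- /fineK <- /fineK <-.
by rewrite -!EFinB -!EFinD => -[h]; congr EFin; lra.
Qed.

Lemma cintegral_dist (nu : {charge set MR -> \bar R}) D : measurable D ->
  exists2 C, 0 <= C & forall f g eps, measurable_fun D f -> bounded_on D f ->
    measurable_fun D g -> bounded_on D g ->
    (forall x, D x -> `|f x - g x| <= eps) ->
    `|cintegral nu D f - cintegral nu D g| <= C * eps.
Proof.
move=> mD; have [p [q [_ cE]]] := cintegralE nu.
have fin (m : {finite_measure set MR -> \bar R}) : (m D < +oo)%E.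
  by rewrite ltey_eq fin_num_measure.
exists (fine (p D) + fine (q D)); first by rewrite addr_ge0 // fine_ge0.
move=> f g eps mf bf mg bg fg; rewrite !cE.
have key (m : {finite_measure set MR -> \bar R}) :
    `|\int[m]_(x in D) f x - \int[m]_(x in D) g x| <= fine (m D) * eps.
  have i1 : m.-integrable D (EFin \o f) by apply: bounded_integrable => //; exact: fin.
  have i2 : m.-integrable D (EFin \o g) by apply: bounded_integrable => //; exact: fin.
  rewrite -RintegralB //.
  have mfg : measurable_fun D (fun x => f x - g x) by exact: measurable_funB.
  have ifg : m.-integrable D (EFin \o (fun x => f x - g x)).
    by apply: bounded_integrable => //; [exact: fin|exists eps].
  apply: le_trans (le_normr_Rintegral mD ifg) _.
  rewrite mulrC -Rintegral_cst //; apply: le_Rintegral => //.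
    exact: (integrable_norm ifg).
  apply: bounded_integrable => //; first exact: fin.
  by exists `|eps|.
have := key p; have := key q; rewrite !ler_norml mulrDl => /andP[? ?] /andP[? ?].
by apply/andP; split; lra.
Qed.

End ChargeIntegral.

Section JumpSumIntegral.
Context {R : realType} {d : nat}.
Variable T : R.
Local Notation leb := (@lebesgue_measure R).
Local Notation I := (`]0, T[%classic : set (measurableTypeR R)).
Implicit Types (A : seq (R * jump R d)) (f phi : R -> R).

Lemma cintegral_jump_sum A i f : {in A, forall x, 0 < x.2.2 < T} ->
  measurable_fun I f -> bounded_on I f ->
  cintegral (jump_sum A i) I f = \sum_(x <- A) x.1 * x.2.1 0 i * f x.2.2.
Proof.
move=> AI mf bf.
(* Measures are scaled by nonnegative factors only, so each coefficient is split into its positive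
   and negative part, and the Dirac masses are collected in m1 and m2. *)
suff [m1 [m2 [f1 f2 mE ->]]] : exists m1 m2 : {measure set (measurableTypeR R) -> \bar R},
    [/\ (m1 setT < +oo)%E, (m2 setT < +oo)%E,
     forall B, measurable B -> (jump_sum A i B = m1 B - m2 B)%E &
     \sum_(x <- A) x.1 * x.2.1 0 i * f x.2.2 =
     \int[m1]_(x in I) f x - \int[m2]_(x in I) f x].
  exact: cintegral_difference.
have fin (m : {measure set (measurableTypeR R) -> \bar R}) : (m setT < +oo)%E -> (m I < +oo)%E.
  by apply: le_lt_trans; apply: le_measure; rewrite ?inE.
elim: A AI => [|x A ih] AI.
  exists mzero, mzero; split; [exact: ltry|exact: ltry| |].
    by move=> B _; rewrite /jump_sum /= /czero /= /mzero subee.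
  by rewrite big_nil subrr.
have xI : I x.2.2 by rewrite /= in_itv /=; apply: AI; rewrite mem_head.
have [m1 [m2 [f1 f2 mE sE]]] := ih (fun y (yA : y \in A) => AI y (@mem_behead _ (x :: A) y yA)).
set a := x.1 * x.2.1 0 i.
have ap0 : 0 <= Num.max a 0 by rewrite le_max lexx orbT.
have an0 : 0 <= Num.max (- a) 0 by rewrite le_max lexx orbT.
have aE : a = Num.max a 0 - Num.max (- a) 0.
  rewrite -{1}[a]opprK; case: (leP a 0) => h; case: (leP (- a) 0) => h'; lra.
pose dx : {measure set (measurableTypeR R) -> \bar R} := \d_(x.2.2 : measurableTypeR R).
have fd : (dx setT < +oo)%E by rewrite /dx /= diracT ltry.
have idx : dx.-integrable I (EFin \o f) by apply: bounded_integrable => //; exact: fin.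
have fs (k : {nonneg R}) : (mscale k dx setT < +oo)%E.
  by rewrite /mscale /= diracT mule1 ltry.
have is_ (k : {nonneg R}) : (mscale k dx).-integrable I (EFin \o f).
  by apply: bounded_integrable => //; exact: (fin _ (fs k)).
have i1 : m1.-integrable I (EFin \o f) by apply: bounded_integrable => //; exact: fin.
have i2 : m2.-integrable I (EFin \o f) by apply: bounded_integrable => //; exact: fin.
have addE (m m' : {measure set (measurableTypeR R) -> \bar R}) B :
  ((measure_add m m' : {measure set (measurableTypeR R) -> \bar R}) B = m B + m' B)%E.
  exact: measure_addE.
exists (measure_add (mscale (NngNum ap0) dx) m1).
exists (measure_add (mscale (NngNum an0) dx) m2); split.
- by rewrite addE; apply: lte_add_pinfty => //; exact: fs.
- by rewrite addE; apply: lte_add_pinfty => //; exact: fs.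
- move=> B mB; rewrite !addE.
  have -> : jump_sum (x :: A) i B = (a%:E * dx B + jump_sum A i B)%E by [].
  have Fm (m : {measure set (measurableTypeR R) -> \bar R}) :
      (m setT < +oo)%E -> (m B \is a fin_num)%E.
    move=> h; rewrite ge0_fin_numE //; apply: le_lt_trans h.
    by apply: le_measure; rewrite ?inE.
  rewrite mE // /mscale /=.
  have := Fm _ f1; have := Fm _ f2; have := Fm _ fd.
  move=> /fineK <- /fineK <- /fineK <-.
  rewrite -!EFinM -!EFinB -!EFinD; congr EFin; rewrite [X in X * _]aE /=; ring.
have sc (k : {nonneg R}) : \int[mscale k dx]_(t in I) f t = k%:num * f x.2.2.
  by rewrite (Rintegral_mscale k _ idx) // Rintegral_dirac.
have e k (m : {measure set (measurableTypeR R) -> \bar R}) : m.-integrable I (EFin \o f) ->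
    \int[measure_add (mscale k dx) m]_(t in I) f t =
    k%:num * f x.2.2 + \int[m]_(t in I) f t.
  move=> im; have h := Rintegral_measure_add (measurable_itv _) (is_ k) im.
  exact: (etrans h (congr1 (fun z => z + _) (sc k))).
rewrite big_cons sE (e (NngNum ap0) m1 i1) (e (NngNum an0) m2 i2) /=.
rewrite -/a [X in X * _ + _]aE; ring.
Qed.

End JumpSumIntegral.

Section TestFunctions.
Context {R : realType}.
Variable T : R.
Hypothesis T0 : 0 < T.
Local Notation leb := (@lebesgue_measure R).
Local Notation I := (`]0, T[%classic : set (measurableTypeR R)).
Implicit Types (f phi : R -> R).

Lemma continuous_bounded_on f : continuous f -> bounded_on I f.
Proof.
move=> cf; have cn : {within `[0, T], continuous (fun x => `|f x|)}.
  apply: continuous_subspaceT => x.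
  exact: (continuous_comp (@cf x) (@norm_continuous _ _ _)).
have [c _ hc] := EVT_max (ltW T0) cn.
exists `|f c| => x; rewrite /= in_itv /= => /andP[x0 xT].
by apply: hc; rewrite in_itv /= !ltW.
Qed.

Lemma continuous_measurable_on (D : set (measurableTypeR R)) f :
  continuous f -> measurable_fun D f.
Proof. by move=> cf; apply: measurable_funTS; exact: continuous_measurable_fun. Qed.

Lemma bounded_leb_integrable f : measurable_fun I f -> bounded_on I f ->
  leb.-integrable I (EFin \o f).
Proof.
by move=> mf bf; apply: bounded_integrable => //; exact: leb_itv_fin.
Qed.

Lemma integrable_mul_bounded f g : leb.-integrable I (EFin \o f) ->
  measurable_fun I g -> bounded_on I g ->
  leb.-integrable I (EFin \o (fun x => f x * g x)).
Proof.
move=> iF mg [M hM]; have mI : measurable I by [].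
have iz := integrableZl mI M (integrable_norm iF).
apply: le_integrable iz => //.
  apply/measurable_EFinP; apply: measurable_funM => //.
  by apply/measurable_EFinP; exact: (measurable_int leb iF).
move=> x Ix; rewrite /= lee_fin normrM mulrC [leRHS]ger0_norm; last first.
  by rewrite mulr_ge0 //; exact: le_trans (normr_ge0 _) (hM x Ix).
by rewrite ler_wpM2r // hM.
Qed.

Section Facts.
Variable phi : R -> R.
Hypothesis test_phi : test_function T phi.

Lemma test_is_derive x : is_derive x (1 : R) phi (derive1 phi x).
Proof. by rewrite derive1E; apply: derivableP; exact: (test_phi.1 0%N x). Qed.

Lemma test_derive_continuous : continuous (derive1 phi).
Proof.
move=> x; apply/differentiable_continuous/derivable1_diffP.
exact: (test_phi.1 1%N x).
Qed.

Lemma test_continuous : continuous phi.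
Proof. exact: is_derive_continuous test_is_derive. Qed.

Lemma test_at_T : phi T = 0.
Proof.
have [_ [a [b [a0 bT]]]] := test_phi; apply.
by rewrite in_itv /= [T <= b]leNgt bT andbF.
Qed.

Lemma test_at_0 : phi 0 = 0.
Proof.
have [_ [a [b [a0 bT]]]] := test_phi; apply.
by rewrite in_itv /= leNgt a0.
Qed.

Lemma test_integral s : s <= T ->
  \int[leb]_(x in `]s, T[) derive1 phi x = - phi s.
Proof.
move=> sT.
by rewrite (C1_integral sT test_is_derive test_derive_continuous).2 test_at_T sub0r.
Qed.

End Facts.

Lemma Rintegral_comb (J : Type) (r : seq J) (a : J -> R) (w : J -> R -> R) f :
  (forall j, leb.-integrable I (EFin \o w j)) -> leb.-integrable I (EFin \o f) ->
  leb.-integrable I (EFin \o (fun t => \sum_(j <- r) a j * w j t + f t)) /\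
  \int[leb]_(t in I) (\sum_(j <- r) a j * w j t + f t) =
  \sum_(j <- r) a j * (\int[leb]_(t in I) w j t) + \int[leb]_(t in I) f t.
Proof.
move=> iw i_f; elim: r => [|j r [ih1 ih2]].
  rewrite big_nil add0r; split.
    by apply: eq_integrable i_f => // t _; rewrite /= big_nil add0r.
  by apply: eq_Rintegral => t _; rewrite big_nil add0r.
have mI : measurable I by [].
have iz : leb.-integrable I (EFin \o (fun t => a j * w j t)).
  have := integrableZl mI (a j) (iw j).
  by apply: eq_integrable.
split.
  have := integrableD _ iz ih1 => /(_ (measurable_itv _)).
  by apply: eq_integrable => // t _; rewrite /= big_cons -addrA EFinD.
rewrite big_cons -addrA -ih2 -(RintegralZl (a j) mI (iw j)) -RintegralD //.
by apply: eq_Rintegral => t _; rewrite big_cons -addrA.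
Qed.

End TestFunctions.

Section DistributionalDerivative.
Context {R : realType} {d : nat}.
Variable T : R.
Hypothesis T0 : 0 < T.
Local Notation leb := (@lebesgue_measure R).
Local Notation I := (`]0, T[%classic : set (measurableTypeR R)).
Implicit Types (A : seq (R * jump R d)) (u phi : R -> 'rV[R]_d) (q : vmeasure R d).

Lemma distr_derivative_B_op A c : {in A, forall x, 0 < x.2.2 < T} ->
  is_distr_derivative T (B_op T (jump_sum A) c) (jump_sum A).
Proof.
move=> AI phi tphi i.
have cphi := test_continuous tphi.
rewrite cintegral_jump_sum //; last first.
- exact: continuous_bounded_on.
- exact: continuous_measurable_on.
have cphi' := test_derive_continuous tphi.
have mphi' : measurable_fun I (derive1 phi) by exact: continuous_measurable_on.
have [M hM] := continuous_bounded_on T0 cphi'.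
pose w (x : R * jump R d) t := \1_(`]x.2.2, T[) t * derive1 phi t.
have iw x : leb.-integrable I (EFin \o w x).
  apply: bounded_leb_integrable.
    by apply: measurable_funM => //; exact: measurable_indic.
  exists M => t It; rewrite /w normrM; apply: le_trans (hM t It).
  by rewrite ler_piMl // indicE; case: (_ \in _); rewrite /= ?normr1 ?normr0.
have i_f : leb.-integrable I (EFin \o (fun t => (c - mean_shift T A) 0 i * derive1 phi t)).
  apply: bounded_leb_integrable; first by apply: measurable_funM.
  exists (`|(c - mean_shift T A) 0 i| * M) => t It.
  by rewrite normrM ler_wpM2l ?hM.
have -> : \int[leb]_(t in I) (B_op T (jump_sum A) c t 0 i * derive1 phi t) =
    \int[leb]_(t in I) (\sum_(x <- A) (x.1 * x.2.1 0 i) * w x t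
      + (c - mean_shift T A) 0 i * derive1 phi t).
  apply: eq_Rintegral => t /set_mem It; rewrite B_op_jump_sum // mxE mulrDl.
  congr (_ + _); rewrite summxE mulr_suml; apply: eq_bigr => x _.
  by rewrite !mxE /w; ring.
rewrite (Rintegral_comb _ _ iw i_f).2 RintegralZl //; last first.
  by apply: bounded_leb_integrable => //; exists M.
rewrite (test_integral tphi (ltW T0)) (test_at_0 tphi) oppr0 mulr0 addr0 -sumrN.
rewrite big_seq [RHS]big_seq; apply: eq_bigr => x xA.
have /andP[x0 xT] := AI _ xA.
rewrite -mulrN; congr (_ * _).
rewrite -[LHS]opprK -(test_integral tphi (ltW xT)); congr (- _).
have e : `]x.2.2, T[%classic = I `&` `]x.2.2, T[.
  by rewrite setIidr //; exact: itv_sub_I (ltW x0) _.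
rewrite [in LHS]e Rintegral_mkcondr; apply: eq_Rintegral => t _.
rewrite /w /patch indicE.
by case: ifP => _; rewrite ?mul1r ?mul0r.
Qed.

Lemma inC0_density phi i eps : inC0 T phi -> 0 < eps ->
  exists f, [/\ test_function T f, exists B, forall x, `|f x| <= B &
    forall x, I x -> `|phi x 0 i - f x| <= eps].
Proof.
move=> /(_ i)[cphi p0 pT] eps0.
have cf x : 0 < x < T -> {for x, continuous (fun t => phi t 0 i)}.
  by move=> xT; apply: cphi; rewrite inE /= in_itv.
have [f [tf bf hf]] := test_function_density T0 eps0 cf p0 pT.
by exists f; split => // x; rewrite /= in_itv /=; exact: hf.
Qed.

Lemma inC0_bounded phi i : inC0 T phi -> bounded_on I (fun t => phi t 0 i).
Proof.
move=> hphi; have [f [_ [B hB] hf]] := inC0_density i hphi ltr01.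
exists (1 + B) => x Ix; rewrite -(subrK (f x) (phi x 0 i)).
by rewrite (le_trans (ler_normD _ _)) // lerD ?hf.
Qed.

Lemma inC0_measurable phi i : inC0 T phi -> measurable_fun I (fun t => phi t 0 i).
Proof.
move=> /(_ i)[cphi _ _]; apply: open_continuous_measurable_fun => //.
Qed.

Lemma pairing_jump_sum A phi : {in A, forall x, 0 < x.2.2 < T} -> inC0 T phi ->
  pairing T phi (jump_sum A) = \sum_(x <- A) x.1 * edot (phi x.2.2) x.2.1.
Proof.
move=> AI hphi; rewrite /pairing.
rewrite (eq_bigr (fun i => \sum_(x <- A) x.1 * x.2.1 0 i * phi x.2.2 0 i)) => [|i _].
  rewrite exchange_big /=; apply: eq_bigr => x _; rewrite mulr_sumr.
  by apply: eq_bigr => i _; ring.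
apply: cintegral_jump_sum => //; first exact: inC0_measurable.
exact: inC0_bounded.
Qed.

(** Two representatives of u' agree on test functions, and [cintegral_dist] carries the equality to
    the uniform closure. Hence the representative that [TV] happens to pick can be replaced by the
    jump sum. *)
Lemma pairing_unique u q q' phi : is_distr_derivative T u q ->
  is_distr_derivative T u q' -> inC0 T phi -> pairing T phi q = pairing T phi q'.
Proof.
move=> uq uq' hphi; apply: eq_bigr => i _.
have [C C0 hC] := @cintegral_dist _ (q i) I (measurable_itv _).
have [C' C0' hC'] := @cintegral_dist _ (q' i) I (measurable_itv _).
have D0 : 0 < C + C' + 1 by rewrite ltr_wpDl // addr_ge0.
apply/eqP; rewrite -subr_eq0 -normr_le0; apply/ler_addgt0Pr => e e0; rewrite add0r.
have eps0 : 0 < e / (C + C' + 1) by rewrite divr_gt0.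
have [f [tf [B hB] hf]] := inC0_density i hphi eps0.
have mf : measurable_fun I f by apply: continuous_measurable_on; exact: test_continuous tf.
have bf : bounded_on I f by exists B => x _.
have mp := inC0_measurable i hphi; have bp := inC0_bounded i hphi.
have h1 := hC _ _ _ mp bp mf bf hf; have h2 := hC' _ _ _ mp bp mf bf hf.
rewrite (uq f tf i) in h1; rewrite (uq' f tf i) distrC in h2.
apply: le_trans (ler_distD _ _ _) (le_trans (lerD h1 h2) _).
by rewrite -mulrDl mulrA ler_pdivrMr // mulrC ler_pM2l // lerDl.
Qed.

Lemma Cnorm_bound phi : inC0 T phi -> Cnorm T phi <= 1 ->
  forall t, I t -> enorm (phi t) <= 1.
Proof.
move=> hphi p1 t It; apply: le_trans p1; apply: ub_le_sup; last by exists t.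
have : forall i, exists M, forall x, I x -> `|phi x 0 i| <= M.
  by move=> i; exact: inC0_bounded.
move=> /choice[M hM]; exists (\sum_i M i) => _ /= [x Ix <-].
by apply: le_trans (enorm_le_sum _) _; apply: ler_sum => i _; exact: hM.
Qed.

Section TotalVariation.
Variables (u : R -> 'rV[R]_d) (A : seq (R * jump R d)).
Hypothesis AJ : {in A, forall x, 0 <= x.1 /\ is_jump T x.2}.
Hypothesis uA : is_distr_derivative T u (jump_sum A).

Lemma pairing_le q phi : is_distr_derivative T u q -> inC0 T phi ->
  Cnorm T phi <= 1 -> pairing T phi q <= \sum_(x <- A) x.1.
Proof.
move=> uq hphi p1; rewrite (pairing_unique uq uA hphi) pairing_jump_sum //; last first.
  by move=> x /AJ[_ []]; rewrite /= in_itv.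
rewrite big_seq [leRHS]big_seq; apply: ler_sum => x /AJ[x0 [xI x1]].
rewrite ler_piMr // (le_trans (edot_le _ _)) // x1 mulr1.
exact: Cnorm_bound.
Qed.

Lemma inC0_0 : inC0 T (fun=> 0 : 'rV[R]_d).
Proof.
move=> i; rewrite (_ : (fun _ => _) = cst 0); last by apply/funext => t; rewrite mxE.
by split; [move=> x _; exact: cst_continuous|exact: cvg_cst|exact: cvg_cst].
Qed.

Lemma Cnorm_0 : Cnorm T (fun=> 0 : 'rV[R]_d) <= 1.
Proof.
apply: ge_sup; last by move=> _ [t _ <-]; rewrite enorm0.
by exists 0, (T / 2) => /=; rewrite ?enorm0 // in_itv /= divr_gt0 //= ltr_pdivrMr // ltr_pMr // ltr1n.
Qed.

(** The jump sum is a representative, so [xget] does not fall back on its default 0. *)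
Lemma TV_rep : exists2 q, is_distr_derivative T u q & TV T u = Mnorm T q.
Proof.
rewrite /TV; case: xgetP => [m -> [q uq <-]|/(_ (Mnorm T (jump_sum A)))]; first by exists q.
by case; exists (jump_sum A).
Qed.

Lemma TV_le : TV T u <= \sum_(x <- A) x.1.
Proof.
have [q uq ->] := TV_rep; apply: ge_sup.
  by exists (pairing T (fun=> 0) q), (fun=> 0) => //; split; [exact: inC0_0|exact: Cnorm_0].
by move=> _ [phi [hphi p1] <-]; exact: pairing_le.
Qed.

Lemma TV_ge phi : inC0 T phi -> Cnorm T phi <= 1 ->
  pairing T phi (jump_sum A) <= TV T u.
Proof.
move=> hphi p1; have [q uq ->] := TV_rep.
rewrite (pairing_unique uA uq hphi); apply: ub_le_sup; last by exists phi.
by exists (\sum_(x <- A) x.1) => _ [psi [hpsi q1] <-]; exact: pairing_le.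
Qed.

End TotalVariation.

Lemma TV_eq u u' q : is_distr_derivative T u q -> is_distr_derivative T u' q ->
  TV T u = TV T u'.
Proof.
move=> uq u'q; rewrite /TV; congr (xget 0 _).
apply/seteqP; split => _ [q' h <-]; exists q' => // phi tphi i.
  by rewrite (h phi tphi i) -(uq phi tphi i) (u'q phi tphi i).
by rewrite (h phi tphi i) -(u'q phi tphi i) (uq phi tphi i).
Qed.

End DistributionalDerivative.

(** * The du Bois-Reymond lemma *)

Section DuBoisReymond.
Context {R : realType}.
Variable T : R.
Hypothesis T0 : 0 < T.
Local Notation leb := (@lebesgue_measure R).
Local Notation I := (`]0, T[%classic : set (measurableTypeR R)).
Variable w : R -> R.
Hypothesis iw : leb.-integrable I (EFin \o w).

Variables (bump : R -> R) (M : R).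
Hypothesis bump_derive : forall x, is_derive x (1 : R) step (bump x).
Hypothesis bump_cont : continuous bump.
Hypothesis bump_supp : forall x, 1 < `|x| -> bump x = 0.
Hypothesis bump_le : forall x, `|bump x| <= M.

(** A mollifier at a: the derivative of a smooth step that rises within distance h / 2 of a. The
    lemmas use the cruder radius h. *)
Let moll (a h : R) (x : R) : R := 2 / h * bump (2 / h * x + (- (2 / h) * a)).
Let smooth_step (a h : R) (x : R) : R := step (2 / h * x + (- (2 / h) * a)).

Lemma smooth_step_derive a h x : is_derive x (1 : R) (smooth_step a h) (moll a h x).
Proof.
have h2 := is_derive_affine (2 / h) (- (2 / h) * a) x.
have := @is_derive1_comp _ step (fun y => 2 / h * y + (- (2 / h) * a)) x _ _
  (bump_derive _) h2.
by rewrite [bump _ * _]mulrC.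
Qed.

Lemma moll_cont a h : continuous (moll a h).
Proof.
move=> x; apply: cvgM; first exact: cvg_cst.
apply: (continuous_comp (f := fun y => 2 / h * y + (- (2 / h) * a)) (g := bump)).
  exact: (is_derive_continuous (is_derive_affine _ _)).
exact: bump_cont.
Qed.

Lemma moll_arg (a h x : R) : 0 < h -> 2 / h * x + (- (2 / h) * a) = 2 * ((x - a) / h).
Proof. by move=> h0; field; rewrite gt_eqF. Qed.

Lemma moll_supp a h x : 0 < h -> h <= `|x - a| -> moll a h x = 0.
Proof.
move=> h0 hx; rewrite /moll moll_arg // bump_supp ?mulr0 //.
rewrite !normrM normfV (gtr0_norm h0) gtr0_norm //.
have : 1 <= `|x - a| / h by rewrite ler_pdivlMr // mul1r.
lra.
Qed.

Lemma moll_le a h x : 0 < h -> `|moll a h x| <= 2 / h * M.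
Proof.
by move=> h0; rewrite normrM ger0_norm ?divr_ge0 ?(ltW h0) // ler_wpM2l // divr_ge0 // ltW.
Qed.

Lemma smooth_step_left a h x : 0 < h -> x <= a - h -> smooth_step a h x = 0.
Proof.
move=> h0 hx; rewrite /smooth_step moll_arg // step0 //.
have : (x - a) / h <= -1 by rewrite ler_pdivrMr //; lra.
lra.
Qed.

Lemma smooth_step_right a h x : 0 < h -> a + h <= x -> smooth_step a h x = 1.
Proof.
move=> h0 hx; rewrite /smooth_step moll_arg // step1 //.
have : 1 <= (x - a) / h by rewrite ler_pdivlMr //; lra.
lra.
Qed.

Lemma moll_integral a h : 0 < h -> h <= a -> a <= T - h ->
  \int[leb]_(x in I) moll a h x = 1.
Proof.
move=> h0 ha aT.
rewrite (C1_integral (ltW T0) (smooth_step_derive a h) (@moll_cont a h)).2.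
by rewrite smooth_step_right ?smooth_step_left ?subr0 //; lra.
Qed.

Lemma smooth_step_test a b h : 0 < h -> h < a -> a < T - h -> h < b -> b < T - h ->
  test_function T (fun x => smooth_step a h x + -1 * smooth_step b h x).
Proof.
move=> h0 ha aT hb bT; split.
  by apply: Cn_smooth => n; apply: CnD; [|apply: CnZ]; exact: Cn_affine (Cn_step n).
exists (Num.min a b - h), (Num.max a b + h); split.
- by rewrite subr_gt0 lt_min ha.
- by rewrite -ltrBrDr gt_max aT.
move=> x; rewrite in_itv /= negb_and -!ltNge => /orP[xl|xr].
  rewrite !smooth_step_left ?mulr0 ?addr0 // (le_trans (ltW xl)) // lerD2r.
    by rewrite ge_min lexx orbT.
  by rewrite ge_min lexx.
rewrite !smooth_step_right //; first lra.
  by rewrite (le_trans _ (ltW xr)) // lerD2r le_max lexx orbT.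
by rewrite (le_trans _ (ltW xr)) // lerD2r le_max lexx.
Qed.

Let mI : measurable I. Proof. by []. Qed.

Lemma moll_bounded a h : 0 < h -> bounded_on I (moll a h).
Proof. by move=> h0; exists (2 / h * M) => x _; exact: moll_le. Qed.

Lemma moll_measurable a h D : measurable_fun (D : set (measurableTypeR R)) (moll a h).
Proof. by apply: continuous_measurable_on; exact: moll_cont. Qed.

Lemma mul_moll_integrable a h f : 0 < h -> leb.-integrable I (EFin \o f) ->
  leb.-integrable I (EFin \o (fun x => f x * moll a h x)).
Proof.
move=> h0 iF; apply: integrable_mul_bounded => //; first exact: moll_measurable.
exact: moll_bounded.
Qed.

(** The mollifier has integral 1, vanishes off the ball of radius h and is at most 2 M / h. The
    error is thus at most 2 M / h times the integral of |w - w a| over the ball, which has length 2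
    h and mean deviation at most eps; this gives 4 M eps. *)
Lemma mollify_lebesgue_pt a eps : 0 < a < T -> lebesgue_pt (w \_ I) a -> 0 < eps ->
  \forall h \near (0 : R)^'+,
    `|\int[leb]_(x in I) (w x * moll a h x) - w a| <= 4 * M * eps.
Proof.
move=> /andP[a0 aT] /fine_cvgP[_ cv] eps0.
have M0 : 0 <= M by exact: le_trans (normr_ge0 _) (bump_le 0).
have small : \forall h \near (0 : R)^'+, [/\ 0 < h, h < a & h < T - a].
  by near=> h; split => //; near: h; apply: nbhs_right_lt; rewrite subr_gt0.
move/cvgrPdist_le: cv => /(_ _ eps0); move: small; apply: filterS2.
move=> h [h0 ha hT]; rewrite sub0r normrN => hd.
have wa : (w \_ I) a = w a by rewrite patchE mem_set //= in_itv /= a0.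
have Bsub : ball a h `<=` I.
  move=> x; rewrite /ball /= in_itv /= ltr_distlC => /andP[? ?].
  by apply/andP; split; lra.
have mB : measurable (ball a h : set (measurableTypeR R)) by exact: measurable_ball.
have iwB : leb.-integrable (ball a h) (EFin \o w) by exact: integrableS iw.
have icB : leb.-integrable (ball a h) (EFin \o cst (w a)).
  have fB : (leb (ball a h) < +oo)%E by rewrite lebesgue_measure_ball ?ltry // ltW.
  by apply: bounded_integrable => //; exists `|w a|.
have idB : leb.-integrable (ball a h) (EFin \o (fun x => `|w x - w a|)).
  apply: integrable_norm.
  by have := integrableB mB iwB icB; apply: eq_integrable.
have hB : \int[leb]_(x in ball a h) `|w x - w a| <= eps * (h + h).
  move: hd; rewrite /davg /iavg /= wa.
  have -> : (\int[leb]_(y in ball a h) `|(center (w a) ((w \_ I) y))%:E| =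
      \int[leb]_(y in ball a h) `|w y - w a|%:E)%E.
    apply: eq_integral => x /set_mem /Bsub xI.
    by rewrite patchE mem_set.
  rewrite lebesgue_measure_ball ?(ltW h0) // inver mulrn_eq0 /= gt_eqF //.
  rewrite fineM //; last exact: integrable_fin_num.
  rewrite /= mulr2n => hd.
  have hh0 : 0 < h + h by rewrite addr_gt0.
  have := le_trans (ler_norm _) hd.
  by rewrite mulrC ler_pdivrMr.
have iwa : leb.-integrable I (EFin \o (fun=> w a)).
  by apply: bounded_leb_integrable; [exact: measurable_cst|exists `|w a|].
have im : leb.-integrable I (EFin \o moll a h).
  apply: bounded_leb_integrable; first exact: moll_measurable.
  exact: moll_bounded.
have e1 : \int[leb]_(x in I) (w x * moll a h x) - w a =
    \int[leb]_(x in I) ((w x - w a) * moll a h x).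
  rewrite -[X in _ - X]mulr1 -(@moll_integral a h) //; [|lra..].
  rewrite -RintegralZl // -RintegralB //.
  - by apply: eq_Rintegral => x _; rewrite mulrBl.
  - exact: mul_moll_integrable.
  - exact: mul_moll_integrable iwa.
have iwd : leb.-integrable I (EFin \o (fun x => w x - w a)).
  by have := integrableB mI iw iwa; apply: eq_integrable.
have ig := mul_moll_integrable a h0 iwd.
rewrite e1; apply: le_trans (le_normr_Rintegral mI ig) _.
have BE : ball a h = I `&` ball a h by rewrite setIidr.
apply: (@le_trans _ _ (2 / h * M * \int[leb]_(x in ball a h) `|w x - w a|)).
  rewrite -(RintegralZl _ mB idB) BE Rintegral_mkcondr.
  apply: le_Rintegral => //.
  - exact: (integrable_norm ig).
  - rewrite -restrict_EFin; apply/integrable_restrict => //; rewrite setIidr //.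
    by have := integrableZl mB (2 / h * M) idB; apply: eq_integrable.
  move=> x Ix; rewrite patchE; case: ifPn => [_|xB].
    by rewrite normrM mulrC ler_wpM2r // moll_le.
  rewrite moll_supp ?mulr0 ?normr0 // leNgt; apply/negP => xa.
  by move/negP: xB; apply; rewrite inE /ball /= distrC.
apply: le_trans (ler_wpM2l _ hB) _.
  by rewrite mulr_ge0 // divr_ge0 // ltW.
by rewrite le_eqVlt; apply/orP; left; apply/eqP; field; rewrite gt_eqF.
Unshelve. all: by end_near. Qed.

Hypothesis w_orth : forall phi, test_function T phi ->
  \int[leb]_(x in I) (w x * derive1 phi x) = 0.

(** The difference of the steps at a and b vanishes on both sides of the two points, so it is a test
    function, and its derivative is the difference of the two mollifiers. *)
Lemma lebesgue_pts_eq a b : 0 < a < T -> 0 < b < T ->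
  lebesgue_pt (w \_ I) a -> lebesgue_pt (w \_ I) b -> w a = w b.
Proof.
move=> aI bI la lb; apply/eqP; rewrite -subr_eq0 -normr_le0.
apply/ler_addgt0Pr => e e0; rewrite add0r.
have M0 : 0 <= M by exact: le_trans (normr_ge0 _) (bump_le 0).
have D0 : 0 < 8 * M + 1 by rewrite ltr_wpDl // mulr_ge0.
have eps0 : 0 < e / (8 * M + 1) by rewrite divr_gt0.
have na := mollify_lebesgue_pt aI la eps0; have nb := mollify_lebesgue_pt bI lb eps0.
have small : \forall h \near (0 : R)^'+,
    [/\ 0 < h, h < a, h < T - a, h < b & h < T - b].
  have /andP[a0 aT] := aI; have /andP[b0 bT] := bI.
  by near=> h; split => //; near: h; apply: nbhs_right_lt; rewrite subr_gt0.
near (0 : R)^'+ => h.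
have ha : `|\int[leb]_(x in I) (w x * moll a h x) - w a| <= 4 * M * (e / (8 * M + 1)).
  by near: h.
have hb : `|\int[leb]_(x in I) (w x * moll b h x) - w b| <= 4 * M * (e / (8 * M + 1)).
  by near: h.
have [h0 h1 h2 h3 h4] : [/\ 0 < h, h < a, h < T - a, h < b & h < T - b].
  by near: h.
have tphi : test_function T (fun x => smooth_step a h x + -1 * smooth_step b h x).
  by apply: smooth_step_test => //; lra.
have dphi : derive1 (fun x => smooth_step a h x + -1 * smooth_step b h x) =
    fun x => moll a h x - moll b h x.
  apply: is_derive1_funE => x.
  have d1 := smooth_step_derive a h x; have d2 := smooth_step_derive b h x.
  have -> : (fun x => smooth_step a h x + -1 * smooth_step b h x) =
      (smooth_step a h - smooth_step b h).
    by apply/funext => z; rewrite mulN1r.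
  exact: is_deriveB.
have : \int[leb]_(x in I) (w x * moll a h x) = \int[leb]_(x in I) (w x * moll b h x).
  apply/eqP; rewrite -subr_eq0 -RintegralB //; try exact: mul_moll_integrable.
  rewrite -[X in _ == X](w_orth tphi) dphi; apply/eqP; apply: eq_Rintegral => x _.
  by rewrite mulrBr.
move=> E; rewrite E in ha; rewrite distrC in ha.
apply: le_trans (ler_distD _ _ _) (le_trans (lerD ha hb) _).
have : e / (8 * M + 1) * (8 * M + 1) = e by rewrite mulfVK ?gt_eqF.
have := ltW eps0; lra.
Unshelve. all: by end_near. Qed.

End DuBoisReymond.

Lemma du_bois_reymond (R : realType) (T : R) (w : R -> R) : 0 < T ->
  (@lebesgue_measure R).-integrable `]0, T[ (EFin \o w) ->
  (forall phi, test_function T phi ->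
    \int[@lebesgue_measure R]_(x in `]0, T[) (w x * derive1 phi x) = 0) ->
  exists k, {ae (@lebesgue_measure R),
    forall t, (`]0, T[%classic : set (measurableTypeR R)) t -> w t = k}.
Proof.
move=> T0 iw orth; have [b [db cb b0 [M bM]]] := @step_bump R.
have key := lebesgue_pts_eq T0 iw db cb b0 bM orth.
have mI : measurable (`]0, T[%classic : set (measurableTypeR R)) by [].
have [Z [mZ Z0 sub]] := lebesgue_differentiation (integrable_locally mI iw).
have [[a [aI la]]|none] := pselect (exists a, 0 < a < T /\ lebesgue_pt (w \_ `]0, T[) a).
  exists (w a), Z; split => // t /= nt; apply: sub => /= lt; apply: nt => It.
  by apply: key => //; rewrite in_itv /= in It.
(* Without a Lebesgue point in I, the exceptional null set contains I and any constant will do. *)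
exists 0, Z; split => // t /= nt; apply: sub => /= lt; apply: nt => It.
by exfalso; apply: none; exists t; rewrite in_itv /= in It.
Qed.

(** * Runs of the algorithm *)

Section DualVariable.
Context {R : realType} {d : nat} {Y : completeNormedModType R}.
Variable T : R.
Hypothesis T0 : 0 < T.
Variable ip : {dot Y for idfun}.
Hypothesis hip : forall y, ip y y = `|y| ^+ 2.
Variables (K : (R -> 'rV[R]_d) -> Y) (Kstar : Y -> R -> 'rV[R]_d).
Hypotheses (hK : lin_cont_L2 T K) (hKstar : is_adjoint T ip K Kstar).
Hypothesis hKinf : cont_to_Linfty T Kstar.
Local Notation kv := (kvec T K).

Lemma dual_var_le_Cnorm w t : 0 < t < T ->
  enorm (primitive (Kstar w) t) <= Cnorm T (primitive (Kstar w)).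
Proof.
move=> tI; apply: ub_le_sup; last by exists t => //=; rewrite in_itv.
have [C C0 hC] := kvec_lip hip hKstar hKinf.
exists (d%:R * C * `|w| * T) => _ /= [s sI <-].
have sT : 0 <= s <= T by move: sI; rewrite in_itv /= => /andP[? ?]; rewrite !ltW.
by rewrite (primitive_pvar hKstar) // (pvar_le hip T0 C0 hC).
Qed.

Lemma kvec_T i : kv i T = 0.
Proof.
rewrite /kvec -(K_zero hK); apply: (K_eq hK); first exact: bounded_meas_indic.
move=> t; rewrite /= in_itv /= => /andP[_ tT].
rewrite /indic_after indicE memNset ?scale0r //= in_itv /= => /andP[h1 h2].
by have := lt_trans h1 h2; rewrite ltxx.
Qed.

(** Continuity and the value at 0 come from the Lipschitz bound. The value at T vanishes because
    chi_T = 0 on I leaves only the pairing of g with the constants, which [orth_const] makes 0. *)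
Lemma pvar_inC0 g a : orth_const ip kv g -> inC0 T (fun t => a *: pvar ip kv g t).
Proof.
move=> g0 i; have [C C0 hC] := kvec_lip hip hKstar hKinf.
pose f t := a * ip (kv i 0 - kv i t) g.
have fE : (fun t => (a *: pvar ip kv g t) 0 i) = f by apply/funext => t; rewrite !mxE.
have lip s t : 0 <= s <= T -> 0 <= t <= T ->
    `|f s - f t| <= (`|a| * (C * `|g|) + 1) * `|s - t|.
  move=> sT tT; rewrite /f -mulrBr -linearBl /= normrM.
  rewrite opprB addrC addrA subrK mulrDl mul1r.
  apply: (@le_trans _ _ (`|a| * (C * `|g|) * `|s - t|)); last by rewrite lerDl.
  rewrite -mulrA ler_wpM2l // (le_trans (ler_ip hip _ _)) //.
  by rewrite mulrAC ler_wpM2r // distrC hC.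
set D := _ + 1 in lip.
have D0 : 0 < D by rewrite ltr_wpDl // !mulr_ge0.
have f0 : f 0 = 0 by rewrite /f subrr linear0l mulr0.
have fT : f T = 0.
  by rewrite /f kvec_T subr0 (ipC ip) g0 mulr0.
have close s t e : 0 <= s <= T -> 0 <= t <= T -> `|s - t| < e / D ->
    `|f s - f t| <= e.
  move=> sT tT; rewrite ltr_pdivlMr // mulrC => /ltW.
  exact: le_trans (lip _ _ sT tT).
have tT0 : 0 <= (0 : R) <= T by apply/andP; split => //; exact: ltW.
have tTT : 0 <= T <= T by apply/andP; split => //; exact: ltW.
rewrite fE; split.
- move=> t /set_mem; rewrite /= in_itv /= => /andP[t0 tT].
  apply/cvgrPdist_le => e e0; near=> s.
  apply: close; first by apply/andP; split; exact: ltW.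
    have s0 : 0 < s by near: s; exact: lt_nbhsr.
    have sT : s < T by near: s; exact: lt_nbhsl.
    by apply/andP; split; exact: ltW.
  near: s; apply: (@cvgr_dist_lt _ _ _ _ _ id) => //; exact: divr_gt0.
- apply/cvgrPdist_le => e e0; near=> s; rewrite -f0.
  have s0 : 0 < s by [].
  have sT : s < T by near: s; exact: nbhs_right_lt.
  apply: close => //; first by apply/andP; split; exact: ltW.
  rewrite sub0r normrN gtr0_norm //; near: s; apply: nbhs_right_lt; exact: divr_gt0.
- apply/cvgrPdist_le => e e0; near=> s; rewrite -fT.
  have s0 : 0 < s by near: s; exact: nbhs_left_gt.
  have sT : s < T by [].
  apply: close => //; first by apply/andP; split; exact: ltW.
  rewrite gtr0_norm ?subr_gt0 // ltrBlDr -ltrBlDl; near: s; apply: nbhs_left_gt.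
  by rewrite ltrBlDr ltrDl divr_gt0.
Unshelve. all: by end_near. Qed.

End DualVariable.

Section Run.
Context {R : realType} {d : nat} {Y : completeNormedModType R}.
Variable T : R.
Hypothesis T0 : 0 < T.
Variable ip : {dot Y for idfun}.
Hypothesis hip : forall y, ip y y = `|y| ^+ 2.
Variables (K : (R -> 'rV[R]_d) -> Y) (Kstar : Y -> R -> 'rV[R]_d).
Hypotheses (hK : lin_cont_L2 T K) (hKstar : is_adjoint T ip K Kstar).
Variables (F : Y -> R) (gradF : Y -> Y) (beta : R).
Hypothesis beta0 : 0 < beta.
Local Notation kv := (kvec T K).
Local Notation J := (jump_objective kv F beta).
Implicit Types (vs : seq (jump R d)) (mu : seq R) (c v : 'rV[R]_d).

Lemma zip_in vs mu x : x \in zip mu vs -> x.2 \in vs.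
Proof.
move=> xz; have [n nz <-] := nthP (0, x.2) xz.
have [nm nv] : (n < size mu)%N /\ (n < size vs)%N.
  by move: nz; rewrite size_zip leq_min => /andP.
by rewrite nth_zip_cond nz /= mem_nth.
Qed.

Lemma map_zip (g : R * jump R d -> R) vs mu : size mu = size vs ->
  zip [seq g x | x <- zip mu vs] vs = [seq (g x, x.2) | x <- zip mu vs].
Proof.
by elim: mu vs => [|m mu ih] [|v vs] //= [] /ih ->.
Qed.

Lemma coeff_objectiveE vs mu c : size mu = size vs ->
  {in vs, forall w, is_jump T w} ->
  coeff_objective T beta K F vs mu c =
  J (zip mu vs) (c - mean_shift T (zip mu vs)).
Proof.
move=> sz vI; rewrite /coeff_objective /jump_objective (K_B_op hK); last first.
  by move=> x /zip_in/vI[]; rewrite /= in_itv.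
congr (_ + _ * _).
rewrite -(big_map fst xpredT id) /=; congr (\sum_(m <- _) m).
by rewrite -[LHS](@unzip1_zip _ _ mu vs) ?sz.
Qed.

Lemma active_part_in vs mu x : x \in active_part vs mu -> 0 < x.1 /\ x.2 \in vs.
Proof. by rewrite mem_filter => /andP[x0 /zip_in]. Qed.

Lemma active_part_sum (V : nmodType) vs mu (f : R * jump R d -> V) :
  all (fun m => 0 <= m) mu -> (forall x, x.1 = 0 -> f x = 0) ->
  \sum_(x <- active_part vs mu) f x = \sum_(x <- zip mu vs) f x.
Proof.
move=> mu0 f0; rewrite big_filter big_mkcond /= big_seq [RHS]big_seq.
apply: eq_bigr => x xz; case: ifPn => // x0; rewrite f0 //.
apply/eqP; rewrite eq_le leNgt x0 /=.
have [n nz <-] := nthP (x.1, x.2) xz.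
have nm : (n < size mu)%N by move: nz; rewrite size_zip leq_min => /andP[].
by rewrite nth_zip_cond nz /= (allP mu0) // mem_nth.
Qed.

Lemma active_part_Phi vs mu v : all (fun m => 0 <= m) mu ->
  Phi kv (active_part vs mu) v = Phi kv (zip mu vs) v.
Proof.
by move=> mu0; rewrite /Phi active_part_sum // => x ->; rewrite scale0r.
Qed.

Lemma active_part_shift vs mu : all (fun m => 0 <= m) mu ->
  mean_shift T (active_part vs mu) = mean_shift T (zip mu vs).
Proof.
move=> mu0; rewrite /mean_shift active_part_sum // => x ->.
by rewrite mul0r scale0r.
Qed.

Lemma active_part_objective vs mu v : all (fun m => 0 <= m) mu ->
  J (active_part vs mu) v = J (zip mu vs) v.
Proof. by move=> mu0; rewrite /jump_objective active_part_Phi // active_part_sum. Qed.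

Lemma minimizes_coeffs_le vs mu c mu' v : {in vs, forall w, is_jump T w} ->
  minimizes_coeffs T beta K F vs mu c -> size mu' = size vs ->
  all (fun m => 0 <= m) mu' ->
  J (active_part vs mu) (c - mean_shift T (active_part vs mu)) <= J (zip mu' vs) v.
Proof.
move=> vI [/andP[/eqP sz mu0] opt] sz' mu'0.
rewrite active_part_objective // active_part_shift // -coeff_objectiveE //.
(* The mean shift depends on the magnitudes; since the offset is free, adding the shift of mu' makes
   v the resulting value left of the first jump. *)
have := opt mu' (v + mean_shift T (zip mu' vs)).
rewrite /admissible_coeffs sz' eqxx mu'0 => /(_ isT) h; apply: le_trans h _.
by rewrite coeff_objectiveE // addrK.
Qed.

Variables (A : nat -> seq (R * jump R d)) (c : nat -> 'rV[R]_d) (that : nat -> R).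
Hypothesis run : PDAJ_run T beta K Kstar F gradF A c that.

Lemma active_sets n : {in A n, forall x, 0 < x.1 /\ is_jump T x.2}.
Proof.
elim: n => [|n ih] x xA; first exact: run_input run _ xA.
have [x0 xv] : 0 < x.1 /\ (x.2 \in map snd (A n) \/ is_jump T x.2).
  case: n ih xA => [|n] ih xA.
    have [mu [_ A1]] := run_init run.
    by move: xA; rewrite A1 => /active_part_in[x0 xv]; split => //; left.
  have [mu [_ An]] := run_step run (ltn0Sn n).
  move: xA; rewrite An => /active_part_in[x0]; rewrite mem_rcons inE.
  case/orP => [/eqP ->|xv]; split => //; [right|by left].
  have [tI tC] := run_choice run (ltn0Sn n).
  split => //=; rewrite enormZ tC.
  have P0 : 0 < Cnorm T (dual_var K Kstar gradF (iterate T (A n.+1) (c n.+1))).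
    exact: lt_trans beta0 (run_no_stop run (ltn0Sn n)).
  by rewrite gtr0_norm ?invr_gt0 // mulVf // gt_eqF.
split => //; case: xv => // /mapP[z zA ->].
by have [] := ih z zA.
Qed.

Lemma active_jumps n : {in map snd (A n), forall w, is_jump T w}.
Proof. by move=> v /mapP[x /active_sets[_ xJ] ->]. Qed.

Lemma run_minimizes n : exists vs mu, [/\ {in vs, forall w, is_jump T w},
  minimizes_coeffs T beta K F vs mu (c n.+1) & A n.+1 = active_part vs mu].
Proof.
case: n => [|n].
  have [mu [opt A1]] := run_init run.
  by exists (map snd (A 0%N)), mu; split => //; exact: active_jumps.
have [mu [opt An]] := run_step run (ltn0Sn n).
eexists _, mu; split; [|exact: opt|exact: An].
move=> v; rewrite mem_rcons inE => /orP[/eqP ->|]; last exact: active_jumps.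
have [tI tC] := run_choice run (ltn0Sn n).
split => //=; rewrite enormZ tC.
have P0 : 0 < Cnorm T (dual_var K Kstar gradF (iterate T (A n.+1) (c n.+1))).
  exact: lt_trans beta0 (run_no_stop run (ltn0Sn n)).
by rewrite gtr0_norm ?invr_gt0 // mulVf // gt_eqF.
Qed.

Let c' n := c n - mean_shift T (A n).

Lemma K_iterate n : K (iterate T (A n) (c n)) = Phi kv (A n) (c' n).
Proof.
by rewrite (K_B_op hK) // => x /active_sets[_ []]; rewrite /= in_itv.
Qed.

(** The index starts at 1: the input set [A 0] is not optimal for its own jumps. *)
Lemma run_opt_step n f v : {in A n.+1, forall x, 0 <= f x} ->
  J (A n.+1) (c' n.+1) <= J [seq (f x, x.2) | x <- A n.+1] v.
Proof.
move=> f0; have [vs [mu [vI opt An]]] := run_minimizes n.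
have [/andP[/eqP sz mu0] _] := opt.
(* A competitor on the active part is extended by magnitude 0 to the discarded jumps. *)
pose g (x : R * jump R d) := if 0 < x.1 then f x else 0.
have g0 : all (fun m => 0 <= m) [seq g x | x <- zip mu vs].
  apply/allP => _ /mapP[x xz ->]; rewrite /g; case: ifP => // x0.
  by apply: f0; rewrite An mem_filter x0.
have sg : size [seq g x | x <- zip mu vs] = size vs.
  by rewrite size_map size_zip sz minnn.
have := minimizes_coeffs_le v vI opt sg g0.
rewrite -An -/(c' n.+1) map_zip // => h; apply: le_trans h _.
rewrite le_eqVlt; apply/orP; left; apply/eqP.
rewrite /jump_objective !Phi_map !big_map /= An !big_filter.
congr (F (_ + _) + _ * _); rewrite [RHS]big_mkcond; apply: eq_bigr => x _.
  by rewrite /g; case: ifP => // _; rewrite scale0r.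
by rewrite /g; case: ifP.
Qed.

Lemma run_next_step n f m v (p := dual_var K Kstar gradF (iterate T (A n.+1) (c n.+1))) :
  {in A n.+1, forall x, 0 <= f x} -> 0 <= m ->
  J (A n.+2) (c' n.+2) <=
  J (rcons [seq (f x, x.2) | x <- A n.+1] (m, new_jump T p (that n.+1))) v.
Proof.
move=> f0 m0; have [mu [opt An]] := run_step run (ltn0Sn n).
set vs := rcons _ _ in opt An.
have vI : {in vs, forall w, is_jump T w}.
  have [vs' [mu' [? ? ?]]] := run_minimizes n.+1.
  move=> w; rewrite mem_rcons inE => /orP[/eqP ->|]; last exact: active_jumps.
  have [tI tC] := run_choice run (ltn0Sn n).
  split => //=; rewrite enormZ tC.
  have P0 : 0 < Cnorm T p by exact: lt_trans beta0 (run_no_stop run (ltn0Sn n)).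
  by rewrite gtr0_norm ?invr_gt0 // mulVf // gt_eqF.
have sz : size (rcons [seq f x | x <- A n.+1] m) = size vs.
  by rewrite !size_rcons !size_map.
have mu0 : all (fun m => 0 <= m) (rcons [seq f x | x <- A n.+1] m).
  by rewrite all_rcons m0 /=; apply/allP => _ /mapP[x xA ->]; exact: f0.
have := minimizes_coeffs_le v vI opt sz mu0.
rewrite -An -/(c' n.+2) /vs zip_rcons ?size_map //.
suff -> : zip [seq f x | x <- A n.+1] [seq i.2 | i <- A n.+1] =
  [seq (f x, x.2) | x <- A n.+1] by [].
by elim: (A n.+1) => //= x s ->.
Qed.

End Run.

Section JumpRepresentation.
Context {R : realType} {d : nat}.
Variable T : R.
Hypothesis T0 : 0 < T.
Local Notation leb := (@lebesgue_measure R).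
Local Notation I := (`]0, T[%classic : set (measurableTypeR R)).
Variables (u : R -> 'rV[R]_d) (B : seq (R * jump R d)).
Hypothesis BI : {in B, forall x, 0 < x.2.2 < T}.
Hypothesis uL1 : inLp T 1 u.
Hypothesis uB : is_distr_derivative T u (jump_sum B).

Lemma distr_derivative_B_op_ae : exists c,
  {ae leb, forall t, I t -> u t = B_op T (jump_sum B) c t}.
Proof.
pose b := B_op T (jump_sum B) 0.
have iu i := inLp_coord_integrable i (ltn0Sn 0) uL1.
have ib i := inLp_coord_integrable i (ltn0Sn 0)
  (bounded_meas_inLp 1 (bounded_meas_B_op 0 BI)).
have mI : measurable I by [].
have key i : exists k, {ae leb, forall t, I t -> u t 0 i - b t 0 i = k}.
  apply: du_bois_reymond => //.
    by have := integrableB mI (iu i) (ib i); apply: eq_integrable.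
  move=> phi tphi.
  have mphi' : measurable_fun I (derive1 phi).
    by apply: continuous_measurable_on; exact: test_derive_continuous tphi.
  have bphi' := continuous_bounded_on T0 (test_derive_continuous tphi).
  transitivity (\int[leb]_(x in I) (u x 0 i * derive1 phi x)
    - \int[leb]_(x in I) (b x 0 i * derive1 phi x)).
    rewrite -RintegralB //; [|exact: integrable_mul_bounded (iu i) mphi' bphi'
                             |exact: integrable_mul_bounded (ib i) mphi' bphi'].
    by apply: eq_Rintegral => x _; rewrite mulrBl.
  have := uB tphi i; have := distr_derivative_B_op T0 0 BI tphi i; rewrite -/b.
  by move=> -> /oppr_inj ->; rewrite subrr.
have [k hk] := choice key; exists (\row_i k i).
have : \forall t \ae leb, forall i, I t -> u t 0 i - b t 0 i = k i.
  by apply: filter_forall => i; exact: hk.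
apply: filterS => t h It; apply/rowP => i; have := h i It.
rewrite /b /B_op !mxE => <-; ring.
Qed.

End JumpRepresentation.

Theorem theorem23 (R : realType) (T : R) (d : nat)
  (hT : 0 < T) (hd : (1 <= d)%N)
  (Y : completeNormedModType R) (ip : {dot Y for idfun})
  (hip : forall y, ip y y = `|y| ^+ 2)
  (K : (R -> 'rV[R]_d) -> Y) (Kstar : Y -> R -> 'rV[R]_d)
  (hK : lin_cont_L2 T K) (hKstar : is_adjoint T ip K Kstar)
  (F : Y -> R) (gradF : Y -> Y)
  (hFconv : strictly_convex F) (hFgrad : is_gradient ip F gradF)
  (hFC1 : continuous gradF)
  (beta : R) (hbeta : 0 < beta)
  (hradial : radially_unbounded T beta K F)
  (ubar : R -> 'rV[R]_d) (hubar : is_minimizer T beta K F ubar)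
  (pbar := dual_var K Kstar gradF ubar)
  (L : R) (hL : 0 < L) (hLip : L.-lipschitz gradF)
  (gamma0 : R) (hgamma0 : 0 < gamma0)
  (hgrowth : \forall y \near K ubar,
     F (K ubar) + ip (gradF (K ubar)) (y - K ubar)
       + gamma0 * `|y - K ubar| ^+ 2 <= F y)
  (N : nat) (hN : (1 <= N)%N) (tbar : 'I_N -> R)
  (h_i : range tbar =
     [set t | [/\ `]0, T[%classic t, enorm (pbar t) = Cnorm T pbar &
                  Cnorm T pbar = beta]])
  (h_ii : lin_indep (fun j : 'I_N + 'I_d => match j with
     | inl i => K (indic_after T (tbar i) (pbar (tbar i)))
     | inr i => K (indic_after T 0 (delta_mx 0 i))
     end))
  (mubar : 'I_N -> R)
  (hderiv : is_distr_derivative T ubar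
     (jump_sum [seq (mubar i, (beta^-1 *: pbar (tbar i), tbar i))
               | i <- enum 'I_N]))
  (sigma rho : R) (hsigma : 0 < sigma) (hrho : 0 < rho)
  (hsub : forall i, `]tbar i - rho, tbar i + rho[ `<=` `]0, T[)
  (hdisj : forall i j, i != j ->
     `]tbar i - rho, tbar i + rho[ `&` `]tbar j - rho, tbar j + rho[ = set0)
  (hsep : forall t, `[0, T]%classic t ->
     (forall i, ~ `]tbar i - rho, tbar i + rho[%classic t) ->
     enorm (pbar t) <= beta - sigma)
  (h_iii_mu : forall i, 0 < mubar i)
  (theta0 : R) (htheta0 : 0 < theta0)
  (h_iii_theta : forall i t, `]tbar i - rho, tbar i + rho[%classic t ->
     theta0 * `|t - tbar i| ^+ 2 <= beta - enorm (pbar t))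
  (h_iii_K : cont_to_Linfty T Kstar)
  (A : nat -> seq (R * jump R d)) (c : nat -> 'rV[R]_d) (that : nat -> R)
  (hrun : PDAJ_run T beta K Kstar F gradF A c that)
  (u := fun k => iterate T (A k) (c k))
  (r := fun k => objective T beta K F (u k) - objective T beta K F ubar)
  (rhat := fun k => F (K (u k)) + beta * \sum_(x <- A k) x.1
                    - objective T beta K F ubar) :
  exists zeta C : R, [/\ 0 < zeta < 1, 0 < C &
    \forall k \near \oo, r k <= rhat k /\ rhat k <= C * zeta ^+ k].
Proof.
have mvb i : `]0, T[%classic (tbar i).
  by apply: (hsub i); rewrite /= in_itv /=; apply/andP; split; lra.
have tbI i : 0 < tbar i < T by have := mvb i; rewrite /= in_itv.
set B := [seq _ | i <- _] in hderiv.
have BI : {in B, forall x, 0 < x.2.2 < T} by move=> _ /mapP[i _ ->]; exact: tbI.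
have [c0 uae] := distr_derivative_B_op_ae hT BI hubar.1.1 hderiv.
pose kv := kvec T K; pose gb := gradF (K ubar).
have [Ck Ck0 lipk] := kvec_lip hip hKstar h_iii_K.
have bB c1 := bounded_meas_B_op c1 BI.
have KE : K ubar = K (B_op T (jump_sum B) c0).
  have [M hM] := (bB c0).2.
  apply: (K_ae_eq hK _ _ uae); last exact: bounded_meas_inLp.
  apply: (ae_bounded_inLp 2 hubar.1.1.1 (M := M)).
  by apply: filterS uae => t h It; rewrite h // hM.
have KB c1 := K_B_op hK c1 BI.
pose cb := c0 - mean_shift T B.
have PhiB v : Phi kv B v =
    \sum_i mubar i *: kap kv (tbar i) (beta^-1 *: pbar (tbar i)) + kap kv 0 v.
  by rewrite /Phi big_map big_enum.
have cvx := convex_gradient hFconv hFgrad.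
have lip x y : `|gradF x - gradF y| <= L * `|x - y|.
  exact: (hLip (x, y)).
have TVE c1 : TV T (B_op T (jump_sum B) c1) = TV T ubar.
  exact: TV_eq (distr_derivative_B_op hT c1 BI) hderiv.
(* The minimizer is compared with its translates by constants, which have the same variation. *)
have orth : orth_const ip kv gb.
  move=> i; rewrite -[LHS]addr0.
  apply: (@stationary _ _ ip hip F gradF L cvx lip) => t _; rewrite mulr0 addr0.
  have := hubar.2 (B_op T (jump_sum B) (c0 + t *: delta_mx 0 i)).
  rewrite /objective TVE lerD2r => h; apply: le_trans (h _) _.
    split; first exact: bounded_meas_inLp.
    by exists (jump_sum B); exact: distr_derivative_B_op.
  suff -> : K (B_op T (jump_sum B) (c0 + t *: delta_mx 0 i)) = K ubar + t *: kv i 0 by [].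
  by rewrite KE !KB -/kv !PhiB (addrAC c0) [kap kv 0 (_ + t *: _)]kapD kapZ kap_delta addrA.
have pbE t : 0 <= t <= T -> pbar t = pvar ip kv gb t.
  exact: primitive_pvar hKstar gb t.
have hC i : enorm (pbar (tbar i)) = Cnorm T pbar /\ Cnorm T pbar = beta.
  have : range tbar (tbar i) by exists i.
  by rewrite h_i => -[].
have CB : Cnorm T pbar = beta by exact: (hC (Ordinal hN)).2.
have pb_le t : 0 < t < T -> enorm (pvar ip kv gb t) <= beta.
  move=> tI; rewrite -CB -pbE ?in_cc //.
  exact: (dual_var_le_Cnorm hT hip hKstar h_iii_K).
have pb_tb i : enorm (pvar ip kv gb (tbar i)) = beta.
  by rewrite -pbE ?in_cc // (hC i).1.
have BJ : {in B, forall x, 0 <= x.1 /\ is_jump T x.2}.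
  move=> _ /mapP[i _ ->]; split; first exact: ltW (h_iii_mu i).
  split; [exact: mvb|rewrite /= enormZ (hC i).1 CB gtr0_norm ?invr_gt0 //].
  by rewrite mulVf // gt_eqF.
(* The test function pbar / beta has norm at most 1 and equals the direction of each jump at its
   point. Hence F (K ubar) plus beta times the sum of the mubar is at most min j, and a bound on the
   residual taken against it is a bound on [rhat]. *)
have Mb_TV : \sum_i mubar i <= TV T ubar.
  pose phi t := beta^-1 *: pvar ip kv gb t.
  have hphi : inC0 T phi by exact: (pvar_inC0 hT hip hK hKstar h_iii_K).
  have p1 : Cnorm T phi <= 1.
    apply: ge_sup; first by exists (enorm (phi (tbar (Ordinal hN)))), (tbar (Ordinal hN)).
    move=> _ [t + <-]; rewrite /= in_itv /= => tI.
    rewrite enormZ gtr0_norm ?invr_gt0 // mulrC ler_pdivrMr // mul1r.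
    exact: pb_le.
  have := TV_ge hT BJ hderiv hphi p1.
  rewrite (pairing_jump_sum hT BI hphi) big_map big_enum /=.
  rewrite (eq_bigr mubar) // => i _.
  rewrite /phi -pbE ?in_cc // -sqr_enorm enormZ (hC i).1 CB gtr0_norm ?invr_gt0 //.
  by rewrite mulVf ?gt_eqF // expr1n mulr1.
have [w hw] := dual_family hip h_ii.
(* The independent family in (ii) contains pbar itself, while the jump directions are pbar / beta;
   the factor beta on w compensates. *)
have w_jump i j : ip (beta *: w (inl i)) (kap kv (tbar j) (beta^-1 *: pvar ip kv gb (tbar j)))
    = (i == j)%:R.
  have := hw (inl i) (inl j); rewrite -pbE ?in_cc // (K_indic_after hK) => <-.
  by rewrite kapZ ipZl ipZr mulVKf ?gt_eqF.
have w_const i : orth_const ip kv (beta *: w (inl i)).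
  by move=> j; have := hw (inl i) (inr j); rewrite ipZl /= => ->; rewrite mulr0.
have [e e0 growth] : exists2 e, 0 < e & forall y, `|y - K ubar| <= e ->
    F (K ubar) + ip gb (y - K ubar) + gamma0 * `|y - K ubar| ^+ 2 <= F y.
  move: hgrowth => /nbhs_ballP[e /= e0 he]; exists (e / 2); first by rewrite divr_gt0.
  move=> y ye; apply: he; rewrite -ball_normE /= distrC (le_lt_trans ye) //; lra.
(* The run is shifted by one, since optimality holds from index 1 on, and the means become values
   left of the first jump. *)
pose A' n := A n.+1; pose c' n := c n.+1 - mean_shift T (A n.+1).
pose th n := that n.+1.
have KuE n : K (u n.+1) = Phi kv (A' n) (c' n) by exact: (K_iterate hK hbeta hrun).
have thI n : 0 < th n < T.
  by have [+ _] := run_choice hrun (ltn0Sn n); rewrite /= in_itv.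
have dE n t : 0 <= t <= T ->
    dual_var K Kstar gradF (u n.+1) t = pvar ip kv (gradF (Phi kv (A' n) (c' n))) t.
  by move=> tT; rewrite -KuE; exact: primitive_pvar hKstar _ t tT.
have PE n : Cnorm T (dual_var K Kstar gradF (u n.+1)) =
    enorm (pvar ip kv (gradF (Phi kv (A' n) (c' n))) (th n)).
  by rewrite -dE ?in_cc //; have [_ ->] := run_choice hrun (ltn0Sn n).
have HA n x : x \in A' n -> 0 < x.1 /\ is_jump T x.2.
  exact: (active_sets hbeta hrun).
have opt n f v := @run_opt_step _ _ _ _ _ _ hK _ _ _ hbeta _ _ _ hrun n f v.
have next n (f : R * jump R d -> R) (m : R) (v : 'rV[R]_d) :
    {in A' n, forall x, 0 <= f x} -> 0 <= m ->
    jump_objective kv F beta (A' n.+1) (c' n.+1) <=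
    jump_objective kv F beta (rcons [seq (f x, x.2) | x <- A' n]
      (m, ((enorm (pvar ip kv (gradF (Phi kv (A' n) (c' n))) (th n)))^-1 *:
         pvar ip kv (gradF (Phi kv (A' n) (c' n))) (th n), th n))) v.
  move=> f0 m0; have := @run_next_step _ _ _ _ _ _ hK _ _ _ hbeta _ _ _ hrun n f m v f0 m0.
  by rewrite /new_jump -/(u n.+1) PE dE; [exact: id|exact: in_cc (thI n)].
have P_max n t : 0 < t < T -> enorm (pvar ip kv (gradF (Phi kv (A' n) (c' n))) t) <=
    enorm (pvar ip kv (gradF (Phi kv (A' n) (c' n))) (th n)).
  move=> tI; rewrite -PE -dE ?in_cc //.
  exact: (dual_var_le_Cnorm hT hip hKstar h_iii_K).
have P_gt n : beta < enorm (pvar ip kv (gradF (Phi kv (A' n) (c' n))) (th n)).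
  by rewrite -PE; exact: (run_no_stop hrun (ltn0Sn n)).
have ybarE : K ubar = \sum_i mubar i *:
    kap kv (tbar i) (beta^-1 *: pvar ip kv gb (tbar i)) + kap kv 0 cb.
  rewrite KE KB -/kv PhiB; congr (_ + _); apply: eq_bigr => i _.
  by rewrite pbE ?in_cc.
have nearE i t : (`|t - tbar i| < rho) = (t \in `]tbar i - rho, tbar i + rho[).
  by rewrite ltr_distl in_itv.
have sep t : 0 < t < T -> (forall i, ~~ (`|t - tbar i| < rho)) ->
    enorm (pvar ip kv gb t) <= beta - sigma.
  move=> tI far; rewrite -pbE ?in_cc //; apply: hsep => [|i].
    by rewrite /= in_itv /= in_cc.
  by apply/negP; rewrite -nearE; exact: far.
have disj i j t : `|t - tbar i| < rho -> `|t - tbar j| < rho -> i = j.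
  rewrite !nearE => ti tj; apply/eqP; apply: contraT => /hdisj ij.
  suff : set0 t by [].
  by rewrite -ij.
have quad i t : `|t - tbar i| < rho ->
    theta0 * `|t - tbar i| ^+ 2 <= beta - enorm (pvar ip kv gb t).
  rewrite nearE => ti; have := hsub i _ ti; rewrite /= in_itv /= => tI.
  by rewrite -pbE ?in_cc //; exact: h_iii_theta.
have [z [C [z01 C0 rate]]] := linear_rate hip hT Ck0 lipk hL cvx lip hbeta HA opt next
  thI P_max P_gt hgamma0 e0 growth orth tbI h_iii_mu pb_tb ybarE pb_le hsigma htheta0
  sep disj quad w_jump w_const.
have z0 : 0 < z by case/andP: z01.
(* Dividing by z undoes the shift of the index by one. *)
exists z, (C / z); split => //; first exact: divr_gt0.
case: rate => m _ hm; exists m.+1 => // -[//|n] /= mn.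
have nI : {in A n.+1, forall x, 0 < x.2.2 < T}.
  by move=> x /HA[_ []]; rewrite /= in_itv.
split.
  rewrite lerD2r lerD2l ler_pM2l //; apply: (TV_le hT _ (distr_derivative_B_op hT (c n.+1) nI)).
  by move=> x /HA[/ltW].
have /hm := mn; rewrite /jump_objective -KuE exprS mulrA divfK ?gt_eqF //.
apply: le_trans; rewrite /A' lerD2l lerN2 /objective lerD2l ler_pM2l //.
Qed.
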